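(* MB Dom Game is $\mathrm{PSPACE}$-complete, even restricted to graphs $G$ with $\gamma(G)=1$.
   Context: All graphs are finite, simple and undirected. $\gamma(G)$ denotes the minimum size of a dominating set of $G$. The Maker-Breaker domination game on a graph $G$ is played by Dominator and Staller, who alternately claim one unclaimed vertex of $G$. Dominator wins if the vertices she claims contain a dominating set of $G$; otherwise Staller wins. MB Dom Game is the problem: given a graph $G$ and the first player (Dominator or Staller), decide which player has a winning strategy in the Maker-Breaker domination game on $G$ with the given player moving first. *)

(* Defs.v *)
From HB Require Import structures.
From mathcomp Require Import all_boot all_algebra.
Set Implicit Arguments.
Unset Strict Implicit.
Unset Printing Implicit Defensive.

Inductive move := Left | Stay | Right.

(* [tm_tapes.+1] is the number of tapes.  A tape cell is blank ([None]) or holds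
   an input bit or a symbol of the machine's own finite work alphabet. *)
Record turing_machine := TuringMachine {
  tm_tapes : nat;
  tm_state : finType;
  tm_work : finType;
  tm_start : tm_state;
  tm_halting : pred tm_state;
  tm_accepting : pred tm_state;
  tm_trans : tm_state ->
    {ffun 'I_tm_tapes.+1 -> option (bool + tm_work)} ->
    tm_state * ('I_tm_tapes.+1 -> option (bool + tm_work) * move) }.

Section Semantics.
Variable M : turing_machine.

Definition cell : Type := option (bool + tm_work M).
Definition tape_index : Type := 'I_(tm_tapes M).+1.

(* Tapes are infinite to the right only; a left move from cell 0 stays there. *)
Record config := Config {
  cfg_state : tm_state M;
  cfg_tape : tape_index -> nat -> cell;
  cfg_head : tape_index -> nat }.

Definition word_tape (x : seq bool) (p : nat) : cell := omap inl (onth x p).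

Definition init_config (x : seq bool) : config :=
  Config (tm_start M)
    (fun i => if i == ord0 then word_tape x else fun=> None)
    (fun=> 0).

Definition move_head (m : move) (p : nat) : nat :=
  match m with Left => p.-1 | Stay => p | Right => p.+1 end.

Definition step (c : config) : config :=
  if tm_halting (cfg_state c) then c else
  let a := tm_trans (cfg_state c) [ffun i => cfg_tape c i (cfg_head c i)] in
  Config a.1
    (fun i p => if p == cfg_head c i then (a.2 i).1 else cfg_tape c i p)
    (fun i => move_head (a.2 i).2 (cfg_head c i)).

Definition run (x : seq bool) (t : nat) : config := iter t step (init_config x).

Definition halts_at (x : seq bool) (t : nat) : Prop :=
  tm_halting (cfg_state (run x t)).

(* On each tape only the first [s] cells are ever scanned. *)
Definition runs_in_space (x : seq bool) (s : nat) : Prop :=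
  forall (t : nat) (i : tape_index), cfg_head (run x t) i < s.

Definition outputs_at (x : seq bool) (t : nat) (y : seq bool) : Prop :=
  cfg_tape (run x t) ord_max =1 word_tape y.

End Semantics.

Definition language := seq bool -> Prop.

Definition PSPACE (L : language) : Prop :=
  exists (M : turing_machine) (p : {poly nat}), forall x : seq bool,
    runs_in_space M x (p.[size x])%R /\
    exists t : nat, halts_at M x t /\
      (tm_accepting (cfg_state (run M x t)) <-> L x).

Definition polytime (f : seq bool -> seq bool) : Prop :=
  exists (M : turing_machine) (p : {poly nat}), forall x : seq bool,
    exists t : nat,
      [/\ t <= (p.[size x])%R, halts_at M x t & outputs_at M x t (f x)].

(* A decision problem is a class of (encoded) instances together with the
   yes-instances among them; this makes it possible to speak of the restriction
   of a problem to a subclass of its instances. *)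
Record problem := Problem { instances : language; property : language }.

Definition yes_instances (Q : problem) : language :=
  fun x => instances Q x /\ property Q x.

(* A reduction must produce genuine instances of the target problem. *)
Definition reduces_to (A : language) (Q : problem) : Prop :=
  exists f : seq bool -> seq bool, polytime f /\
    forall x, instances Q (f x) /\ (A x <-> yes_instances Q (f x)).

Definition PSPACE_hard (Q : problem) : Prop :=
  forall A : language, PSPACE A -> reduces_to A Q.

Definition PSPACE_complete (Q : problem) : Prop :=
  PSPACE (yes_instances Q) /\ PSPACE_hard Q.

Record graph := Graph {
  nvertices : nat;
  adj : rel 'I_nvertices;
  adj_sym : symmetric adj;
  adj_irr : irreflexive adj }.

Definition vertex (G : graph) := 'I_(nvertices G).

Definition dominating (G : graph) (D : {set vertex G}) : bool :=
  [forall v : vertex G, (v \in D) || [exists u in D, adj u v]].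

Definition gamma (G : graph) : nat :=
  #|[arg min_(D < [set: vertex G] | dominating D) #|D|]|.

Inductive player := Dominator | Staller.

Definition is_dominator (P : player) : bool :=
  if P is Dominator then true else false.
Definition player_of_bool (b : bool) : player :=
  if b then Dominator else Staller.
Lemma is_dominatorK : cancel is_dominator player_of_bool.
Proof. by case. Qed.
HB.instance Definition _ := Equality.copy player (can_type is_dominatorK).

Definition opponent (P : player) : player :=
  if P is Dominator then Staller else Dominator.

(* Moves are numbered from 0. *)
Definition mover (first : player) (i : nat) : player :=
  if odd i then opponent first else first.

Section Game.
Variables (G : graph) (first : player).

(* A play is recorded as the sequence of claimed vertices in chronological
   order; it is complete when every vertex has been claimed. *)
Definition complete_play (p : seq (vertex G)) : bool :=
  uniq p && (size p == nvertices G).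

Definition claimed (P : player) (p : seq (vertex G)) : {set vertex G} :=
  [set v in p | mover first (index v p) == P].

Definition dominator_wins (p : seq (vertex G)) : Prop :=
  exists2 D : {set vertex G}, D \subset claimed Dominator p & dominating D.

Definition wins (P : player) (p : seq (vertex G)) : Prop :=
  if P is Dominator then dominator_wins p else ~ dominator_wins p.

(* A strategy maps the history of the play to the next vertex to claim; the
   [option] only serves the graph without vertices. *)
Definition strategy := seq (vertex G) -> option (vertex G).

Definition legal_strategy (P : player) (s : strategy) : Prop :=
  forall h : seq (vertex G), uniq h -> size h < nvertices G ->
    mover first (size h) = P -> exists2 v, s h = Some v & v \notin h.

Definition follows (P : player) (s : strategy) (p : seq (vertex G)) : Prop :=
  forall i, i < size p -> mover first i = P -> onth p i = s (take i p).

Definition has_winning_strategy (P : player) : Prop :=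
  exists2 s : strategy, legal_strategy P s &
    forall p, complete_play p -> follows P s p -> wins P p.

End Game.

(* First player, then the order in unary, then the adjacency matrix by rows. *)
Definition encode (G : graph) (first : player) : seq bool :=
  is_dominator first :: nseq (nvertices G) true ++
  false :: [seq adj u v | u <- enum (vertex G), v <- enum (vertex G)].

Definition MB_Dom_Game_on (C : graph -> Prop) : problem :=
  {| instances := fun x =>
       exists (G : graph) (first : player), C G /\ x = encode G first;
     property := fun x =>
       exists (G : graph) (first : player),
         x = encode G first /\ has_winning_strategy G first Dominator |}.

Definition MB_Dom_Game : problem := MB_Dom_Game_on (fun=> True).

(* Main.v *)
(** Membership. A depth-first search of the game tree keeps the play in polynomially many bits,
    and each bit after one step is an arithmetic expression, with bounded sums, in the bits
    before the step. Such expressions are evaluated by a Turing machine whose tapes serve as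
    unary counters, within polynomial time.

    Hardness. By Savitch's recursion, acceptance in polynomial space becomes a quantified
    formula in conjunctive normal form: Dominator names the configuration in the middle of a
    run, Staller selects a half. The formula becomes a Maker-Breaker game on a hypergraph with
    Staller as Maker, who is always forced to play the stages of the formula in order: every
    hyperedge of a stage contains the keys of the stages before it, so Breaker wins by taking
    a key that Maker neglects. Finally the hyperedges become closed neighborhoods. Staller has
    to open with the universal vertex of the graph, which gives domination number one. The
    adjacency of the resulting graph is again an arithmetic expression, now in the input. *)
From HB Require Import structures.
From mathcomp Require Import all_boot all_algebra zify.
From Stdlib Require Import FunctionalExtensionality.
Require Import Defs.
Set Implicit Arguments.
Unset Strict Implicit.
Unset Printing Implicit Defensive.

(** * Programs on tapes and their Turing machines *)

(** No machine is built for the game or for the reduction themselves: both are brought down to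
    functions in a class closed under arithmetic, bounded sums and lookup in constant tables.
    Counters may be unary because all values that occur are polynomial in the input length. A
    completed hyperedge is not yet a win in the domination game: Staller still needs a vertex whose
    closed neighborhood she then owns, so some vertex adjacent to all of the hyperedge must be free
    at that moment. Hence the many copies. The hub is Dominator's forced answer to the universal
    vertex; it dominates everything except the copies of the hyperedges, so that only these are left
    to fight for. In the formula the obstacle is locality. The heads of a machine with several tapes
    may be far apart, so a window of the computation table does not show what they scan. Therefore
    every letter repeats the state and all scanned symbols, and the windows check, besides the
    transition, that these records agree and are right where the heads stand. *)

Definition sym := option (bool + void).
Definition mark : sym := Some (inl true).
Definition marked (s : sym) : bool := if s is Some (inl b) then b else false.

Definition tape := ((nat -> sym) * nat)%type.
Definition store := nat -> tape.
Definition scan (t : tape) : sym := t.1 t.2.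
Definition act (a : sym * move) (t : tape) : tape :=
  (fun p => if p == t.2 then a.1 else t.1 p, move_head a.2 t.2).
Definition upd (s : store) (w : nat) (t : tape) : store :=
  fun i => if i == w then t else s i.

(* [Act r w f] rewrites tape [w] according to the symbols scanned on [r] and [w]. *)
Inductive cmd :=
  | Act of nat & nat & (sym -> sym -> sym * move)
  | Seq of cmd & cmd
  | While of nat & pred sym & cmd.

Fixpoint state (P : cmd) : finType :=
  match P with
  | Act _ _ _ => unit
  | Seq a b => (state a + state b)%type
  | While _ _ a => option (state a)
  end.

Fixpoint start (P : cmd) : state P :=
  match P return state P with
  | Act _ _ _ => tt
  | Seq a b => inl (start a)
  | While _ _ _ => None
  end.

(* The successor state ([None] on exit), and the action on the one tape that is changed. *)
Fixpoint trans (P : cmd) :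
    state P -> (nat -> sym) -> option (state P) * (nat * (sym * move)) :=
  match P return state P -> (nat -> sym) ->
      option (state P) * (nat * (sym * move)) with
  | Act r w f => fun _ v => (None, (w, f (v r) (v w)))
  | Seq a b => fun s v =>
      match s with
      | inl s => let u := trans s v in
          (Some (if u.1 is Some s' then inl s' else inr (start b)), u.2)
      | inr s => let u := trans s v in (omap inr u.1, u.2)
      end
  | While r p a => fun s v =>
      match s with
      | None => (if p (v r) then Some (Some (start a)) else None, (r, (v r, Stay)))
      | Some s => let u := trans s v in (Some u.1, u.2)
      end
  end.

Definition after (u : nat * (sym * move)) (s : store) : store :=
  upd s u.1 (act u.2 (s u.1)).
Definition scans (s : store) : nat -> sym := fun i => scan (s i).

(** [ok] is asked of every store from which a step is taken: trivial when only time matters, a bound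
    on the heads when space matters. The final store is not covered. *)
Inductive runs (ok : store -> Prop) (P : cmd) : state P -> store -> nat -> store -> Prop :=
  | RunsExit q s : ok s -> (trans q (scans s)).1 = None ->
      runs ok q s 1 (after (trans q (scans s)).2 s)
  | RunsStep q s q' n s' : ok s -> (trans q (scans s)).1 = Some q' ->
      runs ok q' (after (trans q (scans s)).2 s) n s' -> runs ok q s n.+1 s'.

Definition exec ok P s n s' := runs ok (start P) s n s'.

Lemma upd_id s w : upd s w (s w) = s.
Proof. by apply: functional_extensionality => i; rewrite /upd; case: eqP => [->|]. Qed.

Lemma upd_eq s w t : upd s w t w = t.
Proof. by rewrite /upd eqxx. Qed.

Lemma updd s w t t' : upd (upd s w t) w t' = upd s w t'.
Proof. by apply: functional_extensionality => i; rewrite /upd; case: eqP. Qed.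

Lemma act_id t : act (scan t, Stay) t = t.
Proof.
case: t => c h; rewrite /act /scan /=; congr pair.
by apply: functional_extensionality => p; case: eqP => [->|].
Qed.

Lemma exec_act (ok : store -> Prop) r w f s : ok s ->
  exec ok (Act r w f) s 1 (upd s w (act (f (scan (s r)) (scan (s w))) (s w))).
Proof. by move=> oks; have := @RunsExit ok (Act r w f) tt s oks erefl. Qed.

Lemma exec_seq ok a b s n s1 m s' :
  exec ok a s n s1 -> exec ok b s1 m s' -> exec ok (Seq a b) s (n + m) s'.
Proof.
rewrite /exec /= => A B.
have {}B : runs ok (inr (start b) : state (Seq a b)) s1 m s'.
  elim: B => [q t oks e|q t q' k t' oks e _ IH].
    by apply: (@RunsExit ok (Seq a b) (inr q)) => //=; rewrite e.
  by apply: (@RunsStep ok (Seq a b) (inr q) _ (inr q')) => //=; rewrite e.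
elim: A B => [q {}s oks e|q {}s q' k t oks e _ IH] B.
  by rewrite add1n; apply: (@RunsStep ok (Seq a b) (inl q) _ (inr (start b))) => //=; rewrite e.
rewrite addSn; apply: (@RunsStep ok (Seq a b) (inl q) _ (inl q')) => //=; rewrite ?e //.
exact: IH.
Qed.

Lemma after_id s r : after (r, (scans s r, Stay)) s = s.
Proof. by rewrite /after /= act_id upd_id. Qed.

Lemma exec_while_exit (ok : store -> Prop) r (p : pred sym) a s : ok s -> ~~ p (scan (s r)) ->
  exec ok (While r p a) s 1 s.
Proof.
move=> oks /negbTE np.
have := @RunsExit ok (While r p a) None s oks; rewrite /= np after_id; exact.
Qed.

Lemma exec_while_step (ok : store -> Prop) r (p : pred sym) a s n s1 m s' : ok s -> p (scan (s r)) ->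
  exec ok a s n s1 -> exec ok (While r p a) s1 m s' ->
  exec ok (While r p a) s (n + m).+1 s'.
Proof.
move=> oks ps A B.
apply: (@RunsStep ok (While r p a) None s (Some (start a))) => //=; rewrite ?ps //.
rewrite after_id {oks ps}.
elim: A B => [q {}s oks e|q {}s q' k t oks e _ IH] B.
  by rewrite add1n; apply: (@RunsStep ok (While r p a) (Some q) _ None) => //=; rewrite e.
rewrite addSn; apply: (@RunsStep ok (While r p a) (Some q) _ (Some q')) => //=; rewrite ?e //.
exact: IH.
Qed.

Lemma runs_weaken (ok ok' : store -> Prop) P (q : state P) s n s' :
  (forall s, ok s -> ok' s) -> runs ok q s n s' -> runs ok' q s n s'.
Proof. by move=> sub; elim=> *; [apply: RunsExit|apply: RunsStep]; eauto. Qed.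

Definition heads_le (h : nat) (s : store) : Prop := forall i, (s i).2 <= h.

(** Time bounds space, since a step moves one head by at most one cell. *)
Lemma runs_heads P (q : state P) s n s' h :
  runs (fun=> True) q s n s' -> heads_le h s -> runs (heads_le (h + n)) q s n s'.
Proof.
move=> A; elim: A h => {q s n s'} [q s _ e|q s q' n s' _ e _ IH] h hs.
  by apply: RunsExit => // i; apply: leq_trans (hs i) _; rewrite leq_addr.
apply: RunsStep e _; first by move=> i; apply: leq_trans (hs i) _; rewrite leq_addr.
rewrite addnS -addSn; apply: IH => i; rewrite /after /upd.
case: eqP => _; last exact: leq_trans (hs i) _.
by rewrite /act /=; move: (hs (trans q (scans s)).2.1); case: (_.2.2.2) => /=; lia.
Qed.

Fixpoint tapes_le (K : nat) (P : cmd) : bool :=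
  match P with
  | Act r w _ => (r <= K) && (w <= K)
  | Seq a b => tapes_le K a && tapes_le K b
  | While r _ a => (r <= K) && tapes_le K a
  end.

Lemma trans_local K P (q : state P) v v' : tapes_le K P ->
  (forall i, i <= K -> v i = v' i) -> trans q v = trans q v'.
Proof.
move=> tP e; elim: P q tP => [r w f|a IHa b IHb|r p a IHa] /=.
- by move=> _ /andP[rK wK]; rewrite !e.
- by move=> [] q /andP[? ?]; rewrite ?(IHa q) ?(IHb q).
- by move=> [q|] /andP[rK aK]; rewrite ?(IHa q) ?e.
Qed.

Lemma trans_tape K P (q : state P) v : tapes_le K P -> (trans q v).2.1 <= K.
Proof.
elim: P q => [r w f|a IHa b IHb|r p a IHa] /=.
- by move=> _ /andP[].
- by move=> [] q /andP[? ?]; rewrite ?IHa ?IHb.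
- by move=> [q|] /andP[rK aK] //=; apply: IHa.
Qed.

(** * The Turing machine of a program *)

Section Machine.
Variables (K : nat) (P : cmd) (r : nat).
Hypothesis tP : tapes_le K P.

Definition extend (v : {ffun 'I_K.+1 -> sym}) (i : nat) : sym :=
  if insub i is Some j then v j else None.

(** A program has no verdict of its own: after its exit, the state [inl None] spends one more step
    to turn the symbol scanned on tape [r] into an accepting or a rejecting halt. *)
Definition machine : turing_machine :=
  @TuringMachine K (option (state P) + bool)%type void (inl (Some (start P)))
    (fun q => if q is inr _ then true else false)
    (fun q => if q is inr b then b else false)
    (fun q v =>
       match q with
       | inl (Some q) => let u := trans q (extend v) in
           (inl u.1, fun i : 'I_K.+1 => if val i == u.2.1 then u.2.2 else (v i, Stay))
       | inl None => (inr (marked (extend v r)), fun i => (v i, Stay))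
       | inr b => (inr b, fun i => (v i, Stay))
       end).

Definition conf (q : tm_state machine) (s : store) : config machine :=
  @Config machine q (fun i => (s i).1) (fun i => (s i).2).

Lemma extendE (s : store) i : i <= K ->
  extend [ffun i : 'I_K.+1 => (s i).1 (s i).2] i = scan (s i).
Proof. by rewrite /extend => iK; rewrite insubT ffunE. Qed.

Lemma config_eq (q : tm_state machine) f f' g g' : (forall i, f i = f' i) ->
  (forall i, g i = g' i) -> @Config machine q f g = @Config machine q f' g'.
Proof. by move=> /functional_extensionality -> /functional_extensionality ->. Qed.

Lemma step_machine (q : state P) s :
  step (conf (inl (Some q)) s) =
  conf (inl (trans q (scans s)).1) (after (trans q (scans s)).2 s).
Proof.
rewrite /step /=.
have -> : trans q (extend [ffun i : 'I_K.+1 => (s i).1 (s i).2]) = trans q (scans s).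
  by apply: (@trans_local K) => // i iK; rewrite extendE.
apply: config_eq => i; rewrite /after /upd.
  apply: functional_extensionality => p; case: (val i =P _) => [<-|_] //=.
  by rewrite ffunE; case: eqP => [->|].
by case: (val i =P _) => [<-|].
Qed.

Lemma machine_runs ok (q : state P) s n s' : runs ok q s n s' ->
  iter n (@step machine) (conf (inl (Some q)) s) = conf (inl None) s' /\
  forall k, k < n ->
    exists q' s1, ok s1 /\ iter k (@step machine) (conf (inl (Some q)) s) = conf q' s1.
Proof.
elim=> {q s n s'} [q s oks e|q s q' n s' oks e _ [IH1 IH2]].
  rewrite [iter 1 _ _]/= step_machine e; split => // -[|//] _.
  by exists (inl (Some q)), s.
rewrite iterSr step_machine e; split => // -[|k] kn; first by exists (inl (Some q)), s.
by rewrite iterSr step_machine e; apply: IH2.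
Qed.

Definition input_store (x : seq bool) : store :=
  fun i => if i == 0 then (fun p => omap inl (onth x p), 0) else (fun=> None, 0).

Lemma init_machine x : init_config machine x = conf (inl (Some (start P))) (input_store x).
Proof.
apply: config_eq => i; rewrite /input_store; first by rewrite -val_eqE /=; case: eqP.
by case: eqP.
Qed.

Lemma run_machine ok x n s' : exec ok P (input_store x) n s' ->
  run machine x n.+1 = conf (inr (marked (extend [ffun i : 'I_K.+1 => (s' i).1 (s' i).2] r))) s'.
Proof.
move=> /machine_runs[e _]; rewrite /run iterS init_machine e /step /=.
apply: config_eq => i //=; apply: functional_extensionality => p; rewrite ffunE.
by case: eqP => [->|].
Qed.

Lemma machine_time ok x n s' y : exec ok P (input_store x) n s' ->
  (s' K).1 =1 word_tape machine y ->
  halts_at machine x n.+1 /\ outputs_at machine x n.+1 y.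
Proof. by rewrite /halts_at /outputs_at => /run_machine ->. Qed.

Lemma machine_space h x n s' : exec (heads_le h) P (input_store x) n s' -> heads_le h s' ->
  r <= K ->
  [/\ runs_in_space machine x h.+1, halts_at machine x n.+1
    & tm_accepting (cfg_state (run machine x n.+1)) = marked (scan (s' r))].
Proof.
move=> E hs' rK; rewrite /halts_at (run_machine E) /=; split=> //; last by rewrite extendE.
move=> t i; rewrite ltnS; have [tn|nt] := ltnP t n.
  have [_ /(_ t tn)[q [s1 [oks e]]]] := machine_runs E.
  by rewrite /run init_machine e; exact: oks.
move: nt; rewrite leq_eqVlt => /predU1P[<-|nt].
  by have [e _] := machine_runs E; rewrite /run init_machine e; exact: hs'.
rewrite /run -(subnK nt) iterD; have := run_machine E; rewrite /run => ->.
by rewrite iter_fix //; exact: hs'.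
Qed.
End Machine.

(** * Counters and arithmetic expressions *)

(** The base is at least 2, so a larger exponent absorbs constants and sums. *)
Definition polybounded (f : nat -> nat) : Prop :=
  exists c, forall n, f n <= (n + 2) ^ c.

Lemma leq_exp m n e : m <= n -> m ^ e <= n ^ e.
Proof. by case: e => // e mn; rewrite leq_exp2r. Qed.

Lemma polybounded_le f g : (forall n, f n <= g n) -> polybounded g -> polybounded f.
Proof. by move=> fg [c gc]; exists c => n; apply: leq_trans (fg n) (gc n). Qed.

Lemma polybounded_id : polybounded (fun n => n).
Proof. by exists 1 => n; rewrite expn1; lia. Qed.

Lemma polybounded_const c : polybounded (fun=> c).
Proof.
exists c => n; apply: leq_trans (ltnW (ltn_expl c (isT : 1 < 2))) _.
by apply: leq_exp; lia.
Qed.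

Lemma polybounded_mul f g : polybounded f -> polybounded g ->
  polybounded (fun n => f n * g n).
Proof. by move=> [c fc] [d gd]; exists (c + d) => n; rewrite expnD leq_mul. Qed.

Lemma polybounded_add f g : polybounded f -> polybounded g ->
  polybounded (fun n => f n + g n).
Proof.
move=> [c fc] [d gd]; exists (c + d).+1 => n; rewrite expnS expnD.
have := fc n; have := gd n.
have : 0 < (n + 2) ^ c by rewrite expn_gt0 addn2.
have : 0 < (n + 2) ^ d by rewrite expn_gt0 addn2.
move: (_ ^ c) (_ ^ d) (f n) (g n) => a b u v; nia.
Qed.

Lemma polybounded_comp f g : polybounded f -> polybounded g ->
  polybounded (fun n => f (g n)).
Proof.
move=> [c fc] [d gd]; exists (d.+2 * c) => n; apply: leq_trans (fc _) _.
rewrite expnM; apply: leq_exp; apply: leq_trans (leq_add (gd n) (leqnn 2)) _.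
rewrite !expnS; have : 0 < (n + 2) ^ d by rewrite expn_gt0 addn2.
move: (_ ^ d) => a; nia.
Qed.

Lemma polybounded_poly f : polybounded f ->
  exists p : {poly nat}, forall n, f n <= (p.[n])%R.
Proof.
move=> [c fc]; exists (('X + 2%:P) ^+ c)%R => n; apply: leq_trans (fc n) _.
by rewrite horner_exp hornerD hornerX hornerC -natrXE.
Qed.

(* A tape holding the number [n] carries [n] marks, with the head behind them. *)
Definition ctr (n : nat) : tape := (fun p => if p < n then mark else None, n).
Definition ctr_left (n : nat) : tape := ((ctr n).1, n.-1).
Definition word_at (x : seq bool) (p : nat) : tape := (fun q => omap inl (onth x q), p).
Notation word x := (word_at x 0).
Arguments ctr : simpl never.
Arguments word_at : simpl never.

Definition left_ (r : nat) := Act r r (fun s _ => (s, Left)).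
Definition right_ (r : nat) := Act r r (fun s _ => (s, Right)).
Definition erase (r : nat) := Act r r (fun _ _ => (None, Stay)).
Definition incr (r : nat) := Act r r (fun _ _ => (mark, Right)).
Definition decr (r : nat) := Seq (left_ r) (erase r).
Definition skip := Act 0 0 (fun s _ => (s, Stay)).
(* Since a left move from cell 0 stays there, testing a counter for zero needs no end marker;
   the loop decrements the counter before each round. *)
Definition loop (r : nat) (P : cmd) :=
  Seq (left_ r) (While r isSome (Seq (erase r) (Seq P (left_ r)))).

Lemma tape_eq (t t' : tape) : t.1 =1 t'.1 -> t.2 = t'.2 -> t = t'.
Proof. by case: t t' => [a b] [c d] /= /functional_extensionality -> ->. Qed.

Lemma act_incr n : act (mark, Right) (ctr n) = ctr n.+1.
Proof.
apply: tape_eq => // p /=; rewrite ltnS.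
by case: (ltngtP p n).
Qed.

Lemma act_left n : act (scan (ctr n), Left) (ctr n) = ctr_left n.
Proof.
by apply: tape_eq => // p /=; case: eqP => // ->; rewrite ltnn.
Qed.

Lemma act_erase n : act (None, Stay) (ctr_left n) = ctr n.-1.
Proof.
apply: tape_eq => // p; case: n => [|n] /=; first by case: eqP.
by rewrite ltnS; case: ltngtP.
Qed.

Lemma isSome_left n : isSome (scan (ctr_left n)) = (0 < n).
Proof. by case: n => //= n; rewrite /scan /= ltnSn. Qed.

Definition within P s B s' := exists n, n <= B /\ exec (fun=> True) P s n s'.

Lemma within_le P s B B' s' : within P s B s' -> B <= B' -> within P s B' s'.
Proof. by move=> [n [nB E]] BB'; exists n; split=> //; apply: leq_trans nB BB'. Qed.

Lemma within_act r w f s :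
  within (Act r w f) s 1 (upd s w (act (f (scan (s r)) (scan (s w))) (s w))).
Proof. by exists 1; split=> //; apply: exec_act. Qed.

Lemma within_seq a b s A s1 B s' :
  within a s A s1 -> within b s1 B s' -> within (Seq a b) s (A + B) s'.
Proof.
move=> [n [nA E]] [m [mB F]]; exists (n + m); split; first exact: leq_add.
exact: exec_seq E F.
Qed.

Lemma within_exit r (p : pred sym) a s : ~~ p (scan (s r)) -> within (While r p a) s 1 s.
Proof. by move=> np; exists 1; split=> //; apply: exec_while_exit. Qed.

Lemma within_step r (p : pred sym) a s A s1 B s' : p (scan (s r)) ->
  within a s A s1 -> within (While r p a) s1 B s' ->
  within (While r p a) s (A + B).+1 s'.
Proof.
move=> ps [n [nA E]] [m [mB F]]; exists (n + m).+1; split; first exact: leq_add.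
exact: exec_while_step ps E F.
Qed.

Lemma within_incr r s n : s r = ctr n -> within (incr r) s 1 (upd s r (ctr n.+1)).
Proof. by move=> sr; have := within_act r r (fun _ _ => (mark, Right)) s; rewrite sr act_incr. Qed.

Lemma within_left r s n : s r = ctr n -> within (left_ r) s 1 (upd s r (ctr_left n)).
Proof. by move=> sr; have := within_act r r (fun t _ => (t, Left)) s; rewrite sr act_left. Qed.

Lemma within_erase r s n : s r = ctr_left n -> within (erase r) s 1 (upd s r (ctr n.-1)).
Proof. by move=> sr; have := within_act r r (fun _ _ => (None, Stay)) s; rewrite sr act_erase. Qed.

Lemma within_decr r s n : s r = ctr n -> within (decr r) s 2 (upd s r (ctr n.-1)).
Proof.
move=> sr; apply: (@within_seq _ _ _ 1 _ 1 _ (within_left sr)).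
by have := @within_erase r (upd s r (ctr_left n)) n; rewrite updd upd_eq; apply.
Qed.

Lemma within_skip s : within skip s 1 s.
Proof. by have := within_act 0 0 (fun t _ => (t, Stay)) s; rewrite act_id upd_id. Qed.

(** [J i] is the store after [i] rounds. A round costs three steps beyond the body (test, erasure,
    left move); the two extra steps are the left move in front and the last test. *)
Lemma within_loop r P n T (J : nat -> store) :
  (forall i, i <= n -> J i r = ctr (n - i)) ->
  (forall i, i < n -> within P (upd (J i) r (ctr (n - i.+1))) T (J i.+1)) ->
  within (loop r P) (J 0) (n * (T + 3) + 2) (J n).
Proof.
move=> Jr JP.
suff W : within (While r isSome (Seq (erase r) (Seq P (left_ r))))
    (upd (J 0) r (ctr_left n)) (n * (T + 3) + 1) (J n).
  have J0 : J 0 r = ctr n by rewrite Jr // subn0.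
  by apply: within_le (within_seq (within_left J0) W) _; lia.
elim: n J Jr JP => [|n IH] J Jr JP.
  have -> : upd (J 0) r (ctr_left 0) = J 0.
    by rewrite -[RHS](upd_id _ r) Jr //; congr upd; apply: tape_eq.
  by apply: within_exit; rewrite Jr.
have eT : ((1 + (T + 1)) + (n * (T + 3) + 1)).+1 <= n.+1 * (T + 3) + 1 by lia.
apply: within_le (eT).
apply: (@within_step _ _ _ _ _ (upd (J 1) r (ctr_left n))).
- by rewrite upd_eq isSome_left.
- apply: within_seq; first by apply: within_erase; rewrite upd_eq.
  rewrite updd; apply: within_seq; last by apply: within_left; rewrite Jr // subn1.
  by have := JP 0 isT; rewrite subn1.
- apply: (IH (fun i => J i.+1)) => i ni; first by rewrite Jr.
  by have := JP i.+1 ni.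
Qed.

(* [Var n] counts binders outwards; reading a word gives 0 beyond its end, else 1 + the bit. *)
Inductive expr :=
  | Var of nat
  | One
  | Len
  | Rdx of expr
  | Rdy of expr
  | Add of expr & expr
  | Sub of expr & expr
  | Mul of expr & expr
  | Sum of expr & expr.

Definition read (x : seq bool) (p : nat) : nat := if onth x p is Some b then b.+1 else 0.

Definition scons (i : nat) (env : nat -> nat) (n : nat) : nat :=
  if n is m.+1 then env m else i.

Fixpoint eval (x y : seq bool) (env : nat -> nat) (e : expr) : nat :=
  match e with
  | Var n => env n
  | One => 1
  | Len => size x
  | Rdx e => read x (eval x y env e)
  | Rdy e => read y (eval x y env e)
  | Add e1 e2 => eval x y env e1 + eval x y env e2
  | Sub e1 e2 => eval x y env e1 - eval x y env e2
  | Mul e1 e2 => eval x y env e1 * eval x y env e2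
  | Sum e1 e2 => \sum_(i < eval x y env e1) eval x y (scons i env) e2
  end.

Lemma read_le x p : read x p <= 2.
Proof. by rewrite /read; case: onth => // -[]. Qed.

Lemma eval_polybounded e : exists2 V, polybounded V &
  forall x y env B, size x <= B -> (forall i, env i <= B) -> eval x y env e <= V B.
Proof.
have R1 := polybounded_const 1; have R2 := polybounded_const 2; have I := polybounded_id.
elim: e => [n|||e [V pV IH]|e [V pV IH]|e1 [V1 pV1 IH1] e2 [V2 pV2 IH2]
  |e1 [V1 pV1 IH1] e2 [V2 pV2 IH2]|e1 [V1 pV1 IH1] e2 [V2 pV2 IH2]|e1 [V1 pV1 IH1] e2 [V2 pV2 IH2]].
- by exists (fun B => B) => // x y env B _ /=; apply.
- by exists (fun=> 1).
- by exists (fun B => B).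
- by exists (fun=> 2) => // x y env B _ _ /=; apply: read_le.
- by exists (fun=> 2) => // x y env B _ _ /=; apply: read_le.
- exists (fun n => V1 n + V2 n); first exact: polybounded_add.
  by move=> x y env B xB eB /=; rewrite leq_add ?IH1 ?IH2.
- exists V1 => // x y env B xB eB /=.
  by apply: leq_trans (leq_subr _ _) _; apply: IH1.
- exists (fun n => V1 n * V2 n); first exact: polybounded_mul.
  by move=> x y env B xB eB /=; rewrite leq_mul ?IH1 ?IH2.
(* The summation index stays below [V1 n], so it enlarges the bound on the environment to
   [n + V1 n]. *)
- exists (fun n => V1 n * V2 (n + V1 n)).
    by apply: polybounded_mul => //; apply: polybounded_comp => //; apply: polybounded_add.
  move=> x y env B xB eB /=; have h := IH1 x y env B xB eB.
  apply: (@leq_trans (\sum_(i < eval x y env e1) V2 (B + V1 B))); last first.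
    by rewrite sum_nat_const card_ord leq_mul.
  apply: leq_sum => i _; apply: IH2 => [|[|j]] /=; first by lia.
    by have := ltn_ord i; lia.
  by have := eB j; lia.
Qed.

Arguments scan : simpl never.
Arguments act : simpl never.

(** Counter [k] is used up to advance the head on [a], while [k.+1] records the distance for the way
    back. The two [Act]s add up to the value of [read]: one mark for a nonblank cell, another for a
    true bit. *)
Definition comp_read (k out a : nat) :=
  Seq (loop k (Seq (incr k.+1) (right_ a)))
  (Seq (Act a out (fun s t => if isSome s then (mark, Right) else (t, Stay)))
  (Seq (Act a out (fun s t => if marked s then (mark, Right) else (t, Stay)))
    (loop k.+1 (left_ a)))).

(* Adds the value of [e] to tape [out]; [vs] lists the tapes of the variables, and the tapes
   from [k] on are free. *)
Fixpoint comp (vs : seq nat) (k : nat) (e : expr) (out : nat) : cmd :=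
  match e with
  | Var n =>
      if n < size vs then
        Seq (loop (nth 0 vs n) (incr k)) (loop k (Seq (incr (nth 0 vs n)) (incr out)))
      else skip
  | One => incr out
  | Len => Seq (While 0 isSome (Seq (right_ 0) (Seq (incr k) (incr out))))
             (loop k (left_ 0))
  | Rdx e => Seq (comp vs k.+1 e k) (comp_read k out 0)
  | Rdy e => Seq (comp vs k.+1 e k) (comp_read k out 1)
  | Add e1 e2 => Seq (comp vs k e1 out) (comp vs k e2 out)
  | Sub e1 e2 => Seq (comp vs k.+2 e1 k) (Seq (comp vs k.+2 e2 k.+1)
      (Seq (loop k.+1 (decr k)) (loop k (incr out))))
  | Mul e1 e2 => Seq (comp vs k.+1 e1 k) (loop k (comp vs k.+1 e2 out))
  | Sum e1 e2 => Seq (comp vs k.+1 e1 k) (loop k (comp (k :: vs) k.+1 e2 out))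
  end.

Ltac store_eq :=
  apply: functional_extensionality => ?; rewrite /upd;
  repeat (case: eqP => //= ?); try congruence; try lia.

Ltac store_at := rewrite /upd; repeat (case: eqP => //= ?); try congruence; try lia.

(** As [loop] decrements before each round, the body sees [m - 1] down to [0] on tape [k]. So the
    loop counter itself can be the tape of the index of a [Sum], and the sum is accumulated
    backwards. *)
Lemma within_acc k P out s m n g T : k != out -> s k = ctr m -> s out = ctr n ->
  (forall i n', i < m ->
    within P (upd (upd s k (ctr i)) out (ctr n')) T
             (upd (upd s k (ctr i)) out (ctr (n' + g i)))) ->
  within (loop k P) s (m * (T + 3) + 2)
    (upd (upd s k (ctr 0)) out (ctr (n + \sum_(i < m) g i))).
Proof.
move=> /eqP ko sk so step.
pose J i := upd (upd s k (ctr (m - i))) out (ctr (n + \sum_(j < i) g (m - j.+1))).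
have -> : upd (upd s k (ctr 0)) out (ctr (n + \sum_(i < m) g i)) = J m.
  by rewrite /J subnn [X in n + X](reindex_inj rev_ord_inj).
have e0 : s = J 0 by rewrite /J big_ord0 addn0 subn0; store_eq.
rewrite {1}e0; apply: within_loop => i im.
  by rewrite /J; store_at.
rewrite {2}/J big_ord_recr /= addnA.
have -> : upd (J i) k (ctr (m - i.+1)) =
   upd (upd s k (ctr (m - i.+1))) out (ctr (n + \sum_(j < i) g (m - j.+1))).
  by rewrite /J; store_eq.
by apply: step; lia.
Qed.

Lemma within_move r k s n m : r <> k -> s r = ctr n -> s k = ctr m ->
  within (loop r (incr k)) s (n * 4 + 2) (upd (upd s r (ctr 0)) k (ctr (m + n))).
Proof.
move=> rk sr sk.
have := @within_acc r (incr k) k s n m (fun=> 1) 1.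
rewrite sum_nat_const card_ord muln1; apply => //; first exact/eqP.
move=> i n' _; rewrite addn1 -[X in within _ _ _ X](updd _ k (ctr n')).
by apply: within_incr; rewrite upd_eq.
Qed.

Lemma within_right a s c p : s a = (c, p) -> within (right_ a) s 1 (upd s a (c, p.+1)).
Proof.
move=> sa; have := within_act a a (fun t _ => (t, Right)) s; rewrite sa.
by congr within; congr upd; apply: tape_eq => //= q; case: eqP => // ->.
Qed.

Lemma within_left_word a s c p : s a = (c, p) -> within (left_ a) s 1 (upd s a (c, p.-1)).
Proof.
move=> sa; have := within_act a a (fun t _ => (t, Left)) s; rewrite sa.
by congr within; congr upd; apply: tape_eq => //= q; case: eqP => // ->.
Qed.

Lemma within_rewind a k s c p n : a != k -> p <= n -> s a = (c, p) -> s k = ctr n ->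
  within (loop k (left_ a)) s (n * 4 + 2) (upd (upd s k (ctr 0)) a (c, 0)).
Proof.
move=> /eqP ak pn sa sk.
pose J i := upd (upd s k (ctr (n - i))) a (c, p - i).
have -> : upd (upd s k (ctr 0)) a (c, 0) = J n by rewrite /J subnn (eqP pn).
have e0 : s = J 0 by rewrite /J !subn0; store_eq.
rewrite {1}e0; apply: (@within_loop _ _ _ 1) => i ip; first by rewrite /J; store_at.
have -> : J i.+1 = upd (upd (J i) k (ctr (n - i.+1))) a (c, (p - i).-1).
  by rewrite /J -subnS; store_eq.
by apply: within_left_word; rewrite /J; store_at.
Qed.

(** Variables without a tape are compiled to [skip], hence the demand that they have value 0. *)
Record ready (vs : seq nat) (k : nat) (x y : seq bool) (env : nat -> nat) (s : store) : Prop :=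
  Ready {
    ready_x : s 0 = word x;
    ready_y : s 1 = word y;
    ready_var : forall i, i < size vs -> s (nth 0 vs i) = ctr (env i);
    ready_novar : forall i, size vs <= i -> env i = 0;
    ready_free : forall j, k <= j -> s j = ctr 0;
    ready_k : 2 <= k;
    ready_vs : all (fun v => 2 <= v < k) vs }.

Lemma ready_upd vs k x y env s w t : ready vs k x y env s ->
  2 <= w < k -> w \notin vs -> ready vs k x y env (upd s w t).
Proof.
case=> s0 s1 sv ev sf k2 kv /andP[w2 wk] wvs; split=> //; rewrite /upd.
- by case: eqP => // e; rewrite -e in w2.
- by case: eqP => // e; rewrite -e in w2.
- move=> i ivs; case: eqP => [e|_]; last exact: sv.
  by case/negP: wvs; rewrite -e mem_nth.
- by move=> j kj; case: eqP => [e|_]; [lia|exact: sf].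
Qed.

Lemma ready_leq vs k k' x y env s : ready vs k x y env s -> k <= k' -> ready vs k' x y env s.
Proof.
case=> s0 s1 sv ev sf k2 kv kk; split=> // [j kj||]; [apply: sf; lia|lia|].
by apply: sub_all kv => v; lia.
Qed.

Lemma ready_new vs k x y env s n : ready vs k x y env s -> ready vs k.+1 x y env (upd s k (ctr n)).
Proof.
move=> R; have := ready_upd (ctr n) (ready_leq R (leqnSn k)); apply.
  by rewrite ltnSn andbT (ready_k R).
by apply/negP => /(allP (ready_vs R)); lia.
Qed.

Lemma ready_cons vs k x y env s n : ready vs k x y env s ->
  ready (k :: vs) k.+1 x y (scons n env) (upd s k (ctr n)).
Proof.
move=> R; have [s0 s1 sv ev sf k2 kv] := ready_new n R; split=> //=.
- by case=> [|i] ivs /=; [rewrite upd_eq|apply: sv].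
- by case=> [|i] //=; apply: ev.
- by rewrite kv (ready_k R) ltnSn.
Qed.

Lemma ready_notin vs k x y env s j : ready vs k x y env s -> k <= j -> j \notin vs.
Proof. by move=> R kj; apply/negP => /(allP (ready_vs R)); lia. Qed.

Lemma within_read vs k x y env s a z p n out :
  ready vs k.+1 x y env s -> s k.+1 = ctr 0 ->
  a < 2 -> s a = word z -> s k = ctr p -> 2 <= out < k -> s out = ctr n ->
  within (comp_read k out a) s (p * 9 + 6)
    (upd (upd s k (ctr 0)) out (ctr (n + read z p))).
Proof.
move=> R sk' a2 sa sk /andP[o2 ok] so.
have -> : p * 9 + 6 = (p * (2 + 3) + 2) + (1 + (1 + (p * 4 + 2))) by lia.
pose J i := upd (upd (upd s k (ctr (p - i))) k.+1 (ctr i)) a (word_at z i).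
apply: (@within_seq _ _ _ _ (J p)).
  have e0 : s = J 0 by rewrite /J subn0; store_eq.
  rewrite {1}e0; apply: within_loop => i ip; first by rewrite /J; store_at.
  apply: (@within_seq _ _ _ 1 (upd (upd (J i) k (ctr (p - i.+1))) k.+1 (ctr i.+1)) 1).
    by apply: within_incr; rewrite /J; store_at.
  have -> : J i.+1 = upd (upd (upd (J i) k (ctr (p - i.+1))) k.+1 (ctr i.+1)) a (word_at z i.+1).
    by rewrite /J; store_eq.
  by apply: within_right; rewrite /J; store_at.
have Jo : J p out = ctr n by rewrite /J; store_at.
have Ja : scan (J p a) = omap inl (onth z p) by rewrite /J upd_eq.
pose m1 := n + isSome (onth z p).
apply: (@within_seq _ _ _ _ (upd (J p) out (ctr m1))).
  have := within_act a out (fun s t => if isSome s then (mark, Right) else (t, Stay)) (J p).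
  rewrite Ja Jo /m1 /=; case: (onth z p) => [b|] /=; rewrite ?addn1 ?addn0 ?act_incr //.
  by rewrite act_id.
apply: (@within_seq _ _ _ _ (upd (J p) out (ctr (n + read z p)))).
  have := within_act a out (fun s t => if marked s then (mark, Right) else (t, Stay)) (upd (J p) out (ctr m1)).
  have -> : upd (J p) out (ctr m1) a = J p a by rewrite /upd; case: eqP => //; lia.
  rewrite Ja upd_eq updd /m1 /read /=.
  by case: (onth z p) => [[]|] /=; rewrite ?act_id ?act_incr ?addn0 ?addn1 ?addn2.
have -> : upd (upd s k (ctr 0)) out (ctr (n + read z p)) =
   upd (upd (upd (J p) out (ctr (n + read z p))) k.+1 (ctr 0)) a (word z).
  by rewrite /J subnn; store_eq.
apply: (@within_rewind _ _ _ _ p) => //; rewrite /J; store_at.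
Qed.

Ltac polybounded := repeat first
  [ exact: polybounded_id | exact: polybounded_const | assumption
  | apply: polybounded_add | apply: polybounded_mul ].

Lemma upd_same s w t : s w = t -> upd s w t = s.
Proof. by move=> <-; apply: upd_id. Qed.

(** Reading a counter destroys it: the value is first moved to the scratch tape [k] and then put
    back while it is added to [out]. *)
Lemma within_var vs k out s n x y env i : ready vs k x y env s ->
  2 <= out < k -> out \notin vs -> s out = ctr n -> i < size vs ->
  within (comp vs k (Var i) out) s (env i * 9 + 4) (upd s out (ctr (n + env i))).
Proof.
move=> R ok /negP ov so ivs; rewrite /= ivs.
set v := nth 0 vs i; have v_in : v \in vs by apply: mem_nth.
have vk : v < k by have /andP[] := allP (ready_vs R) v v_in.
have vo : v <> out by move=> e; apply: ov; rewrite -e.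
have sv : s v = ctr (env i) by apply: ready_var R _ ivs.
have sk : s k = ctr 0 by apply: ready_free R _ (leqnn k).
set m := env i in sv *.
have -> : m * 9 + 4 = (m * 4 + 2) + (m * (2 + 3) + 2) by lia.
apply: within_seq; first by apply: (within_move _ sv sk); lia.
pose J i := upd (upd (upd s v (ctr i)) k (ctr (m - i))) out (ctr (n + i)).
have -> : upd (upd s v (ctr 0)) k (ctr (0 + m)) = J 0.
  by rewrite /J subn0 addn0; store_eq.
have -> : upd s out (ctr (n + m)) = J m by rewrite /J subnn; store_eq.
apply: within_loop => j jm; first by rewrite /J; store_at.
apply: (@within_seq _ _ _ 1 (upd (upd (J j) k (ctr (m - j.+1))) v (ctr j.+1)) 1).
  by apply: within_incr; rewrite /J; store_at.
have -> : J j.+1 = upd (upd (upd (J j) k (ctr (m - j.+1))) v (ctr j.+1)) out (ctr (n + j).+1).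
  by rewrite /J addnS; store_eq.
by apply: within_incr; rewrite /J; store_at.
Qed.

Lemma within_len vs k out s n x y env : ready vs k x y env s ->
  2 <= out < k -> s out = ctr n ->
  within (comp vs k Len out) s (size x * 8 + 3) (upd s out (ctr (n + size x))).
Proof.
move=> R /andP[o2 ok] so; set m := size x.
have k2 := ready_k R.
have sk : s k = ctr 0 by apply: ready_free R _ (leqnn k).
have s0 := ready_x R.
pose L i := upd (upd (upd s 0 (word_at x i)) k (ctr i)) out (ctr (n + i)).
have L0 : s = L 0 by rewrite /L addn0; store_eq.
have scanL i : scan (L i 0) = omap inl (onth x i).
  by rewrite (_ : L i 0 = word_at x i) //; rewrite /L; store_at.
have -> : m * 8 + 3 = (m * 4 + 1) + (m * 4 + 2) by lia.
apply: (@within_seq _ _ _ _ (L m)).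
  suff W j : j <= m -> within (While 0 isSome (Seq (right_ 0) (Seq (incr k) (incr out))))
      (L (m - j)) (j * 4 + 1) (L m) by have := W m (leqnn m); rewrite subnn -L0.
  elim: j => [|j IH] jm.
    by rewrite subn0; apply: within_exit; rewrite scanL onth_default.
  have jm' : m - j.+1 < m by lia.
  have -> : j.+1 * 4 + 1 = ((1 + (1 + 1)) + (j * 4 + 1)).+1 by lia.
  apply: (@within_step _ _ _ _ _ (L (m - j))); last by apply: IH; lia.
    by rewrite scanL; have := onthTE x (m - j.+1); rewrite jm'; case: onth.
  have -> : m - j = (m - j.+1).+1 by lia.
  move: (m - j.+1) => i.
  apply: (@within_seq _ _ _ 1 (upd (L i) 0 (word_at x i.+1))).
    by apply: within_right; rewrite /L; store_at.
  apply: (@within_seq _ _ _ 1 (upd (upd (L i) 0 (word_at x i.+1)) k (ctr i.+1)) 1).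
    by apply: within_incr; rewrite /L; store_at.
  have -> : L i.+1 = upd (upd (upd (L i) 0 (word_at x i.+1)) k (ctr i.+1)) out (ctr (n + i).+1).
    by rewrite /L addnS; store_eq.
  by apply: within_incr; rewrite /L; store_at.
have -> : upd s out (ctr (n + m)) = upd (upd (L m) k (ctr 0)) 0 (word x).
  by rewrite /L; store_eq.
by apply: (@within_rewind _ _ _ _ m) => //; rewrite /L; store_at.
Qed.

(* [C vs k out] adds the value of [f] to tape [out], in the conventions of [comp]. *)
Definition computes (C : seq nat -> nat -> nat -> cmd)
    (f : seq bool -> seq bool -> (nat -> nat) -> nat) (T : nat -> nat) : Prop :=
  forall vs k out s n x y env B, ready vs k x y env s -> 2 <= out < k ->
    out \notin vs -> s out = ctr n -> size x <= B -> (forall i, env i <= B) ->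
    within (C vs k out) s (T B) (upd s out (ctr (n + f x y env))).

Lemma computes_read a e T : a < 2 -> polybounded T ->
  computes (fun vs k => comp vs k e) (fun x y env => eval x y env e) T ->
  exists2 T', polybounded T' &
    computes (fun vs k out => Seq (comp vs k.+1 e k) (comp_read k out a))
      (fun x y env => read (if a == 0 then x else y) (eval x y env e)) T'.
Proof.
move=> a2 pT IH; have [V pV hV] := eval_polybounded e.
exists (fun B => T B + (V B * 9 + 6)).
  by polybounded.
move=> vs k out s n x y env B R ok ov so xB eB.
have k2 := ready_k R; have sk := ready_free R (leqnn k).
have C := IH vs k.+1 k s 0 x y env B (ready_leq R (leqnSn k)) _ (ready_notin R (leqnn k)) sk xB eB.
apply: within_seq; first by apply: C; lia.
have R' := ready_new (0 + eval x y env e) R.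
have := @within_read _ _ _ _ _ _ a (if a == 0 then x else y) (eval x y env e) n out R' _ a2 _ _ ok.
rewrite updd (upd_same sk) => h; apply: within_le (h _ _ _ _) _ => //.
- by have := ready_free R (leqnSn k); store_at.
- by case: a a2 {h} => [|[|]] // _ /=; have := (ready_x R, ready_y R) => -[]; store_at.
- by store_at.
- by store_at.
- by have := hV x y env B xB eB; lia.
Qed.

Lemma comp_within e : exists2 T, polybounded T &
  computes (fun vs k => comp vs k e) (fun x y env => eval x y env e) T.
Proof.
have fresh vs k k' x y env s : ready vs k x y env s -> k <= k' -> k' \notin vs.
  exact: ready_notin.
elim: e => [i|||e [T pT IH]|e [T pT IH]|e1 [T1 pT1 IH1] e2 [T2 pT2 IH2]
  |e1 [T1 pT1 IH1] e2 [T2 pT2 IH2]|e1 [T1 pT1 IH1] e2 [T2 pT2 IH2]|e1 [T1 pT1 IH1] e2 [T2 pT2 IH2]].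
- exists (fun B => B * 9 + 4); first by polybounded.
  move=> vs k out s n x y env B R ok ov so xB eB; have [ivs|vsi] := ltnP i (size vs).
    by apply: within_le (within_var R ok ov so ivs) _; have := eB i; lia.
  rewrite /= ltnNge vsi /= (ready_novar R vsi) addn0 upd_same //.
  by apply: within_le (within_skip s) _; lia.
- exists (fun=> 1); first by polybounded.
  by move=> vs k out s n x y env B R ok ov so xB eB /=; rewrite addn1; apply: within_incr.
- exists (fun B => B * 8 + 3); first by polybounded.
  move=> vs k out s n x y env B R ok ov so xB eB.
  by apply: within_le (within_len R ok so) _; lia.
- exact: (@computes_read 0 e T isT pT IH).
- exact: (@computes_read 1 e T isT pT IH).
- exists (fun B => T1 B + T2 B); first by polybounded.
  move=> vs k out s n x y env B R ok ov so xB eB /=.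
  apply: within_seq; first exact: IH1 R ok ov so xB eB.
  rewrite addnA -[X in within _ _ _ X](updd s out (ctr (n + eval x y env e1))).
  by apply: IH2 xB eB => //; [apply: ready_upd|rewrite upd_eq].
- have [V1 pV1 hV1] := eval_polybounded e1; have [V2 pV2 hV2] := eval_polybounded e2.
  exists (fun B => T1 B + (T2 B + ((V2 B * 5 + 2) + (V1 B * 4 + 2)))); first by polybounded.
  move=> vs k out s n x y env B R ok ov so xB eB /=.
  have k2 := ready_k R; have sk := ready_free R (leqnn k); have sk1 := ready_free R (leqnSn k).
  have := hV1 x y env B xB eB; have := hV2 x y env B xB eB.
  set v1 := eval x y env e1; set v2 := eval x y env e2 => h2 h1.
  have kv := fresh _ _ _ _ _ _ _ R (leqnn k); have kv1 := fresh _ _ _ _ _ _ _ R (leqnSn k).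
  have R2 : ready vs k.+2 x y env s by apply: ready_leq R _; lia.
  apply: within_seq.
    by apply: (IH1 vs k.+2 k s 0 x y env B) => //; lia.
  apply: within_seq.
    apply: (IH2 vs k.+2 k.+1 _ 0 x y env B) => //; [|by lia|by store_at].
    by apply: ready_upd => //; lia.
  rewrite !add0n -/v1 -/v2.
  (* Decrementing an empty counter leaves it empty, which yields truncated subtraction. *)
  apply: (@within_seq _ _ _ _ (upd s k (ctr (v1 - v2)))).
    pose J i := upd (upd s k (ctr (v1 - i))) k.+1 (ctr (v2 - i)).
    have -> : upd (upd s k (ctr v1)) k.+1 (ctr v2) = J 0 by rewrite /J !subn0.
    have -> : upd s k (ctr (v1 - v2)) = J v2 by rewrite /J subnn; store_eq.
    apply: within_le (_ : v2 * (2 + 3) + 2 <= _); last by lia.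
    apply: within_loop => i iv; first by rewrite /J; store_at.
    have -> : J i.+1 = upd (upd (J i) k.+1 (ctr (v2 - i.+1))) k (ctr (v1 - i).-1).
      by rewrite /J -subnS; store_eq.
    by apply: within_decr; rewrite /J; store_at.
  have -> : upd s out (ctr (n + (v1 - v2))) =
     upd (upd (upd s k (ctr (v1 - v2))) k (ctr 0)) out (ctr (n + (v1 - v2))) by store_eq.
  apply: within_le (_ : (v1 - v2) * 4 + 2 <= _); last by lia.
  by apply: within_move; [lia|store_at|store_at].
- have [V1 pV1 hV1] := eval_polybounded e1.
  exists (fun B => T1 B + (V1 B * (T2 B + 3) + 2)); first by polybounded.
  move=> vs k out s n x y env B R ok ov so xB eB /=.
  have k2 := ready_k R; have sk := ready_free R (leqnn k).
  have kv := fresh _ _ _ _ _ _ _ R (leqnn k); have R1 := ready_leq R (leqnSn k).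
  apply: within_seq; first by apply: (IH1 vs k.+1 k s 0 x y env B) => //; lia.
  have := hV1 x y env B xB eB; rewrite add0n; set v1 := eval x y env e1 => h1.
  have := @within_acc k (comp vs k.+1 e2 out) out (upd s k (ctr v1)) v1 n (fun=> eval x y env e2) (T2 B).
  rewrite sum_nat_const card_ord !updd (upd_same sk) => h.
  apply: within_le (h _ _ _ _) _; [lia|by store_at|by store_at| |by have := leq_mul h1 (leqnn (T2 B + 3)); lia].
  move=> i n' _; rewrite updd -[X in within _ _ _ X](updd _ out (ctr n')).
  by apply: IH2 => //; [apply: ready_upd => //; [exact: ready_new|lia]|lia|rewrite upd_eq].
- have [V1 pV1 hV1] := eval_polybounded e1.
  exists (fun B => T1 B + (V1 B * (T2 (B + V1 B) + 3) + 2)).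
    by polybounded; apply: polybounded_comp; polybounded.
  move=> vs k out s n x y env B R ok ov so xB eB /=.
  have k2 := ready_k R; have sk := ready_free R (leqnn k).
  have kv := fresh _ _ _ _ _ _ _ R (leqnn k); have R1 := ready_leq R (leqnSn k).
  apply: within_seq; first by apply: (IH1 vs k.+1 k s 0 x y env B) => //; lia.
  have := hV1 x y env B xB eB; rewrite add0n; set v1 := eval x y env e1 => h1.
  have := @within_acc k (comp (k :: vs) k.+1 e2 out) out (upd s k (ctr v1)) v1 n
     (fun i => eval x y (scons i env) e2) (T2 (B + V1 B)).
  rewrite !updd (upd_same sk) => h.
  apply: within_le (h _ _ _ _) _; [lia|by store_at|by store_at|
    |by have := leq_mul h1 (leqnn (T2 (B + V1 B) + 3)); lia].
  move=> i n' iv; rewrite updd -[X in within _ _ _ X](updd _ out (ctr n')).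
  apply: IH2; [|lia| |by rewrite upd_eq|lia|].
  + apply: ready_upd; [exact: ready_cons|lia|rewrite inE negb_or ov andbT; lia].
  + by rewrite inE negb_or ov andbT; lia.
  + by case=> [|j] /=; [|have := eB j]; lia.
Qed.

(** * Polynomial time and polynomial space from expressions *)

Definition merge (K : nat) (s t : store) : store := fun i => if i <= K then s i else t i.

(** Frame rule: it lets a half-written output lie on a tape beyond those of a compiled expression,
    although [ready] wants the free tapes blank. *)
Lemma runs_frame K P (q : state P) s n s' t : tapes_le K P ->
  runs (fun=> True) q s n s' -> runs (fun=> True) q (merge K s t) n (merge K s' t).
Proof.
move=> tP.
have scansE q0 s0 : trans q0 (scans (merge K s0 t)) = trans q0 (scans s0) :> option (state P) * _.
  by apply: (trans_local q0 tP) => i iK; rewrite /scans /merge iK.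
have afterE (q0 : state P) s0 : after (trans q0 (scans s0)).2 (merge K s0 t) =
    merge K (after (trans q0 (scans s0)).2 s0) t.
  apply: functional_extensionality => i; rewrite /after /merge /upd (trans_tape _ _ tP).
  by case: (i =P _) => // ->; rewrite (trans_tape _ _ tP).
elim=> {q s n s'} [q s _ e|q s q' n s' _ e _ IH].
  by rewrite -afterE -scansE; apply: RunsExit; rewrite ?scansE.
by apply: (RunsStep (q' := q')); rewrite ?scansE ?afterE.
Qed.

Lemma tapes_leW K K' P : K <= K' -> tapes_le K P -> tapes_le K' P.
Proof.
move=> KK; elim: P => [r w f|a IHa b IHb|r p a IHa] /= /andP[A B].
- by rewrite !(leq_trans _ KK).
- by rewrite IHa ?IHb.
- by rewrite IHa // (leq_trans A).
Qed.

Lemma tapes_bound P : exists K, tapes_le K P.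
Proof.
elim: P => [r w f|a [K IHa] b [K' IHb]|r p a [K IHa]].
- by exists (maxn r w); rewrite /= leq_maxl leq_maxr.
- by exists (maxn K K'); rewrite /= (tapes_leW _ IHa) ?leq_maxl // (tapes_leW _ IHb) ?leq_maxr.
- by exists (maxn r K); rewrite /= leq_maxl (tapes_leW _ IHa) ?leq_maxr.
Qed.

(* Tape [w], beyond those of the program, is exempt from being blank. *)
Lemma comp_within_frame e vs k out : exists2 T, polybounded T & exists K,
  tapes_le K (comp vs k e out) /\
  forall w s n x y env B, K < w -> ready vs k x y env (upd s w (ctr 0)) -> 2 <= out < k ->
    out \notin vs -> s out = ctr n -> size x <= B -> (forall i, env i <= B) ->
    within (comp vs k e out) s (T B) (upd s out (ctr (n + eval x y env e))).
Proof.
have [T pT H] := comp_within e; exists T => //.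
have [K tK] := tapes_bound (comp vs k e out).
exists (maxn K out); split; first exact: tapes_leW (leq_maxl _ _) tK.
move=> w s n x y env B Kw R ok ov so xB eB.
have wo : out <> w by move: Kw; rewrite gtn_max => /andP[_]; lia.
have so' : upd s w (ctr 0) out = ctr n by store_at.
have [m [mT E]] := H vs k out (upd s w (ctr 0)) n x y env B R ok ov so' xB eB.
exists m; split=> //; have := @runs_frame (maxn K out) _ _ _ _ _ s (tapes_leW (leq_maxl _ _) tK) E.
congr runs; apply: functional_extensionality => i; rewrite /merge /upd.
  by case: leqP => // iK; case: eqP => // e'; lia.
by case: eqP => [->|_]; rewrite ?leq_maxr //; case: leqP => // iK; case: eqP => // e'; lia.
Qed.

Definition bit_sym (b : bool) : sym := Some (inl b).
Definition write_bit (b w : nat) :=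
  Seq (Act w w (fun _ _ => (bit_sym false, Stay)))
    (Seq (loop b (Act w w (fun _ _ => (bit_sym true, Stay)))) (right_ w)).

Lemma onth_rcons T (z : seq T) c p : onth (rcons z c) p = if p == size z then Some c else onth z p.
Proof.
rewrite -cats1 onth_cat; case: ltngtP => // [zp|->]; last by rewrite subnn.
by rewrite !onth_default //=; lia.
Qed.

Lemma act_bit z c : act (bit_sym c, Stay) (word_at z (size z)) = word_at (rcons z c) (size z).
Proof. by apply: tape_eq => // p; rewrite /= onth_rcons; case: eqP. Qed.

Lemma act_bit_rcons z c d :
  act (bit_sym d, Stay) (word_at (rcons z c) (size z)) = word_at (rcons z d) (size z).
Proof. by apply: tape_eq => // p; rewrite /= !onth_rcons; case: eqP. Qed.

Lemma within_write_bit b w s v z : b <> w -> s b = ctr v -> s w = word_at z (size z) ->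
  within (write_bit b w) s (v * 4 + 4)
    (upd (upd s b (ctr 0)) w (word_at (rcons z (v != 0)) (size z).+1)).
Proof.
move=> bw sb sw; have -> : v * 4 + 4 = 1 + ((v * (1 + 3) + 2) + 1) by lia.
apply: within_seq; first exact: within_act.
rewrite sw act_bit.
pose J i := upd (upd s b (ctr (v - i))) w (word_at (rcons z (i != 0)) (size z)).
have -> : upd s w (word_at (rcons z false) (size z)) = J 0 by rewrite /J subn0; store_eq.
apply: (@within_seq _ _ _ _ (J v)).
  apply: within_loop => i iv; first by rewrite /J; store_at.
  set s1 := upd (J i) _ _.
  have -> : J i.+1 = upd s1 w (act (bit_sym true, Stay) (s1 w)).
    have -> : s1 w = word_at (rcons z (i != 0)) (size z) by rewrite /s1 /J; store_at.
    by rewrite act_bit_rcons /s1 /J; store_eq.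
  exact: within_act.
have -> : upd (upd s b (ctr 0)) w (word_at (rcons z (v != 0)) (size z).+1) =
   upd (J v) w (word_at (rcons z (v != 0)) (size z).+1) by rewrite /J subnn; store_eq.
by apply: within_right; rewrite /J upd_eq.
Qed.

Definition computable (f : seq bool -> seq bool -> (nat -> nat) -> nat) : Prop :=
  exists e, forall x y env, eval x y env e = f x y env.

Definition env0 : nat -> nat := fun=> 0.

Lemma word_nil : word [::] = ctr 0.
Proof. by apply: tape_eq => // p; rewrite /= onth0n. Qed.

Lemma input_storeE x : input_store x = upd (fun=> ctr 0) 0 (word x).
Proof. by apply: functional_extensionality => i; rewrite /upd /input_store; case: eqP => // _; rewrite -word_nil. Qed.

(** Tape 2 counts the bits still to be written, tape 3 is the variable holding the current index,
    tape 4 receives the bit. Output goes to [K], the last tape, beyond everything that the compiled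
    expressions touch. *)
Theorem polytime_computable (N : seq bool -> nat) (b : seq bool -> nat -> nat) :
  computable (fun x _ _ => N x) -> computable (fun x _ env => b x (env 0)) ->
  polytime (fun x => mkseq (fun j => b x j != 0) (N x)).
Proof.
move=> [eN hN] [eb hb].
have [VN pVN bVN] := eval_polybounded eN; have [Vb pVb bVb] := eval_polybounded eb.
have [TN pTN wN] := comp_within eN.
have [Tb pTb [K1 [tK1 wb]]] := comp_within_frame eb [:: 3] 5 4.
have [K2 tK2] := tapes_bound (comp [::] 5 eN 2).
pose K := (maxn K1 K2) + 6.
pose body := Seq (comp [:: 3] 5 eb 4) (Seq (write_bit 4 K) (incr 3)).
pose P := Seq (comp [::] 5 eN 2) (loop 2 body).
have tP : tapes_le K P.
  have t1 := tapes_leW (_ : K1 <= K) tK1; have t2 := tapes_leW (_ : K2 <= K) tK2.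
  rewrite /P /body /= t1 ?t2 /write_bit /loop /=; rewrite /K; lia.
pose C B := B + VN B.
pose T B := TN B + (VN B * (Tb (C B) + ((Vb (C B) * 4 + 4) + 1) + 3) + 2) + 1.
have pT : polybounded T.
  have pC : polybounded C by polybounded.
  rewrite /T; polybounded; exact: polybounded_comp.
have [p hp] := polybounded_poly pT.
exists (machine K P 0), p => x; set n := size x.
have nB : size x <= n by []; have e0B i : env0 i <= n by [].
have R0 : ready [::] 5 x [::] env0 (input_store x).
  split=> //; first by rewrite word_nil input_storeE.
  by move=> j kj; rewrite input_storeE /upd; case: eqP => //; lia.
have NV : N x <= VN n by have := bVN x [::] env0 n nB e0B; rewrite hN.
pose out i := mkseq (fun j => b x j != 0) i.
pose J i := upd (upd (upd (input_store x) 2 (ctr (N x - i))) 3 (ctr i)) K (word_at (out i) i).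
suff [m [mT E]] : within P (input_store x) (T n).-1 (J (N x)).
  have e1 : (J (N x) K).1 =1 word_tape (machine K P 0) (out (N x)) by rewrite /J upd_eq.
  have [h o] := machine_time tP E e1.
  exists m.+1; split=> //; apply: leq_trans (hp n); rewrite -/n.
  by move: mT; rewrite /T addn1.
rewrite /T addn1 /=.
apply: (@within_seq _ _ _ _ (J 0)).
  have := wN [::] 5 2 (input_store x) 0 x [::] env0 n R0 isT isT.
  rewrite hN add0n => /(_ _ nB e0B); have -> : input_store x 2 = ctr 0 by rewrite input_storeE.
  move=> /(_ erefl); congr within; rewrite /J /out subn0 /= input_storeE word_nil /K.
  by store_eq.
apply: within_le (_ : N x * (Tb (C n) + ((Vb (C n) * 4 + 4) + 1) + 3) + 2 <= _); last first.
  by rewrite leq_add2r leq_mul2r NV orbT.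
have K6 : 6 <= K by rewrite /K; lia.
apply: within_loop => i iN; first by rewrite /J; store_at.
pose s1 := upd (J i) 2 (ctr (N x - i.+1)).
have CB : size x <= C n by rewrite /C /n; lia.
have eB k : scons i env0 k <= C n by case: k => [|k] //=; rewrite /C; lia.
have s1_4 : s1 4 = ctr 0 by rewrite /s1 /J input_storeE; store_at.
have R1 : ready [:: 3] 5 x [::] (scons i env0) (upd s1 K (ctr 0)).
  split=> //.
  - by rewrite /s1 /J input_storeE; store_at.
  - by rewrite /s1 /J input_storeE word_nil; store_at.
  - by case=> // _; rewrite /s1 /J input_storeE; store_at.
  - by case.
  - by move=> j kj; rewrite /s1 /J input_storeE; store_at.
have K1K : K1 < K by rewrite /K; lia.
apply: within_seq; first exact: wb K1K R1 _ _ s1_4 CB eB.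
rewrite hb add0n /=.
apply: (@within_seq _ _ _ _ (upd s1 K (word_at (out i.+1) i.+1))).
  have bV : b x i <= Vb (C n) by have := bVb x [::] _ _ CB eB; rewrite hb.
  apply: within_le (_ : b x i * 4 + 4 <= _); last by rewrite leq_add2r leq_mul2r bV orbT.
  have := @within_write_bit 4 K (upd s1 4 (ctr (b x i))) (b x i) (out i).
  rewrite !upd_eq updd (upd_same s1_4) size_mkseq /out mkseqS => W; apply: W => //; first by lia.
  by rewrite /s1 /J; store_at.
have -> : J i.+1 = upd (upd s1 K (word_at (out i.+1) i.+1)) 3 (ctr i.+1).
  by rewrite /s1 /J; store_eq.
by apply: within_incr; rewrite /s1 /J; store_at.
Qed.

(* Pops the bits stacked on tape [w] and writes them to tape 1 from left to right. *)
Definition pop_all (w : nat) :=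
  Seq (left_ w)
    (While w isSome (Seq (Act w 1 (fun s _ => (s, Right))) (Seq (erase w) (left_ w)))).

(** Tape 1 in the middle of [pop_all], with [i] cells of the old word replaced. *)
Definition overlay (z y : seq bool) (i : nat) : tape :=
  (fun q => if q < i then omap inl (onth z q) else omap inl (onth y q), i).

(** [size y <= size z] makes sure that nothing of the old word survives. *)
Lemma within_pop_all w s y z : w != 1 -> size y <= size z -> s 1 = word y ->
  s w = word_at (rev z) (size z) ->
  within (pop_all w) s (size z * 4 + 2) (upd (upd s w (ctr 0)) 1 (word_at z (size z))).
Proof.
move=> /eqP w1 yz s1 sw.
pose pp p := ((fun q => if q < p then omap inl (onth (rev z) q) else None, p.-1) : tape).
pose L i := upd (upd s w (pp (size z - i))) 1 (overlay z y i).
have -> : size z * 4 + 2 = 1 + (size z * 4 + 1) by lia.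
apply: (@within_seq _ _ _ 1 (L 0)).
  have -> : L 0 = upd s w (word_at (rev z) (size z).-1).
    have -> : word_at (rev z) (size z).-1 = pp (size z).
      apply: tape_eq => // q; rewrite /= -(size_rev z); case: ltnP => // zq.
      by rewrite onth_default.
    have e : overlay z y 0 = word y by apply: tape_eq.
    by rewrite /L subn0; apply: functional_extensionality => j; rewrite /upd;
      do !case: eqP => //; congruence.
  exact: within_left_word.
have -> : upd (upd s w (ctr 0)) 1 (word_at z (size z)) = L (size z).
  have -> : word_at z (size z) = overlay z y (size z).
    apply: tape_eq => // q /=; case: ltnP => // zq.
    by rewrite !onth_default // (leq_trans yz).
  by rewrite /L subnn; have -> : pp 0 = ctr 0 by apply: tape_eq.
suff W j : j <= size z -> within (While w isSome (Seq (Act w 1 (fun s _ => (s, Right)))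
    (Seq (erase w) (left_ w)))) (L (size z - j)) (j * 4 + 1) (L (size z)).
  by have := W (size z) (leqnn _); rewrite subnn.
elim: j => [|j IH] jz.
  rewrite subn0; apply: within_exit.
  by rewrite (_ : L (size z) w = pp 0) // /L subnn /upd; do !case: eqP => //; lia.
have -> : j.+1 * 4 + 1 = ((1 + (1 + 1)) + (j * 4 + 1)).+1 by lia.
set i := size z - j.+1.
have iz : size z - i = j.+1 by lia.
have Lw : L i w = pp j.+1 by rewrite /L iz /upd; do !case: eqP => //; lia.
have L1 : L i 1 = overlay z y i by rewrite /L upd_eq.
have rz : onth (rev z) j = onth z i.
  have jz' : j < size (rev z) by rewrite size_rev.
  have iz' : i < size z by lia.
  have := onthTE (rev z) j; have := onthTE z i; rewrite jz' iz'.
  case e: (onth z i) => [a|//] _; case e': (onth (rev z) j) => [b|//] _; congr Some.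
  by rewrite -(onth_nth false _ _ _ e) -(onth_nth false _ _ _ e') nth_rev.
have scw : scan (pp j.+1) = omap inl (onth z i) by rewrite /scan /= ltnSn rz.
apply: (@within_step _ _ _ _ _ (L (size z - j))); last by apply: IH; lia.
  rewrite Lw scw; have iz' : i < size z by lia.
  by have := onthTE z i; rewrite iz'; case: onth.
have -> : size z - j = i.+1 by lia.
apply: (@within_seq _ _ _ 1 (upd (L i) 1 (overlay z y i.+1))).
  have := within_act w 1 (fun s _ => (s, Right)) (L i); rewrite Lw scw L1.
  congr within; congr upd; apply: tape_eq => // q /=; rewrite ltnS.
  by case: ltngtP => // ->.
pose qq := ((fun q => if q < j then omap inl (onth (rev z) q) else None, j) : tape).
apply: (@within_seq _ _ _ 1 (upd (upd (L i) 1 (overlay z y i.+1)) w qq)).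
  have := within_act w w (fun _ _ => (None, Stay)) (upd (L i) 1 (overlay z y i.+1)).
  have -> : upd (L i) 1 (overlay z y i.+1) w = pp j.+1 by rewrite -Lw /upd; case: eqP.
  congr within; congr upd; apply: tape_eq => // q /=; rewrite ltnS.
  by case: ltngtP.
have -> : L i.+1 = upd (upd (upd (L i) 1 (overlay z y i.+1)) w qq) w (pp j).
  have -> : L i.+1 = upd (upd s w (pp j)) 1 (overlay z y i.+1).
    by rewrite /L; have -> : size z - i.+1 = j by lia.
  by rewrite /L; apply: functional_extensionality => k; rewrite /upd; do !case: eqP => //; lia.
by apply: within_left_word; rewrite upd_eq.
Qed.

(** Every new bit depends on the whole old word, so the new word is first stacked on tape [K], last
    bit first, and then popped onto tape 1. A round takes polynomial time and ends with all heads on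
    cell 0; hence the space is polynomial whatever the number of rounds. Bit 0 of the word ends the
    iteration, bit 1 is the verdict. *)
Theorem PSPACE_iter (L : language) (N : seq bool -> nat) (b : seq bool -> seq bool -> nat -> nat) :
  computable (fun x _ _ => N x) -> computable (fun x y env => b x y (env 0)) ->
  (forall x, exists t,
     let y t := iter t (fun y => mkseq (fun j => b x y j != 0) (N x)) [::] in
     [/\ forall t', t' < t -> ~~ nth false (y t') 0, nth false (y t) 0 &
         nth false (y t) 1 <-> L x]) ->
  PSPACE L.
Proof.
move=> [eN hN] [eb hb] HL.
have [VN pVN bVN] := eval_polybounded eN; have [Vb pVb bVb] := eval_polybounded eb.
have [TN pTN [K2 [tK2 wN]]] := comp_within_frame eN [::] 4 2.
have [Tb pTb [K1 [tK1 wb]]] := comp_within_frame eb [:: 2] 4 3.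
pose K := (maxn K1 K2) + 6.
pose body1 := Seq (comp [:: 2] 4 eb 3) (write_bit 3 K).
pose body := Seq (comp [::] 4 eN 2) (Seq (loop 2 body1) (Seq (comp [::] 4 eN 2)
   (Seq (pop_all K) (loop 2 (left_ 1))))).
pose P := Seq (While 1 (fun s => ~~ marked s) body) (right_ 1).
have tP : tapes_le K P.
  have t1 := tapes_leW (_ : K1 <= K) tK1; have t2 := tapes_leW (_ : K2 <= K) tK2.
  rewrite /P /body /= t1 ?t2 /write_bit /loop /=; rewrite /K; lia.
pose C B := B + VN B.
pose T B := TN B + ((VN B * (Tb (C B) + (Vb (C B) * 4 + 4) + 3) + 2) +
  (TN B + ((VN B * 4 + 2) + (VN B * 4 + 2)))) + 1.
have pT : polybounded (fun B => (T B).+1).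
  have pC : polybounded C by polybounded.
  have : polybounded (fun B => T B + 1) by rewrite /T; polybounded; exact: polybounded_comp.
  by apply: polybounded_le => B; rewrite addn1.
have [p hp] := polybounded_poly pT.
exists (machine K P 1), p => x; set n := size x.
have nB : size x <= n by []; have e0B i : env0 i <= n by [].
have NV : N x <= VN n by have := bVN x [::] env0 n nB e0B; rewrite hN.
pose F y := mkseq (fun j => b x y j != 0) (N x).
pose M y := upd (upd (fun=> ctr 0) 0 (word x)) 1 (word y).
have K6 : 6 <= K by rewrite /K; lia.
have K1K : K1 < K by rewrite /K; lia.
have K2K : K2 < K by rewrite /K; lia.
have bodyP y : size y <= N x -> within body (M y) (T n).-1 (M (F y)).
  move=> yN; rewrite /T addn1 /=.
  have R0 s : (forall j, j != K -> j != 2 -> s j = M y j) -> ready [::] 4 x y env0 (upd s K (ctr 0)).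
    move=> sM; split=> // [||j kj].
    - by rewrite /upd; case: eqP => [|/eqP ?]; [lia|rewrite sM].
    - by rewrite /upd; case: eqP => [|/eqP ?]; [lia|rewrite sM].
    - rewrite /upd; case: eqP => // /eqP jK; rewrite sM //; last lia.
      by rewrite /M; store_at.
  apply: (@within_seq _ _ _ _ (upd (M y) 2 (ctr (N x)))).
    have := wN K (M y) 0 x y env0 n K2K (R0 _ _) isT isT.
    by rewrite hN add0n; apply.
  pose J i := upd (upd (M y) 2 (ctr (N x - i)))
     K (word_at (mkseq (fun j => b x y (N x - j.+1) != 0) i) i).
  have JN : J (N x) = upd (M y) K (word_at (rev (F y)) (N x)).
    rewrite /J subnn; have -> : mkseq (fun j => b x y (N x - j.+1) != 0) (N x) = rev (F y).
      apply: (@eq_from_nth _ false); rewrite ?size_rev ?size_mkseq // => i iN.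
      by rewrite nth_mkseq // nth_rev size_mkseq // nth_mkseq //; lia.
    by rewrite /M; store_eq.
  apply: (@within_seq _ _ _ _ (J (N x))).
    have -> : upd (M y) 2 (ctr (N x)) = J 0.
      by rewrite /J subn0 word_nil /M; store_eq.
    apply: within_le (_ : N x * (Tb (C n) + (Vb (C n) * 4 + 4) + 3) + 2 <= _); last first.
      by rewrite leq_add2r leq_mul2r NV orbT.
    apply: within_loop => i iN; first by rewrite /J; store_at.
    set m := N x - i.+1; pose s1 := upd (J i) 2 (ctr m).
    have CB : size x <= C n by rewrite /C /n; lia.
    have eB k : scons m env0 k <= C n by case: k => [|k] //=; rewrite /C; lia.
    have s1_3 : s1 3 = ctr 0 by rewrite /s1 /J /M; store_at.
    have R1 : ready [:: 2] 4 x y (scons m env0) (upd s1 K (ctr 0)).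
      split=> //.
      - by rewrite /s1 /J /M; store_at.
      - by rewrite /s1 /J /M; store_at.
      - by case=> // _; rewrite /s1 /J /M; store_at.
      - by case.
      - by move=> j kj; rewrite /s1 /J /M; store_at.
    apply: within_seq; first exact: wb K1K R1 _ _ s1_3 CB eB.
    rewrite hb add0n /=.
    have bV : b x y m <= Vb (C n) by have := bVb x y _ _ CB eB; rewrite hb.
    apply: within_le (_ : b x y m * 4 + 4 <= _); last by rewrite leq_add2r leq_mul2r bV orbT.
    have := @within_write_bit 3 K (upd s1 3 (ctr (b x y m))) (b x y m)
       (mkseq (fun j => b x y (N x - j.+1) != 0) i).
    rewrite !upd_eq updd (upd_same s1_3) size_mkseq -/m => W.
    have -> : J i.+1 = upd s1 K (word_at (rcons (mkseq (fun j => b x y (N x - j.+1) != 0) i)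
       (b x y m != 0)) i.+1).
      by rewrite /s1 /J -/m mkseqS; store_eq.
    by apply: W => //; [lia|rewrite /s1 /J; store_at].
  have sF : size (F y) = N x by rewrite size_mkseq.
  pose s2 := upd (J (N x)) 2 (ctr (N x)).
  apply: (@within_seq _ _ _ _ s2).
    have := wN K (J (N x)) 0 x y env0 n K2K (R0 _ _) isT isT.
    rewrite hN add0n; apply=> //.
    + by move=> j /eqP jK /eqP j2; rewrite /J; store_at.
    + by rewrite /J subnn; store_at.
  apply: within_seq.
    have := @within_pop_all K s2 y (F y); rewrite sF => W.
    apply: within_le (W _ yN _ _) _; rewrite ?leq_add2r ?leq_mul2r ?NV ?orbT //.
    - lia.
    - by rewrite /s2 JN /M; store_at.
    - by rewrite /s2 JN; store_at.
  set s3 := upd _ 1 _.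
  have -> : M (F y) = upd (upd s3 2 (ctr 0)) 1 (word (F y)).
    by rewrite /s3 /s2 JN /M; store_eq.
  apply: within_le (_ : N x * 4 + 2 <= _); last by rewrite leq_add2r leq_mul2r NV orbT.
  by apply: (@within_rewind _ _ _ _ (N x)) => //; rewrite /s3 /s2; store_at.
have [t [tmin t0 t1]] := HL x; rewrite -/F in tmin t0 t1.
(* The duration of one round bounds the heads; the successor also covers the last move to cell 1. *)
pose H := (T n).-1.+1.
have hM y : heads_le H (M y) by move=> i; rewrite /M /upd; do !case: eqP.
have bodyE y : size y <= N x -> exists m, exec (heads_le H) body (M y) m (M (F y)).
  move=> yN; have [m [mT E]] := bodyP y yN; exists m.
  have := runs_heads E (_ : heads_le 0 (M y)).
  move=> /(_ (fun i => _)) => h.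
  apply: runs_weaken (h _) => [s hs i|i]; last by rewrite /M /upd; do !case: eqP.
  by apply: leq_trans (hs i) _; rewrite add0n /H; lia.
have scM y : scan (M y 1) = omap inl (onth y 0) by rewrite /M.
have mk y i : marked (omap inl (onth y i)) = nth false y i.
  by rewrite -odflt_onth; case: onth.
have whileE k y : size y <= N x ->
   (forall t', t' < k -> ~~ nth false (iter t' F y) 0) -> nth false (iter k F y) 0 ->
   exists m, exec (heads_le H) (While 1 (fun s => ~~ marked s) body) (M y) m (M (iter k F y)).
  elim: k y => [|k IH] y yN before now.
    by exists 1; apply: exec_while_exit; rewrite // scM mk negbK.
  have [m1 E1] := bodyE y yN.
  have before' k' : k' < k -> ~~ nth false (iter k' F (F y)) 0.
    by move=> kk; rewrite -iterSr; apply: before.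
  rewrite iterSr in now *.
  have [m2 E2] := IH (F y) (eq_leq (size_mkseq _ _)) before' now.
  exists (m1 + m2).+1; apply: exec_while_step E1 E2 => //.
  by rewrite scM mk; apply: (before 0).
have [m E] := whileE t [::] (leq0n _) tmin t0.
pose s' := upd (M (iter t F [::])) 1 (word_at (iter t F [::]) 1).
have E' : exec (heads_le H) P (input_store x) (m + 1) s'.
  have -> : input_store x = M [::] by rewrite input_storeE /M word_nil; store_eq.
  apply: exec_seq E _.
  have := @exec_act (heads_le H) 1 1 (fun t _ => (t, Right)) (M (iter t F [::])) (hM _).
  congr exec; rewrite /s'; congr upd; rewrite /M upd_eq; apply: tape_eq => //= q.
  by case: eqP => [->|].
have r1 : 1 <= K by lia.
have hs' : heads_le H s'.
  by move=> i; rewrite /s' /M /upd; do !case: eqP.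
have [sp ha ac] := machine_space tP E' hs' r1.
split.
  by move=> k i; apply: leq_trans (sp k i) _; rewrite /H; apply: leq_trans (hp n); rewrite /T addn1.
exists (m + 1).+1; split=> //; rewrite ac -t1.
by rewrite /s' upd_eq mk.
Qed.

(** * Computable functions *)

Definition fn := seq bool -> seq bool -> (nat -> nat) -> nat.

Definition up (r : nat -> nat) (n : nat) : nat := if n is m.+1 then (r m).+1 else 0.

Fixpoint rename (r : nat -> nat) (e : expr) : expr :=
  match e with
  | Var n => Var (r n)
  | One => One
  | Len => Len
  | Rdx e => Rdx (rename r e)
  | Rdy e => Rdy (rename r e)
  | Add e1 e2 => Add (rename r e1) (rename r e2)
  | Sub e1 e2 => Sub (rename r e1) (rename r e2)
  | Mul e1 e2 => Mul (rename r e1) (rename r e2)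
  | Sum e1 e2 => Sum (rename r e1) (rename (up r) e2)
  end.

Lemma eval_rename x y e : forall r env,
  eval x y env (rename r e) = eval x y (fun n => env (r n)) e.
Proof.
elim: e => //=; try by [move=> e IH r env; rewrite IH | move=> e1 IH1 e2 IH2 r env; rewrite IH1 IH2].
move=> e1 IH1 e2 IH2 r env; rewrite IH1; apply: eq_bigr => i _; rewrite IH2.
by congr eval; apply: functional_extensionality => -[].
Qed.

Section Closure.
Implicit Types (f g : fn).

Lemma computable_ext f g : (forall x y e, f x y e = g x y e) -> computable f -> computable g.
Proof. by move=> fg [a h]; exists a => x y env; rewrite h. Qed.

Lemma computable_weak f : computable f -> computable (fun x y e => f x y (fun j => e j.+1)).
Proof. by move=> [a h]; exists (rename succn a) => x y env; rewrite eval_rename h. Qed.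

Lemma computable_var n : computable (fun x y e => e n).
Proof. by exists (Var n). Qed.

Lemma computable_add f g : computable f -> computable g -> computable (fun x y e => f x y e + g x y e).
Proof. by move=> [a h] [b k]; exists (Add a b) => x y env /=; rewrite h k. Qed.

Lemma computable_sub f g : computable f -> computable g -> computable (fun x y e => f x y e - g x y e).
Proof. by move=> [a h] [b k]; exists (Sub a b) => x y env /=; rewrite h k. Qed.

Lemma computable_mul f g : computable f -> computable g -> computable (fun x y e => f x y e * g x y e).
Proof. by move=> [a h] [b k]; exists (Mul a b) => x y env /=; rewrite h k. Qed.

Lemma computable_const n : computable (fun x y e => n).
Proof.
elim: n => [|n IH]; first by exists (Sub One One).
apply: computable_ext (computable_add IH (_ : computable (fun _ _ _ => 1))).
  by move=> x y e; rewrite addn1.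
by exists One.
Qed.

Lemma computable_succ f : computable f -> computable (fun x y e => (f x y e).+1).
Proof.
move=> F; apply: computable_ext (computable_add F (computable_const 1)) => x y e.
by rewrite addn1.
Qed.

Lemma computable_size : computable (fun x y e => size x).
Proof. by exists Len. Qed.

Lemma computable_readx f : computable f -> computable (fun x y e => read x (f x y e)).
Proof. by move=> [a h]; exists (Rdx a) => x y env /=; rewrite h. Qed.

Lemma computable_ready f : computable f -> computable (fun x y e => read y (f x y e)).
Proof. by move=> [a h]; exists (Rdy a) => x y env /=; rewrite h. Qed.

Lemma computable_sum f (h : seq bool -> seq bool -> (nat -> nat) -> nat -> nat) : computable f ->
  computable (fun x y e => h x y (fun j => e j.+1) (e 0)) ->
  computable (fun x y e => \sum_(i < f x y e) h x y e i).
Proof.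
move=> [a ha] [b hb]; exists (Sum a b) => x y env /=; rewrite ha.
by apply: eq_bigr => i _; rewrite hb.
Qed.

(** * Tests with values 0 and 1 *)

Section Booleans.
Implicit Types (B C D : seq bool -> seq bool -> (nat -> nat) -> bool).

Lemma computable_neg B : computable (fun x y e => B x y e) -> computable (fun x y e => ~~ B x y e).
Proof.
move=> H; apply: computable_ext (computable_sub (computable_const 1) H) => x y e.
by case: (B x y e).
Qed.

Lemma computable_and B C : computable (fun x y e => B x y e) -> computable (fun x y e => C x y e) ->
  computable (fun x y e => B x y e && C x y e).
Proof.
move=> H K; apply: computable_ext (computable_mul H K) => x y e.
by case: (B x y e); case: (C x y e).
Qed.

Lemma computable_or B C : computable (fun x y e => B x y e) -> computable (fun x y e => C x y e) ->
  computable (fun x y e => B x y e || C x y e).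
Proof.
move=> H K; apply: computable_ext (computable_neg (computable_and (computable_neg H) (computable_neg K))).
by move=> x y e; rewrite negb_and !negbK.
Qed.

Lemma computable_leq f g : computable f -> computable g -> computable (fun x y e => f x y e <= g x y e).
Proof.
move=> F G; apply: computable_ext (computable_sub (computable_const 1) (computable_sub F G)) => x y e.
by rewrite /leq; case: (f x y e - g x y e) => [|[]].
Qed.

Lemma computable_eq f g : computable f -> computable g -> computable (fun x y e => f x y e == g x y e).
Proof.
move=> F G; apply: computable_ext (computable_and (computable_leq F G) (computable_leq G F)) => x y e.
by rewrite eqn_leq.
Qed.

Lemma computable_if B f g : computable (fun x y e => B x y e) -> computable f -> computable g ->
  computable (fun x y e => if B x y e then f x y e else g x y e).
Proof.
move=> H F G; apply: computable_ext
  (computable_add (computable_mul H F) (computable_mul (computable_neg H) G)) => x y e.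
by case: (B x y e); rewrite /= ?mul1n ?mul0n ?addn0.
Qed.

Lemma computable_ifb B C D : computable (fun x y e => B x y e) -> computable (fun x y e => C x y e) ->
  computable (fun x y e => D x y e) ->
  computable (fun x y e => if B x y e then C x y e else D x y e).
Proof.
move=> H F G; apply: computable_ext (computable_if H F G) => x y e.
by case: (B x y e).
Qed.

Lemma computable_eqb B C : computable (fun x y e => B x y e) -> computable (fun x y e => C x y e) ->
  computable (fun x y e => B x y e == C x y e).
Proof.
move=> H K; apply: computable_ext (computable_eq H K) => x y e.
by case: (B x y e) (C x y e) => -[].
Qed.
End Booleans.

(** Bounded operators get names because [computable_step] selects its rule by the head symbol. *)
Definition sum_lt (n : nat) (h : nat -> nat) : nat := \sum_(i < n) h i.
Definition some_lt (n : nat) (B : nat -> bool) : bool := has B (iota 0 n).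
Definition all_lt (n : nat) (B : nat -> bool) : bool := all B (iota 0 n).

Lemma some_ltP n (B : nat -> bool) : reflect (exists2 i, i < n & B i) (some_lt n B).
Proof.
by apply: (iffP hasP) => -[i]; rewrite ?mem_iota => ? ?; exists i; rewrite ?mem_iota.
Qed.

Lemma all_ltP n (B : nat -> bool) : reflect (forall i, i < n -> B i) (all_lt n B).
Proof.
by apply: (iffP allP) => H i; have := H i; rewrite mem_iota /= add0n.
Qed.

Lemma computable_some_lt f (h : seq bool -> seq bool -> (nat -> nat) -> nat -> bool) : computable f ->
  computable (fun x y e => h x y (fun j => e j.+1) (e 0)) ->
  computable (fun x y e => some_lt (f x y e) (h x y e)).
Proof.
move=> F H; have S := @computable_sum f (fun x y e i => h x y e i) F H.
apply: computable_ext (computable_leq (computable_const 1) S) => x y e.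
rewrite lt0n sum_nat_eq0; congr nat_of_bool; apply/idP/some_ltP.
  by rewrite negb_forall => /existsP[i]; rewrite eqb0 negbK; exists i.
by move=> [i lti hi]; apply/forallPn; exists (Ordinal lti); rewrite eqb0 negbK.
Qed.

Lemma computable_all_lt f (h : seq bool -> seq bool -> (nat -> nat) -> nat -> bool) : computable f ->
  computable (fun x y e => h x y (fun j => e j.+1) (e 0)) ->
  computable (fun x y e => all_lt (f x y e) (h x y e)).
Proof.
move=> F H; apply: computable_ext (computable_neg
  (@computable_some_lt _ (fun x y e i => ~~ h x y e i) F (computable_neg H))) => x y e.
by rewrite /some_lt has_predC negbK.
Qed.

Lemma sum_below m n : n <= m -> \sum_(i < m) (i < n) = n.
Proof.
move=> nm; rewrite -(big_mkord xpredT (fun i => (i < n) : nat)) (big_cat_nat (leq0n n) nm) //=.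
rewrite (eq_big_nat _ _ (F2 := fun=> 1)) => [|i /andP[_ ->] //].
rewrite [X in _ + X](eq_big_nat _ _ (F2 := fun=> 0)) => [|i /andP[ni _]]; last by rewrite ltnNge ni.
by rewrite !sum_nat_const_nat subn0 muln1 muln0 addn0.
Qed.

(** The quotient counts the positive multiples of [b] up to [a]; the first factor settles
    [b = 0]. *)
Lemma divn_sum a b : a %/ b = (0 < b) * \sum_(i < a) (i.+1 * b <= a).
Proof.
case: b => [|b]; first by rewrite divn0.
rewrite mul1n -[LHS](sum_below (leq_div a b.+1)).
by apply: eq_bigr => i _; rewrite leq_divRL.
Qed.

Lemma computable_div f g : computable f -> computable g -> computable (fun x y e => f x y e %/ g x y e).
Proof.
move=> F G.
have H : computable (fun x y e => (0 < g x y e) *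
     \sum_(i < f x y e) (i.+1 * g x y e <= f x y e)).
  apply: computable_mul; first by apply: computable_leq => //; apply: computable_const.
  apply: (@computable_sum f (fun x y e i => (i.+1 * g x y e <= f x y e) : nat)) => //.
  apply: computable_leq; last exact: computable_weak.
  apply: computable_mul; last exact: computable_weak.
  exact: computable_succ (computable_var 0).
by apply: computable_ext H => x y e; rewrite divn_sum.
Qed.

Lemma computable_mod f g : computable f -> computable g -> computable (fun x y e => f x y e %% g x y e).
Proof.
move=> F G; apply: computable_ext (computable_sub F (computable_mul (computable_div F G) G)) => x y e.
by rewrite {1}(divn_eq (f x y e) (g x y e)) addKn.
Qed.

(** Constant tables: through them the transition rules of a fixed machine enter an expression. *)
Lemma computable_nth (s : seq nat) f : computable f -> computable (fun x y e => nth 0 s (f x y e)).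
Proof.
elim: s f => [|a s IH] f F.
  by apply: computable_ext (computable_const 0) => x y e; rewrite nth_nil.
have E := computable_eq F (computable_const 0).
apply: computable_ext (computable_if E (computable_const a) (IH _ (computable_sub F (computable_const 1)))).
by move=> x y e; case: (f x y e) => //= n; rewrite subn1.
Qed.

Lemma computable_nthb (s : seq bool) f : computable f ->
  computable (fun x y e => nth false s (f x y e)).
Proof.
move=> F; apply: computable_ext (computable_nth (map nat_of_bool s) F) => x y e.
have [h|h] := ltnP (f x y e) (size s); first by rewrite (nth_map false).
by rewrite !nth_default ?size_map.
Qed.

Lemma computable_horner (p : {poly nat}) f : computable f -> computable (fun x y e => (p.[f x y e])%R).
Proof.
move=> F; rewrite /horner; elim: (polyseq p) => [|a s IH] /=; first exact: computable_const.
exact: computable_add (computable_mul IH F) (computable_const a).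
Qed.

End Closure.

Ltac computable_step :=
  lazymatch goal with
  | |- computable (fun x y e => nat_of_bool (~~ @?b x y e)) => apply: (@computable_neg b)
  | |- computable (fun x y e => nat_of_bool (@?b x y e && @?c x y e)) => apply: (@computable_and b c)
  | |- computable (fun x y e => nat_of_bool (@?b x y e || @?c x y e)) => apply: (@computable_or b c)
  | |- computable (fun x y e => nat_of_bool (@?f x y e <= @?g x y e)) => apply: (@computable_leq f g)
  | |- computable (fun x y e => nat_of_bool (@eq_op Datatypes_nat__canonical__eqtype_Equality (@?f x y e) (@?g x y e))) =>
         apply: (@computable_eq f g)
  | |- computable (fun x y e => nat_of_bool (@eq_op Datatypes_bool__canonical__eqtype_Equality (@?f x y e) (@?g x y e))) =>
         apply: (@computable_eqb f g)
  | |- computable (fun x y e => nat_of_bool (some_lt (@?n x y e) (@?h x y e))) =>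
         apply: (@computable_some_lt n h); cbv beta
  | |- computable (fun x y e => nat_of_bool (all_lt (@?n x y e) (@?h x y e))) =>
         apply: (@computable_all_lt n h); cbv beta
  | |- computable (fun x y e => nat_of_bool (nth false ?s (@?f x y e))) => apply: (@computable_nthb s f)
  | |- computable (fun x y e => @?f x y e + @?g x y e) => apply: (@computable_add f g)
  | |- computable (fun x y e => @?f x y e - @?g x y e) => apply: (@computable_sub f g)
  | |- computable (fun x y e => @?f x y e * @?g x y e) => apply: (@computable_mul f g)
  | |- computable (fun x y e => @?f x y e %/ @?g x y e) => apply: (@computable_div f g)
  | |- computable (fun x y e => @?f x y e %% @?g x y e) => apply: (@computable_mod f g)
  | |- computable (fun x y e => sum_lt (@?n x y e) (@?h x y e)) =>
         apply: (@computable_sum n h); cbv beta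
  | |- computable (fun x y e => nth 0 ?s (@?f x y e)) => apply: (@computable_nth s f)
  | |- computable (fun x y e => horner ?p (@?f x y e)) => apply: (@computable_horner p f)
  | |- computable (fun x y e => e ?n) => exact: (computable_var n)
  | |- computable (fun x y e => size x) => exact: computable_size
  | |- computable (fun x y e => read x (@?f x y e)) => apply: (@computable_readx f)
  | |- computable (fun x y e => read y (@?f x y e)) => apply: (@computable_ready f)
  | |- computable (fun x y e => S (@?f x y e)) => apply: (@computable_succ f)
  | |- _ => first [exact: computable_const | apply: computable_ifb | apply: computable_if]
  end.
Ltac computable := repeat first
  [ assumption
  | lazymatch goal with
    | |- computable (fun x y e => ?f x y (fun j => e j.+1)) => apply: (@computable_weak f)
    | |- computable (fun x y e => nat_of_bool (?f x y (fun j => e j.+1))) =>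
        apply: (@computable_weak (fun x y e => nat_of_bool (f x y e)))
    end
  | computable_step ].

(** * Values of positions, and the game in polynomial space *)

Lemma dominatingS (G : graph) (D E : {set vertex G}) :
  D \subset E -> dominating D -> dominating E.
Proof.
move=> /subsetP DE /forallP domD; apply/forallP => v.
have /orP[vD|/exists_inP[u uD uv]] := domD v; first by rewrite DE.
by apply/orP; right; apply/exists_inP; exists u; rewrite ?DE.
Qed.

Section Value.
Variables (G : graph) (first : player).
Local Notation n := (nvertices G).
Implicit Types h p : seq (vertex G).

Definition dom_turn (i : nat) : bool := mover first i == Dominator.

Fixpoint gval (k : nat) (h : seq (vertex G)) : bool :=
  if k is k'.+1 then
    if dom_turn (size h) then [exists v, (v \notin h) && gval k' (rcons h v)]
    else [forall v, (v \notin h) ==> gval k' (rcons h v)]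
  else dominating (claimed first Dominator h).

Lemma fresh_vertex h : size h < n -> exists v : vertex G, v \notin h.
Proof.
move=> hn; apply/existsP; rewrite -negb_forall; apply/forallP => hall.
have : #|[set: vertex G]| <= size h.
  by apply: leq_trans (card_size h); apply/subset_leq_card/subsetP => v _; apply: hall.
by rewrite cardsT card_ord leqNgt hn.
Qed.

Lemma gval_winning : gval n [::] <-> has_winning_strategy G first Dominator.
Proof.
split=> [val0|[s legal win]]; last first.
  suff H k h : uniq h -> size h + k = n -> follows first Dominator s h -> gval k h by apply: H.
  elim: k h => [|k IH] h uh hk fh /=.
    rewrite addn0 in hk; have := win h; rewrite /complete_play uh hk eqxx.
    by move=> /(_ isT fh)[D /dominatingS]; apply.
  have follow v : (dom_turn (size h) -> s h = Some v) -> follows first Dominator s (rcons h v).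
    move=> sv i; rewrite size_rcons ltnS leq_eqVlt -cats1 => /predU1P[->|ih] turn.
      by rewrite onth_cat ltnn subnn take_size_cat ?sv //; apply/eqP.
    by rewrite onth_cat ih takel_cat ?(ltnW ih) //; apply: fh.
  have step v : v \notin h -> (dom_turn (size h) -> s h = Some v) -> gval k (rcons h v).
    by move=> vh sv; apply: IH (follow v sv); rewrite ?rcons_uniq ?vh // size_rcons addSnnS.
  case: ifP => turn; last by apply/forallP => v; apply/implyP => vh; apply: step; rewrite ?turn.
  have hn : size h < n by lia.
  have [v sv vh] := legal h uh hn (eqP turn).
  by apply/existsP; exists v; rewrite vh step.
pose good h v := (v \notin h) && gval (n - size h).-1 (rcons h v).
(* The fallback serves legality in histories of value [false]; where the value is [true] on
   Dominator's turn, a good vertex exists. *)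
exists (fun h => if [pick v | good h v] is Some v then Some v else [pick v | v \notin h]).
  move=> h uh hn _; case: pickP => [v /andP[vh _]|_]; first by exists v.
  case: pickP => [v vh|none]; first by exists v.
  by have [v vh] := fresh_vertex hn; rewrite none in vh.
move=> p /andP[up /eqP sp] fp; exists (claimed first Dominator p) => //.
suff H i : i <= n -> gval (n - i) (take i p).
  by have := H n (leqnn n); rewrite subnn -sp take_size.
elim: i => [|i IH] lin; first by rewrite take0 subn0.
have sz : size (take i p) = i by rewrite size_takel // sp ltnW.
have := IH (ltnW lin); have -> : n - i = (n - i.+1).+1 by lia.
have ip : i < size p by rewrite sp.
have [v ev] : exists v, onth p i = Some v by move: (onthTE p i); rewrite ip; case: onth => // v; exists v.
have tk : take i.+1 p = rcons (take i p) v.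
  by rewrite (take_nth v) // (onth_nth v _ _ _ ev).
have vt : v \notin take i p.
  have : uniq (take i.+1 p) by rewrite take_uniq.
  by rewrite tk rcons_uniq => /andP[].
rewrite tk /= sz; case: ifP => turn; last by move=> /forallP/(_ v); rewrite vt.
move=> /existsP[w0 gw0]; have := fp i ip (eqP turn); rewrite ev.
case: pickP => [w /andP[wt gw] [->]|/(_ w0)]; first by move: gw; rewrite sz; congr gval; lia.
by rewrite /good sz (_ : (n - i).-1 = n - i.+1) ?gw0 //; lia.
Qed.
End Value.

(** * Depth-first search of a game tree *)

Section Search.
Variables (n : nat) (leaf : seq nat -> bool) (own : nat -> bool) (valid : bool).

(** All [n] children are visited, claimed or not, so the search tests no legality; [leaf] has to
    judge sequences with repetitions. *)
Fixpoint value (k : nat) (c : seq nat) : bool :=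
  if k is k'.+1 then
    if own (size c) then some_lt n (fun v => value k' (rcons c v))
    else all_lt n (fun v => value k' (rcons c v))
  else leaf c.

(** [result] is meaningful while [returning] holds; on the way down it is a leftover. *)
Record search := Search { halted : bool; result : bool; returning : bool; stack : seq nat }.

(* One step of depth-first search; siblings are skipped once one of them decides the value. *)
Definition search_step (s : search) : search :=
  let: Search _ b r c := s in
  let d := (size c).-1 in
  if r then
    if nilp c then Search true (b && valid) true [::]
    else if (b == own d) || ((last 0 c).+1 == n) then Search false b true (take d c)
    else Search false b false (rcons (take d c) (last 0 c).+1)
  else if size c < n then Search false b false (rcons c 0)
  else Search false (leaf c) true c.

Lemma search_value k c b : size c + k = n -> exists t b',
  iter t search_step (Search false b false c) = Search false b' true c /\ b' = value k c.
Proof.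
elim: k c b => [|k IH] c b ck.
  by exists 1, (leaf c); rewrite /= ifF //; lia.
have cn : size c < n by lia.
have szr v : size (rcons c v) + k = n by rewrite size_rcons; lia.
pose tail v := iota v (n - v).
pose val_from v := if own (size c) then has (fun v => value k (rcons c v)) (tail v)
                 else all (fun v => value k (rcons c v)) (tail v).
(* Induction over the siblings [v], ..., [n - 1] still to be visited. *)
have H m v b0 : v + m.+1 = n -> exists t b',
    iter t search_step (Search false b0 false (rcons c v)) = Search false b' true c /\ b' = val_from v.
  elim: m v b0 => [|m IHm] v b0 vm.
    have [t [b1 [E1 E2]]] := IH (rcons c v) b0 (szr v).
    exists t.+1, b1; rewrite /= E1 /= size_rcons last_rcons; split.
      by rewrite ifF ?ifT ?orbT //=; [rewrite -cats1 take_size_cat|apply/eqP; lia|rewrite /nilp size_rcons].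
    by rewrite E2 /val_from /tail (_ : n - v = 1) //=; [rewrite orbF andbT if_same|lia].
  have [t [b1 [E1 E2]]] := IH (rcons c v) b0 (szr v).
  have nv : n - v = (n - v.+1).+1 by lia.
  have vn : (v.+1 == n) = false by apply/eqP; lia.
  have nn : nilp (rcons c v) = false by rewrite /nilp size_rcons.
  (* A child's value equal to [own] decides the node: [true] under an existential, [false] under a
     universal quantifier. *)
  case e: (b1 == own (size c)).
    exists t.+1, b1; rewrite /= E1 /= nn size_rcons /= e /=; split; first by rewrite -cats1 take_size_cat.
    rewrite /val_from /tail nv /= -E2.
    by move/eqP: e => ->; case: (own _).
  have vm' : v.+1 + m.+1 = n by lia.
  have [t2 [b2 [E3 E4]]] := IHm v.+1 b1 vm'.
  exists (t2 + t.+1), b2; rewrite iterD /= E1 /= nn size_rcons last_rcons /= e vn /=.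
  have -> : take (size c) (rcons c v) = c by rewrite -cats1 take_size_cat.
  rewrite E3; split=> //.
  rewrite E4 /val_from /tail nv /= -E2; move: e; rewrite E2 -E2.
  by case: (own _); case: (b1).
have n0 : 0 + n.-1.+1 = n by lia.
have [t [b1 [E1 E2]]] := H n.-1 0 b n0.
exists t.+1, b1; rewrite iterSr /= cn; split=> //.
by rewrite E2 /val_from /tail subn0.
Qed.

Definition start_search := Search false false false [::].

Lemma search_halts : exists t, let s t := iter t search_step start_search in
  [/\ forall t', t' < t -> ~~ halted (s t'), halted (s t) & result (s t) = value n [::] && valid].
Proof.
have [t [b [E1 E2]]] := @search_value n [::] false (add0n n).
have ht : halted (iter t.+1 search_step start_search) by rewrite /= E1.
have ex : exists t, halted (iter t search_step start_search) by exists t.+1.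
(* The halting time in demand is the first one. A halted search is a fixed point of [search_step],
   so its result is the one found later. *)
have [m hm mmin] := ex_minnP ex.
exists m; split=> // [t' t'm|]; first by apply/negP => /mmin; lia.
have mt := mmin _ ht.
case: m hm mmin mt => [|m] //= hm mmin mt.
case e: (iter m search_step start_search) hm => [h b' r c]; case: r e => [|] e.
  case cnil: (nilp c); last first.
    by rewrite /= cnil; case: ifP.
  move=> _.
  have -> : search_step (Search h b' true c) = Search true (b' && valid) true [::] by rewrite /= cnil.
  have fix1 : search_step (Search true (b' && valid) true [::]) = Search true (b' && valid) true [::].
    by rewrite /=; case: valid; rewrite ?andbT ?andbF.
  have E3 : iter t.+1 search_step start_search = Search true (b && valid) true [::].
    by rewrite /= E1.
  move: E3; rewrite (_ : t.+1 = (t - m) + m.+1); last by lia.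
  by rewrite iterD /= e /= cnil iter_fix // -E2 => -[->].
by rewrite /=; case: ifP.
Qed.

Definition search_ok (s : search) := (size (stack s) <= n) && all (fun v => v < n) (stack s).

Lemma search_step_ok s : search_ok s -> search_ok (search_step s).
Proof.
case: s => h b r c; rewrite /search_ok /= => /andP[cn call].
have tk : all (fun v => v < n) (take (size c).-1 c).
  by apply/allP => v /mem_take; apply: (allP call).
case: r => /=; last first.
  by case: ltnP => /= [lt|_]; rewrite ?cn ?call // size_rcons lt all_rcons call andbT; lia.
case: nilP => //= cnn; case: ifP => [_|/negbT] /=; first by rewrite tk andbT size_take; case: ifP; lia.
rewrite negb_or => /andP[_ ln]; rewrite size_rcons all_rcons tk andbT.
have c0 : 0 < size c by case: (c) cnn.
rewrite size_takel ?leq_pred // prednK // cn /=.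
have : last 0 c < n by apply: (allP call); move: cnn; case/lastP: (c) => // s x _; rewrite last_rcons mem_rcons inE eqxx.
by move: ln => /eqP; lia.
Qed.

(** One-hot rows: row [i] marks the vertex at depth [i] and is empty beyond the stack, so the depth
    is the number of nonempty rows. *)
Definition stack_bit (c : seq nat) (i v : nat) : bool := (i < size c) && (nth 0 c i == v).

Definition search_bit (s : search) (j : nat) : bool :=
  match j with
  | 0 => halted s
  | 1 => result s
  | 2 => returning s
  | p.+3 => stack_bit (stack s) (p %/ n) (p %% n)
  end.

Lemma stack_bit_rcons c w i v :
  stack_bit (rcons c w) i v = stack_bit c i v || (i == size c) && (v == w).
Proof.
rewrite /stack_bit size_rcons nth_rcons ltnS leq_eqVlt.
by case: ltngtP => //= _; rewrite ?orbF // eq_sym.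
Qed.

Lemma stack_bit_take c d i v : stack_bit (take d c) i v = (i < d) && stack_bit c i v.
Proof.
by rewrite /stack_bit size_take_min leq_min -andbA; case: ltnP => //= id; rewrite nth_take.
Qed.
End Search.

(** The length of the block of ones behind the first bit, as the number of its nonempty prefixes. *)
Definition coded_order (x : seq bool) : nat :=
  sum_lt (size x) (fun k => all_lt k.+1 (fun j => read x j.+1 == 2)).
Definition coded_edge (x : seq bool) (u v : nat) : bool :=
  read x (coded_order x + 2 + u * coded_order x + v) == 2.
Definition well_formed (x : seq bool) : bool :=
  [&& 0 < size x, read x (coded_order x).+1 == 1, size x == coded_order x + 2 + coded_order x * coded_order x,
      all_lt (coded_order x) (fun u => ~~ coded_edge x u u) &
      all_lt (coded_order x) (fun u => all_lt (coded_order x) (fun v => coded_edge x u v == coded_edge x v u))].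
Definition own (x : seq bool) (i : nat) : bool := (read x 0 == 2) == (i %% 2 == 0).

Lemma computable_coded_order : computable (fun x y e => coded_order x).
Proof. rewrite /coded_order; computable. Qed.

Lemma computable_well_formed : computable (fun x y e => well_formed x).
Proof. have O := computable_coded_order; rewrite /well_formed /coded_edge; computable. Qed.

Lemma read_eq0 x p : (read x p == 0) = (size x <= p).
Proof. by rewrite /read -onthNE; case: onth. Qed.

Lemma read_cons b x p : read (b :: x) p.+1 = read x p.
Proof. by []. Qed.

Lemma read_cat x z p : read (x ++ z) p = if p < size x then read x p else read z (p - size x).
Proof. by rewrite /read onth_cat; case: ifP. Qed.

Lemma eq_from_read x z : (forall p, read x p = read z p) -> x = z.
Proof.
move=> e; apply: eq_from_onth => p; have := e p; rewrite /read.
by case: onth => [[]|]; case: onth => [[]|].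
Qed.

Lemma orderE x n : (forall j, j < n -> read x j.+1 = 2) -> read x n.+1 != 2 -> coded_order x = n.
Proof.
move=> Hlt Hn; rewrite /coded_order /sum_lt.
have E k : all_lt k.+1 (fun j => read x j.+1 == 2) = (k < n).
  apply/all_ltP/idP => [h|kn j jk]; last by apply/eqP/Hlt; lia.
  by rewrite ltnNge; apply/negP => nk; have := h n nk; rewrite (negPf Hn).
have nx : n <= size x.
  case: n Hlt {Hn E} => // n Hlt; have := Hlt n (ltnSn n).
  by case: (leqP n.+1 (size x)) => // /ltnW h; rewrite (eqP (_ : read x n.+1 == 0)) // read_eq0.
by rewrite (eq_bigr (fun i : 'I_(size x) => (i < n) : nat)) ?sum_below // => i _; rewrite E.
Qed.

Lemma onth_allpairs S T R (f : S -> T -> R) s t i j : j < size t ->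
  onth [seq f u v | u <- s, v <- t] (i * size t + j) =
  if onth s i is Some u then omap (f u) (onth t j) else None.
Proof.
move=> jt; elim: s i => [|u s IH] i; first by rewrite !onth0n.
have -> : [seq f u v | u <- u :: s, v <- t] = [seq f u v | v <- t] ++ [seq f u v | u <- s, v <- t] by [].
rewrite onth_cat size_map; case: i => [|i] /=; first by rewrite jt onth_map.
rewrite ifF; last by rewrite mulSn; lia.
by rewrite -IH; congr onth; rewrite mulSn; lia.
Qed.

Lemma onth_enum n (i : 'I_n) : onth (enum 'I_n) i = Some i.
Proof.
have := onthTE (enum 'I_n) i; rewrite size_enum_ord ltn_ord.
case e: onth => [j|//] _; congr Some; apply: val_inj.
by rewrite /= -(onth_nth i _ _ _ e) nth_enum_ord.
Qed.

Section Encode.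
Variables (G : graph) (first : player).
Local Notation n := (nvertices G).
Local Notation x := (encode G first).

Lemma read_encode_first : read x 0 == 2 = (first == Dominator).
Proof. by case: first. Qed.

Lemma order_encode : coded_order x = n.
Proof.
apply: orderE => [j jn|]; rewrite /encode read_cons read_cat size_nseq ?jn ?ltnn ?subnn //.
by rewrite /read onth_nseq jn.
Qed.

Lemma read_encode_sep : read x n.+1 = 1.
Proof. by rewrite /encode read_cons read_cat size_nseq ltnn subnn. Qed.

Lemma read_encode_adj (u v : vertex G) : read x (n + 2 + u * n + v) = (adj u v).+1.
Proof.
have -> : n + 2 + u * n + v = (n + (u * n + v).+1).+1 by lia.
rewrite /encode read_cons read_cat size_nseq ltnNge leq_addr /= addKn read_cons /read.
have := @onth_allpairs _ _ _ (@adj G) (enum (vertex G)) (enum (vertex G)) u v.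
by rewrite size_enum_ord => -> //; rewrite !onth_enum.
Qed.

Lemma edge_encode (u v : vertex G) : coded_edge x u v = adj u v.
Proof. by rewrite /coded_edge order_encode read_encode_adj; case: adj. Qed.

Lemma size_encode : size x = n + 2 + n * n.
Proof. by rewrite /= size_cat size_nseq /= size_allpairs size_enum_ord; lia. Qed.

Lemma well_formed_encode : well_formed x.
Proof.
rewrite /well_formed order_encode read_encode_sep size_encode !eqxx (_ : 0 < n + 2 + n * n) /=; last by lia.
apply/andP; split; apply/all_ltP => u un.
  by rewrite (edge_encode (Ordinal un) (Ordinal un)) adj_irr.
apply/all_ltP => v vn.
by rewrite (edge_encode (Ordinal un) (Ordinal vn)) (edge_encode (Ordinal vn) (Ordinal un)) adj_sym.
Qed.
End Encode.

Lemma order_prefix x j : j < coded_order x -> read x j.+1 = 2.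
Proof.
have [m Hm] : exists m, read x m.+1 != 2.
  by exists (size x); rewrite (eqP (_ : read x (size x).+1 == 0)) // read_eq0.
have ex : exists m, read x m.+1 != 2 by exists m.
have [k Hk kmin] := ex_minnP ex.
have lt_k i : i < k -> read x i.+1 = 2.
  by move=> ik; apply/eqP; apply: contraTT ik => h; rewrite -leqNgt; apply: kmin.
by rewrite (orderE lt_k Hk); apply: lt_k.
Qed.

Lemma well_formedP x : well_formed x -> exists G first, x = encode G first.
Proof.
move=> /and5P[x0 sep /eqP sz irr sym].
set n := coded_order x in sep sz irr sym.
pose e (u v : 'I_n) := coded_edge x u v.
have esym : symmetric e 
  by move=> u v; move/all_ltP: sym => /(_ u (ltn_ord u))/all_ltP/(_ v (ltn_ord v))/eqP.
have eirr : irreflexive e by move=> u; move/all_ltP: irr => /(_ u (ltn_ord u))/negbTE.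
pose G := Graph esym eirr.
exists G, (if read x 0 == 2 then Dominator else Staller).
set f := (if _ then _ else _).
apply: eq_from_read => -[|p].
  have -> : read (encode G f) 0 = (is_dominator f).+1 by [].
  have : read x 0 != 0 by rewrite read_eq0 -ltnNge.
  by have := read_le x 0; rewrite /f; case: read => [|[|[]]].
have [pn|np] := ltnP p n.
  by rewrite order_prefix // order_prefix // order_encode.
case: (ltngtP p n) np => // [np|->] _; last first.
  by rewrite (eqP sep) (@read_encode_sep G).
have [lt|ge] := ltnP p.+1 (size x); last first.
  have r0 y : size y <= p.+1 -> read y p.+1 = 0 by move=> yp; apply/eqP; rewrite read_eq0.
  by rewrite !r0 // size_encode -sz.
have qn : p - n.+1 < n * n by lia.
have n0 : 0 < n by case: (n) qn => //; rewrite mul0n.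
have q1 : (p - n.+1) %/ n < n by rewrite ltn_divLR.
have q2 : (p - n.+1) %% n < n by rewrite ltn_mod.
have E : p.+1 = n + 2 + (p - n.+1) %/ n * n + (p - n.+1) %% n.
  by rewrite -addnA -divn_eq; lia.
rewrite [in RHS]E (@read_encode_adj G f (Ordinal q1) (Ordinal q2)) /= /e /coded_edge /= -/n -E.
have : read x p.+1 != 0 by rewrite read_eq0 -ltnNge.
by have := read_le x p.+1; case: read => [|[|[]]].
Qed.

(* [g i v]: move [i] claims [v]. The player who is first to claim a vertex twice loses. *)
Definition repeats (x : seq bool) (g : nat -> nat -> bool) (i : nat) : bool :=
  some_lt (coded_order x) (fun v => g i v && some_lt i (fun i' => g i' v)).
Definition dominated (x : seq bool) (g : nat -> nat -> bool) : bool :=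
  all_lt (coded_order x) (fun v => some_lt (coded_order x) (fun u =>
    ((u == v) || coded_edge x u v) && some_lt (coded_order x) (fun i => own x i && g i u))).
Definition leaf (x : seq bool) (g : nat -> nat -> bool) : bool :=
  (all_lt (coded_order x) (fun i => ~~ repeats x g i) && dominated x g) ||
  some_lt (coded_order x) (fun i => repeats x g i &&
    (all_lt i (fun i' => ~~ repeats x g i') && ~~ own x i)).

Lemma nth_take_uniq (c : seq nat) i : uniq c -> i < size c -> nth 0 c i \notin take i c.
Proof.
move=> uc ic; have : uniq (take i.+1 c) by apply: take_uniq.
by rewrite (take_nth 0) // rcons_uniq => /andP[].
Qed.

Section LeafValue.
Variables (G : graph) (first : player).
Local Notation n := (nvertices G).
Local Notation x := (encode G first).
Local Notation leafx := (fun c => leaf x (stack_bit c)).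

Lemma own_encode i : own x i = dom_turn first i.
Proof.
rewrite /own read_encode_first /dom_turn /mover modn2.
by case: first; case: (odd i).
Qed.

Lemma repeatsE c i : size c = n -> all (fun v => v < n) c -> i < n ->
  repeats x (stack_bit c) i = (nth 0 c i \in take i c).
Proof.
move=> sc /allP call lin; rewrite /repeats order_encode.
have si : size (take i c) = i by rewrite size_takel // sc ltnW.
apply/some_ltP/idP => [[v vn /andP[/andP[_ /eqP <-] /some_ltP[j ji /andP[_ /eqP ej]]]]|].
  by rewrite -ej -(nth_take _ ji) mem_nth // si.
move=> h; exists (nth 0 c i); first by apply/call/mem_nth; rewrite sc.
rewrite /stack_bit sc lin eqxx /=; apply/some_ltP.
have := h; rewrite -index_mem si => lt; exists (index (nth 0 c i) (take i c)) => //.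
by rewrite -(nth_take 0 lt) nth_index // eqxx andbT; lia.
Qed.

(** All leaves below share their first repetition, so further play cannot change who is punished. *)
Lemma value_repeat k c v s : uniq c -> v \in c -> all (fun v => v < n) (rcons c v ++ s) ->
  size (rcons c v ++ s) + k = n ->
  value n leafx (own x) k (rcons c v ++ s) = ~~ own x (size c).
Proof.
move=> uc vc; elim: k s => [|k IH] s call sz; last first.
  have n0 : 0 < n by lia.
  have E w : w < n -> value n leafx (own x) k (rcons (rcons c v ++ s) w) = ~~ own x (size c).
    move=> wn; rewrite -cats1 -catA IH //; first by rewrite catA all_cat call /= wn.
    by move: sz; rewrite !size_cat /=; lia.
  rewrite /=; case: (own x (size (_ ++ _))).
    apply/some_ltP/idP => [[w wn]|h]; first by rewrite E.
    by exists 0; rewrite ?E.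
  by apply/all_ltP/idP => [/(_ 0 n0)|h w wn]; rewrite E.
rewrite addn0 in sz; rewrite /= /leaf.
set c1 := rcons c v ++ s in call sz *.
have cn : size c < n by rewrite -sz size_cat size_rcons; lia.
have tk i : i <= size c -> take i c1 = take i c.
  by move=> ic; rewrite /c1 -cats1 -catA takel_cat.
have nt : nth 0 c1 (size c) = v by rewrite /c1 -cats1 -catA nth_cat ltnn subnn.
have rep : repeats x (stack_bit c1) (size c) by rewrite repeatsE // tk // take_size nt.
have norep i : i < size c -> ~~ repeats x (stack_bit c1) i.
  move=> ic; rewrite repeatsE //; last exact: ltn_trans ic cn.
  rewrite tk ?(ltnW ic) //.
  have -> : nth 0 c1 i = nth 0 c i by rewrite /c1 -cats1 -catA nth_cat ic.
  exact: nth_take_uniq.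
rewrite order_encode.
have -> : all_lt n (fun i => ~~ repeats x (stack_bit c1) i) = false.
  by apply/negbTE/negP => /all_ltP/(_ _ cn); rewrite rep.
apply/some_ltP/idP => [[i lin /and3P[ri /all_ltP below]]|h].
  case: (ltngtP i (size c)) => [ic|ci|-> //]; first by have := norep i ic; rewrite ri.
  by have := below _ ci; rewrite rep.
by exists (size c); rewrite ?rep //= h andbT; apply/all_ltP.
Qed.

Lemma leaf_dominating (h : seq (vertex G)) : uniq h -> size h = n ->
  leafx (map val h) = dominating (claimed first Dominator h).
Proof.
move=> uh sh; set c := map val h.
have uc : uniq c by rewrite map_inj_uniq //; apply: val_inj.
have sc : size c = n by rewrite size_map.
have call : all (fun v => v < n) c by apply/allP => v /mapP[w _ ->]; apply: ltn_ord.
have norep i : i < n -> ~~ repeats x (stack_bit c) i.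
  by move=> lin; rewrite repeatsE // nth_take_uniq ?sc.
rewrite /leaf order_encode.
have -> : all_lt n (fun i => ~~ repeats x (stack_bit c) i) by apply/all_ltP.
rewrite /= [X in _ || X](_ : _ = false) ?orbF; last first.
  by apply/negbTE/negP => /some_ltP[i lin /andP[ri _]]; have := norep i lin; rewrite ri.
have claimE (u : vertex G) :
    some_lt n (fun i => own x i && stack_bit c i u) = (u \in claimed first Dominator h).
  rewrite inE; apply/some_ltP/andP => [[i lin /andP[oi /andP[_ /eqP e]]]|[uh' turn]].
    have ih : i < size h by rewrite sh.
    have eu : nth u h i = u by apply: val_inj; rewrite /= -e /c (nth_map u).
    by rewrite -eu mem_nth // index_uniq // -[_ == _]own_encode.
  have ih : index u h < n by move: uh'; rewrite -index_mem; move: sh => ->.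
  exists (index u h) => //; rewrite own_encode /dom_turn turn /stack_bit sc ih /=.
  by rewrite /c (nth_map u) ?index_mem // nth_index.
rewrite /dominated order_encode; apply/all_ltP/forallP => [H v|H v vn].
  have /some_ltP[u un /andP[uv /=]] := H v (ltn_ord v).
  rewrite (claimE (Ordinal un)) => uD; apply/orP.
  case/orP: uv => [/eqP uv|]; first by left; rewrite -(_ : Ordinal un = v) //; apply: val_inj.
  by rewrite (edge_encode first (Ordinal un) v) => uv; right; apply/exists_inP; exists (Ordinal un).
apply/some_ltP; have /orP[vD|/exists_inP[u uD uv]] := H (Ordinal vn).
  by exists v => //; rewrite eqxx (claimE (Ordinal vn)).
by exists u; rewrite ?claimE ?uD //= (edge_encode first u (Ordinal vn)) uv orbT.
Qed.

(** A repeated claim has the value that is neutral for the quantifier of its mover, [false] for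
    Dominator and [true] for Staller, so the extra children do no harm. *)
Lemma value_gval k (h : seq (vertex G)) : uniq h -> size h + k = n ->
  value n leafx (own x) k (map val h) = gval first k h.
Proof.
elim: k h => [|k IH] h uh sh; first by rewrite addn0 in sh; apply: leaf_dominating.
have fresh (v : vertex G) : v \notin h ->
    value n leafx (own x) k (rcons (map val h) v) = gval first k (rcons h v).
  move=> vh; rewrite -map_rcons IH // ?rcons_uniq ?vh // size_rcons; lia.
have stale (v : vertex G) : v \in h ->
    value n leafx (own x) k (rcons (map val h) v) = ~~ dom_turn first (size h).
  move=> vh; have := @value_repeat k (map val h) v [::].
  rewrite cats0 size_map own_encode; apply.
  - by rewrite map_inj_uniq //; apply: val_inj.
  - exact: map_f.
  - by rewrite -map_rcons; apply/allP => w /mapP[u _ ->]; apply: ltn_ord.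
  - by rewrite size_rcons size_map addSnnS; exact: sh.
rewrite /= size_map own_encode; case: ifP => turn.
  apply/some_ltP/existsP => [[v vn]|[v /andP[vh gv]]]; last by exists v; rewrite ?fresh.
  case vh: (Ordinal vn \in h); first by rewrite (stale _ vh) turn.
  by rewrite (fresh (Ordinal vn)) ?vh // => gv; exists (Ordinal vn); rewrite vh.
apply/all_ltP/forallP => [H v|H v vn].
  by apply/implyP => vh; rewrite -fresh //; apply: H.
case vh: (Ordinal vn \in h); first by rewrite (stale _ vh) turn.
by rewrite (fresh (Ordinal vn)) ?vh //; have := H (Ordinal vn); rewrite vh.
Qed.

Lemma value_winning : value n leafx (own x) n [::] <-> has_winning_strategy G first Dominator.
Proof. by rewrite -gval_winning -(@value_gval n [::]). Qed.
End LeafValue.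

Lemma eq_some_lt n (B C : nat -> bool) : (forall i, i < n -> B i = C i) -> some_lt n B = some_lt n C.
Proof. by move=> e; apply: eq_in_has => i; rewrite mem_iota; apply: e. Qed.

Lemma eq_all_lt n (B C : nat -> bool) : (forall i, i < n -> B i = C i) -> all_lt n B = all_lt n C.
Proof. by move=> e; apply: eq_in_all => i; rewrite mem_iota; apply: e. Qed.

Lemma eq_leaf x g g' : (forall i v, i < coded_order x -> v < coded_order x -> g i v = g' i v) ->
  leaf x g = leaf x g'.
Proof.
move=> e; have R i : i < coded_order x -> repeats x g i = repeats x g' i.
  move=> lin; apply: eq_some_lt => v vn; rewrite e //; congr andb.
  by apply: eq_some_lt => i' i'i; apply: e => //; apply: ltn_trans lin.
congr ((_ && _) || _).
- by apply: eq_all_lt => i lin; rewrite R.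
- apply: eq_all_lt => v vn; apply: eq_some_lt => u un; congr andb.
  by apply: eq_some_lt => i lin; rewrite e.
- apply: eq_some_lt => i lin; rewrite R //; congr (_ && (_ && _)).
  by apply: eq_all_lt => i' i'i; rewrite R //; apply: ltn_trans lin.
Qed.

(** * The search as an iteration on words *)

Section Bits.
Variable chk : seq bool -> bool.
Implicit Types x y : seq bool.

Definition flag y (j : nat) : bool := read y j == 2.
Definition bit x y (i v : nat) : bool := flag y (3 + i * coded_order x + v).
Definition depth x y : nat :=
  sum_lt (coded_order x) (fun i => some_lt (coded_order x) (fun v => bit x y i v)).
Definition pops x y : bool :=
  (flag y 1 == own x (depth x y - 1)) || bit x y (depth x y - 1) (coded_order x - 1).

Definition next_halted x y := flag y 2 && (depth x y == 0).
Definition next_result x y :=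
  if flag y 2 then flag y 1 && ((0 < depth x y) || (well_formed x && chk x))
  else if depth x y < coded_order x then flag y 1 else leaf x (bit x y).
Definition next_returning x y :=
  if flag y 2 then (depth x y == 0) || pops x y else ~~ (depth x y < coded_order x).
Definition next_stack x y i v :=
  if flag y 2 then
    if i == depth x y - 1 then ~~ pops x y && ((0 < v) && bit x y i (v - 1)) else bit x y i v
  else bit x y i v || ((depth x y < coded_order x) && ((i == depth x y) && (v == 0))).

Definition next_bit x y (j : nat) : bool :=
  if j == 0 then next_halted x y
  else if j == 1 then next_result x y
  else if j == 2 then next_returning x y
  else next_stack x y ((j - 3) %/ coded_order x) ((j - 3) %% coded_order x).

Hypothesis computable_chk : computable (fun x y e => chk x).

Lemma computable_depth : computable (fun x y e => depth x y).
Proof. have O := computable_coded_order; rewrite /depth /bit /flag; computable. Qed.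

Lemma computable_pops : computable (fun x y e => pops x y).
Proof. have O := computable_coded_order; have := computable_depth; rewrite /pops /bit /flag /own => D; computable. Qed.

Lemma computable_next_bit : computable (fun x y e => next_bit x y (e 0)).
Proof.
have O := computable_coded_order; have D := computable_depth; have P := computable_pops; have W := computable_well_formed.
rewrite /next_bit /next_halted /next_result /next_returning /next_stack.
rewrite /leaf /dominated /repeats /bit /flag /own /coded_edge; computable.
Qed.

Section Step.
Variables (x y : seq bool) (s : search).
Let n := coded_order x.
Let leafx c := leaf x (stack_bit c).
Let valid := well_formed x && chk x.
Hypothesis ok : search_ok n s.
Hypothesis ys : forall p, p < 3 + n * n -> flag y p = search_bit n s p.

Lemma bitE i v : i < n -> v < n -> bit x y i v = stack_bit (stack s) i v.
Proof.
move=> lin vn; rewrite /bit -/n ys; last by have := leq_mul lin (leqnn n); lia.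
rewrite -addnA /= divnMDl ?divn_small ?addn0 ?modnMDl ?modn_small //; lia.
Qed.

Lemma depthE : depth x y = size (stack s).
Proof.
have /andP[sn /allP call] := ok.
rewrite /depth -/n /sum_lt -[RHS](sum_below sn); apply: eq_bigr => i _; congr nat_of_bool.
apply/some_ltP/idP => [[v vn]|ic]; first by rewrite bitE // => /andP[].
have ni : nth 0 (stack s) i < n by apply/call/mem_nth.
by exists (nth 0 (stack s) i); rewrite // bitE // /stack_bit ic eqxx.
Qed.

Lemma flagE p : p < 3 -> flag y p = search_bit n s p.
Proof. by move=> p3; apply: ys; lia. Qed.

Lemma next_bitE p : p < 3 + n * n ->
  next_bit x y p = search_bit n (search_step n leafx (own x) valid s) p.
Proof.
have /andP[sn /allP call] := ok.
have popsE : 0 < size (stack s) ->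
    pops x y = (result s == own x (size (stack s)).-1) || ((last 0 (stack s)).+1 == n).
  move=> s0; have n0 : 0 < n by lia.
  rewrite /pops depthE flagE //= subn1; congr (_ || _).
  rewrite -/n bitE; [|lia|lia]; rewrite /stack_bit subn1 nth_last.
  have -> : (size (stack s)).-1 < size (stack s) by lia.
  by rewrite /=; apply/eqP/eqP; lia.
have SB := stack_bit_rcons; have ST := stack_bit_take.
rewrite /next_bit /next_halted /next_result /next_returning /next_stack depthE !flagE //.
case: s ok ys sn call popsE bitE depthE flagE => h b r c /= _ _ sn call popsE bE _ _.
move=> pn.
have nil0 : (0 < size c) = ~~ nilp c by rewrite lt0n.
have nil1 : (size c == 0) = nilp c by [].
rewrite nil0 in popsE; rewrite nil0 nil1.
case: p pn => [|[|[|p]]] pn //=.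
- by case: r => /=; do ?[case: ifP => //= _].
- case: r => /=; first by do ?[case: ifP => //= _]; rewrite andbT.
  case: ltnP => //= ge; rewrite /leafx; apply: eq_leaf; exact: bE.
- case: r => /=; last by case: ltnP.
  by case: (boolP (nilp c)) popsE => //= _ -> //; case: ifP.
rewrite (_ : p.+3 - 3 = p) -?/n; last by lia.
have n0 : 0 < n by case: (n) pn => //; rewrite mul0n.
set i := p %/ n; set v := p %% n.
have lin : i < n by rewrite /i ltn_divLR //; lia.
have vn : v < n by rewrite ltn_mod.
have cv w : w < n -> bit x y i w = stack_bit c i w by move=> wn; rewrite bE.
rewrite !cv //; last by lia.
case: r => /=; last first.
  case: ltnP => //= _; rewrite ?orbF //; rewrite SB; congr (_ || (_ && _)); exact: eq_sym.
case: (boolP (nilp c)) popsE => [/nilP-> _|cn /(_ isT) ->] /=.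
  by rewrite /stack_bit /= !andbF; case: ifP.
have c0 : 0 < size c by rewrite nil0.
rewrite subn1; set q := (b == _) || _; case: q => /=.
  by rewrite ST; case: eqP => [->|ne]; rewrite ?ltnn //; rewrite /stack_bit; case: (ltnP i (size c)); rewrite ?andbF //=; case: ltnP => //; lia.
rewrite SB ST size_takel ?leq_pred //.
case: eqP => [->|ne] /=.
  rewrite ltnn /= /stack_bit; have -> : (size c).-1 < size c by lia.
  by rewrite nth_last /=; case: (v) => [|v'] //=; rewrite subn1 eqSS eq_sym.
by rewrite orbF /stack_bit; case: (ltnP i (size c)); rewrite ?andbF //=; case: ltnP => //; lia.
Qed.
End Step.

(** [chk] lets one argument cover every class of graphs that an expression recognizes from the
    code. *)
Theorem PSPACE_class (C : graph -> Prop) : (forall G first, chk (encode G first) <-> C G) ->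
  PSPACE (yes_instances (MB_Dom_Game_on C)).
Proof.
move=> chkC.
apply: (@PSPACE_iter _ (fun x => 3 + coded_order x * coded_order x) (fun x y j => next_bit x y j)).
- by have O := computable_coded_order; computable.
- exact: computable_next_bit.
move=> x; set n := coded_order x.
pose leafx c := leaf x (stack_bit c); pose valid := well_formed x && chk x.
have [t /= [before now res]] := search_halts n leafx (own x) valid.
exists t; set F := fun y => _; pose S t := iter t (search_step n leafx (own x) valid) start_search.
have okS k : search_ok n (S k) by elim: k => //= k; apply: search_step_ok.
have FS k p : p < 3 + n * n -> flag (iter k F [::]) p = search_bit n (S k) p.
  elim: k p => [|k IH] p pn.
    (* The empty word already encodes the start: flags down, stack empty. *)
    rewrite /flag /read onth0n /=; case: p pn => [|[|[|p]]] //= _.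
  rewrite -[RHS](next_bitE (okS k) IH pn) /F /= /flag /read.
  set f := fun j => _; rewrite (_ : onth (mkseq f _) p = Some (f p)) /f; last first.
    have := onthTE (mkseq f (3 + n * n)) p; rewrite size_mkseq pn.
    case e: onth => [a|//] _; congr Some.
    by rewrite -(onth_nth false _ _ _ e) nth_mkseq.
  by case: next_bit.
have nthE k p : p < 2 -> nth false (iter k F [::]) p = search_bit n (S k) p.
  move=> p2; rewrite -FS; last by lia.
  by rewrite /flag /read -odflt_onth; case: onth => [[]|].
split=> /=; first by move=> t' /before; rewrite nthE.
  by rewrite nthE.
rewrite nthE //= res; split=> [/andP[v /andP[wf ck]]|[[G [first [CG e]]] [G' [first' [e' w]]]]].
  have [G [first e]] := well_formedP wf.
  move: ck v; rewrite /leafx /n e order_encode => /chkC CG /value_winning win.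
  by split; exists G, first.
have wf : well_formed x by rewrite e well_formed_encode.
have ck : chk x by rewrite e; apply/chkC.
(* [G] and [G'] may be different records with the same code; order and value depend on the code
   alone. *)
by rewrite /valid wf ck /leafx /n e' order_encode andbT (proj2 (value_winning G' first') w).
Qed.
End Bits.

(** * From hypergraphs to graphs *)

Section Hypergraph.
(* Points are the numbers below [P] and hyperedges the numbers below [E]. *)
Variables (P E : nat) (inc : nat -> nat -> bool).

(* [maker_wins D S]: Maker, owning [S] and about to move, completes a hyperedge although
   Breaker owns [D]; a reply outside the point set is a pass. *)
Inductive maker_wins (D S : seq nat) : Prop :=
  | MakerDone e : e < E -> (forall y, y < P -> inc e y -> y \in S) -> maker_wins D S
  | MakerMove v : v < P -> v \notin D -> v \notin S ->
      (forall u, u \notin v :: S -> maker_wins (u :: D) (v :: S)) -> maker_wins D S.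

(** A strategy of Breaker as a set of safe positions. The reply [u] may be a point of [D] or no
    point at all, so passing is allowed. *)
Definition breaker_invariant (I : seq nat -> seq nat -> Prop) : Prop :=
  (forall D S, I D S -> forall e, e < E -> exists y, [/\ y < P, inc e y & y \notin S]) /\
  (forall D S, I D S -> forall v, v < P -> v \notin D -> v \notin S ->
     exists2 u, u \notin v :: S & I (u :: D) (v :: S)).

(** A copy must be free when it is needed: at most [2 * P + 2] vertices are claimed when Maker
    completes a hyperedge, and 4 when Staller, having taken vertices 0 and 1, moves again; the
    summand 5 covers this even for [P = 0]. *)
Definition copies : nat := 2 * P + 5.
Definition hyper_order : nat := 2 + P + E.+1 * copies.

(* Vertex 0 is universal, vertex 1 dominates everything but the copies of the hyperedges,
   the points follow, and then every hyperedge has [copies] vertices adjacent to its points,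
   more than are claimed before Maker completes a hyperedge.
   Block 0 of copies plays the part of a hyperedge consisting of vertex 1 only. *)
Definition arc (u v : nat) : bool :=
  ((u == 0) && (v != 0)) ||
  (((u == 1) && ((1 < v) && (v < 2 + P + copies))) ||
   ((1 < u) && ((u < 2 + P) && ((2 + P + copies <= v) &&
      inc ((v - (2 + P)) %/ copies - 1) (u - 2))))).
Definition adjacent (u v : nat) : bool := arc u v || arc v u.

Definition hyper_adj : rel 'I_hyper_order := fun u v => adjacent u v.

Lemma hyper_adj_sym : symmetric hyper_adj.
Proof. by move=> u v; rewrite /hyper_adj /adjacent orbC. Qed.

Lemma hyper_adj_irr : irreflexive hyper_adj.
Proof. by move=> u; rewrite /hyper_adj /adjacent /arc; lia. Qed.

Definition hyper_graph : graph := Graph hyper_adj_sym hyper_adj_irr.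
Local Notation G := hyper_graph.

Lemma order_ge : 2 + P + copies <= hyper_order.
Proof. by rewrite /hyper_order mulSn; lia. Qed.

Lemma order_gt1 : 1 < hyper_order. Proof. by have := order_ge; lia. Qed.

Definition apex : vertex G := Ordinal (ltnW order_gt1).
Definition hub : vertex G := Ordinal order_gt1.

Lemma copy_lt b c : b <= E -> c < copies -> 2 + P + b * copies + c < hyper_order.
Proof.
move=> bE cc; rewrite /hyper_order; have := leq_mul bE (leqnn copies); rewrite mulSn; lia.
Qed.

Lemma apex_dominates (D : {set vertex G}) : apex \in D -> dominating D.
Proof.
move=> aD; apply/forallP => v; have [->|va] := eqVneq v apex; first by rewrite aD.
apply/orP; right; apply/exists_inP; exists apex => //.
by rewrite /= /hyper_adj /adjacent /arc /= (_ : (v : nat) != 0).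
Qed.

Lemma gamma_hyper : gamma G = 1.
Proof.
rewrite /gamma; case: arg_minnP => [|D domD minD].
  by apply: apex_dominates; rewrite inE.
apply/eqP; rewrite eqn_leq -{1}(cards1 apex) minD; last by apply: apex_dominates; rewrite inE.
rewrite card_gt0; apply/negP => /eqP D0; move/forallP: domD => /(_ apex).
by rewrite D0 inE => /exists_inP[u]; rewrite inE.
Qed.

(** * Positions of the domination game on this graph *)

Local Notation claims := (@claimed G Staller).

Lemma claims_rcons pl h v : v \notin h ->
  claims pl (rcons h v) = if mover Staller (size h) == pl then v |: claims pl h else claims pl h.
Proof.
move=> vh; apply/setP => u; rewrite inE mem_rcons inE -cats1 index_cat.
have [uh|uh] := boolP (u \in h).
  have uv : (u == v) = false by apply: contraNF vh => /eqP <-.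
  by rewrite orbT; case: ifP => _; rewrite !inE uh // uv.
have [->|uv] := eqVneq u v; last by case: ifP => _; rewrite !inE (negPf uh) ?(negPf uv).
by rewrite /= eqxx addn0; case: ifP => _; rewrite !inE ?eqxx // (negPf vh).
Qed.

Lemma claims_in pl h u : u \in claims pl h -> u \in h.
Proof. by rewrite inE => /andP[]. Qed.

Lemma claims_either h u : u \in h -> u \notin claims Staller h -> u \in claims Dominator h.
Proof. by move=> uh; rewrite !inE uh /=; case: mover. Qed.

Lemma claims_disjoint h u : u \in claims Staller h -> u \notin claims Dominator h.
Proof. by rewrite !inE => /andP[_ /eqP ->]; rewrite andbF. Qed.

Lemma gval_apex k h : apex \in claims Dominator h -> size h + k = hyper_order -> gval Staller k h.
Proof.
elim: k h => [|k IH] h ah sh /=; first exact: apex_dominates.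
have mono v : v \notin h -> gval Staller k (rcons h v).
  move=> vh; apply: IH; last by rewrite size_rcons addSnnS.
  by rewrite claims_rcons //; case: ifP => _ //; rewrite inE ah orbT.
case: ifP => _; last by apply/forallP => v; apply/implyP; apply: mono.
have [|v vh] := @fresh_vertex G h; first by rewrite /= -sh addnS ltnS leq_addr.
by apply/existsP; exists v; rewrite vh mono.
Qed.

Definition closed_nbhd_claimed (h : seq (vertex G)) (z : vertex G) : Prop :=
  z \in claims Staller h /\ forall u, hyper_adj u z -> u \in claims Staller h.

Lemma gval_lost k h z : closed_nbhd_claimed h z -> size h + k = hyper_order -> ~~ gval Staller k h.
Proof.
elim: k h => [|k IH] h [zh nz] sh /=.
  apply/negP => /forallP/(_ z); rewrite (negPf (claims_disjoint zh)) => /exists_inP[u uD /nz uS].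
  by move: uD; apply/negP/claims_disjoint.
have mono v : v \notin h -> ~~ gval Staller k (rcons h v).
  move=> vh; apply: IH; last by rewrite size_rcons addSnnS.
  have sub u : u \in claims Staller h -> u \in claims Staller (rcons h v).
    by move=> uS; rewrite claims_rcons //; case: ifP => _ //; rewrite inE uS orbT.
  by split=> [|u /nz]; apply: sub.
case: ifP => _; first by apply/negP => /existsP[v /andP[/mono/negPf ->]].
have [|v vh] := @fresh_vertex G h; first by rewrite /= -sh addnS ltnS leq_addr.
by apply/negP => /forallP/(_ v); rewrite vh /=; apply/negP/mono.
Qed.

Definition vertex_at (i : nat) : vertex G := insubd apex i.

Lemma vertex_atK i : i < hyper_order -> vertex_at i = i :> nat.
Proof. by move=> iN; rewrite /vertex_at val_insubd iN. Qed.

Definition point (y : nat) : vertex G := vertex_at (2 + y).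

Lemma pointK y : y < P -> point y = 2 + y :> nat.
Proof. by move=> yP; rewrite /point vertex_atK //; have := order_ge; lia. Qed.

Lemma point_inj y z : y < P -> z < P -> point y = point z -> y = z.
Proof. by move=> yP zP /(congr1 (@nat_of_ord _)); rewrite !pointK //; lia. Qed.

Lemma adjacent_point y i : y < P -> 2 + P + copies <= i ->
  adjacent (2 + y) i = inc ((i - (2 + P)) %/ copies - 1) y.
Proof.
move=> yP iP; rewrite /adjacent /arc (_ : 2 + y - 2 = y); last by lia.
by move: (inc _ (i - 2)) (inc _ y) => [] []; lia.
Qed.

Lemma adjacent_hub i : i < 2 + P + copies -> i != 1 -> adjacent 1 i.
Proof. by rewrite /adjacent /arc; case: i => [|[|i]] //= ->. Qed.

Lemma adjacent_copy u i : 2 + P + copies <= i -> adjacent u i ->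
  u = 0 \/ [/\ 1 < u, u - 2 < P & inc ((i - (2 + P)) %/ copies - 1) (u - 2)].
Proof.
rewrite /adjacent /arc => iP; have [->|u0] := eqVneq u 0; first by left.
move=> h; right; move: h; case: (inc _ (u - 2)) => h; first by split=> //; lia.
by exfalso; move: h; case: (inc _ (i - 2)); lia.
Qed.

Lemma adjacent_hub_copy u i : 2 + P <= i < 2 + P + copies -> adjacent u i -> u = 0 \/ u = 1.
Proof.
rewrite /adjacent /arc => iP; case: u => [|[|u]]; [by left|by right|].
by move: (inc _ (u.+2 - 2)) (inc _ (i - 2)) => [] []; lia.
Qed.

Lemma adj_point_copy y (z : vertex G) : y < P -> 2 + P + copies <= z ->
  hyper_adj (point y) z = inc ((z - (2 + P)) %/ copies - 1) y.
Proof. by move=> yP zP; rewrite /hyper_adj pointK //; apply: adjacent_point. Qed.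

Lemma adj_hub (z : vertex G) : z < 2 + P + copies -> z != hub -> hyper_adj hub z.
Proof. by move=> zl zh; apply: adjacent_hub => //; apply: contra zh => /eqP z1; apply/eqP/val_inj. Qed.

Lemma adj_to_copy (u z : vertex G) : 2 + P + copies <= z -> hyper_adj u z ->
  u = apex \/ exists y, [/\ y < P, u = point y & inc ((z - (2 + P)) %/ copies - 1) y].
Proof.
move=> zl /(adjacent_copy zl)[u0|[u1 uP iu]]; [left|right; exists (u - 2); split=> //];
  by apply: val_inj; rewrite //= pointK //; lia.
Qed.

Lemma adj_to_hub_copy (u z : vertex G) : 2 + P <= z < 2 + P + copies -> hyper_adj u z ->
  u = apex \/ u = hub.
Proof. by move=> zl /(adjacent_hub_copy zl)[u0|u1]; [left|right]; apply: val_inj. Qed.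

Lemma block_copy b c : c < copies -> (2 + P + b * copies + c - (2 + P)) %/ copies = b.
Proof.
move=> cc; have -> : 2 + P + b * copies + c - (2 + P) = b * copies + c by lia.
by rewrite divnMDl ?divn_small ?addn0 //; lia.
Qed.

Lemma block_lt i : 2 + P + copies <= i -> i < hyper_order -> (i - (2 + P)) %/ copies - 1 < E.
Proof.
move=> il iN; have c0 : 0 < copies by rewrite /copies; lia.
have h : (i - (2 + P)) %/ copies < E.+1 by rewrite ltn_divLR //; move: iN; rewrite /hyper_order; lia.
have : 0 < (i - (2 + P)) %/ copies by rewrite divn_gt0 //; lia.
by lia.
Qed.

Lemma free_copy (h : seq (vertex G)) b : size h < copies -> b <= E -> exists z : vertex G,
  [/\ z \notin h, (z - (2 + P)) %/ copies = b & 2 + P + b * copies <= z < 2 + P + b.+1 * copies].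
Proof.
move=> hc bE.
pose f (c : 'I_copies) := vertex_at (2 + P + b * copies + c).
have fK c : f c = 2 + P + b * copies + c :> nat by rewrite vertex_atK // copy_lt.
have finj : injective f.
  by move=> c d /(congr1 (@nat_of_ord _)); rewrite !fK => e; apply: val_inj => /=; lia.
have /subsetPn[z /imsetP[c _ ->] zh] : ~~ ([set f c | c in 'I_copies] \subset [set z in h]).
  apply/negP => /subset_leq_card; rewrite card_imset // card_ord cardsE => le.
  by have := leq_ltn_trans (leq_trans le (card_size h)) hc; rewrite ltnn.
exists (f c); move: zh; rewrite inE => zh; split=> //; first by rewrite fK block_copy.
by rewrite fK mulSn; have := ltn_ord c; lia.
Qed.
Lemma all_claimed (h : seq (vertex G)) v : uniq h -> size h = hyper_order -> v \in h.
Proof.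
move=> uh sh; apply/negPn/negP => vh.
have /card_uniqP c : uniq (v :: h) by rewrite /= vh.
by have := max_card (mem (v :: h)); rewrite c card_ord /= sh ltnn.
Qed.

Lemma is_point (v : vertex G) : 1 < v < 2 + P -> exists2 y, y < P & v = point y.
Proof.
case: v => i iN /= vP; have yP : i - 2 < P by lia.
by exists (i - 2) => //; apply: val_inj; rewrite /= pointK //; lia.
Qed.

Lemma claims_nil pl : claims pl [::] = set0.
Proof. by apply/setP => u; rewrite !inE. Qed.

(** * From Breaker to Dominator *)

Section BreakerStrategy.
Variable I : seq nat -> seq nat -> Prop.
Hypotheses (invI : breaker_invariant I) (I0 : I [::] [::]).

(* [u] is the point that Breaker has yet to claim, if it is his turn. *)
Definition breaker_safe (u : option nat) (h : seq (vertex G)) : Prop :=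
  hub \in claims Dominator h /\ exists D S, [/\ I D S,
    forall y, y < P -> (y \in S) = (point y \in claims Staller h),
    forall y, y \in D -> y < P -> point y \in claims Dominator h \/ u = Some y &
    forall y, y \in D -> y \notin S].

(** The hub takes care of all vertices but the copies of hyperedges. At the end everything is
    claimed, so a point of the hyperedge that Staller lacks is Dominator's. *)
Lemma breaker_safe_dominating u h : uniq h -> size h = hyper_order -> breaker_safe u h ->
  dominating (claims Dominator h).
Proof.
move=> uh sh [hubD [D [S [IDS SE _ _]]]]; apply/forallP => z.
have [->|zh] := eqVneq z hub; first by rewrite hubD.
apply/orP; right; apply/exists_inP; have [zl|zl] := ltnP z (2 + P + copies).
  by exists hub => //; apply: adj_hub.
have bl : (z - (2 + P)) %/ copies - 1 < E.
  exact: block_lt zl (ltn_ord z).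
have [y [yP ye yS]] := invI.1 D S IDS _ bl.
exists (point y); last by rewrite /= adj_point_copy.
by apply: claims_either; [apply: all_claimed|rewrite -SE].
Qed.

(** [D] may lack points that Dominator owns: her surplus claims, made when nothing is pending, only
    restrict Staller. *)
Lemma breaker_safe_gval k h u : uniq h -> size h + k = hyper_order ->
  odd (size h) || (u == None) -> breaker_safe u h -> gval Staller k h.
Proof.
elim: k h u => [|k IH] h u uh sh turn safe.
  by rewrite addn0 in sh; apply: breaker_safe_dominating safe.
have [|v0 v0h] := @fresh_vertex G h; first by rewrite /= -sh addnS ltnS leq_addr.
have next v u' : v \notin h -> odd (size h).+1 || (u' == None) -> breaker_safe u' (rcons h v) ->
    gval Staller k (rcons h v).
  by move=> vh t; apply: IH; rewrite ?rcons_uniq ?vh ?size_rcons ?addSnnS.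
have [hubD [D [S [IDS SE DE DS]]]] := safe.
rewrite /= /dom_turn /mover; case: (boolP (odd (size h))) turn => /= ho turn.
  (* Claim the pending point if it is free; otherwise any free vertex [v0] will do. *)
  have [v [vh vu]] : exists v, v \notin h /\
      forall y, u = Some y -> y < P -> point y \in h \/ v = point y.
    case: u {turn safe DE} => [y|]; last by exists v0; split.
    have [yh|yh] := boolP (point y \in h); first by exists v0; split=> // y' [<-]; left.
    by exists (point y); split=> // y' [<-]; right.
  apply/existsP; exists v; rewrite vh; apply: (next v None) => //; first by rewrite orbT.
  have SS : claims Staller (rcons h v) = claims Staller h.
    by rewrite claims_rcons // /mover ho.
  have DD : claims Dominator (rcons h v) = v |: claims Dominator h.
    by rewrite claims_rcons // /mover ho.
  split; first by rewrite DD in_setU1 hubD orbT.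
  exists D, S; split=> // y; first by rewrite SS; apply: SE.
  move=> yD yP; left; rewrite DD in_setU1; case: (DE y yD yP) => [-> | uy]; first by rewrite orbT.
  case: (vu y uy yP) => [yh|->]; last by rewrite eqxx.
  by rewrite claims_either ?orbT // -SE // DS.
move/eqP: turn => u0; rewrite {}u0 in DE safe.
apply/forallP => v; apply/implyP => vh.
have SS : claims Staller (rcons h v) = v |: claims Staller h.
  by rewrite claims_rcons // /mover (negPf ho).
have DD : claims Dominator (rcons h v) = claims Dominator h.
  by rewrite claims_rcons // /mover (negPf ho).
have [vP|vP] := boolP (1 < v < 2 + P); last first.
  (* Staller has moved outside the points: the hypergraph position stays, nothing is pending. *)
  apply: (next v None) => //; first by rewrite orbT.
  split; first by rewrite DD.
  exists D, S; split=> // y; last by rewrite DD; apply: DE.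
  move=> yP; rewrite SS in_setU1 SE //; case: eqP => [e|//].
  by case/negP: vP; rewrite -e pointK //; lia.
have [y yP vy] := is_point vP.
have yD : y \notin D.
  by apply: contra vh => /DE/(_ yP)[|//] /claims_in; rewrite vy.
have yS : y \notin S by rewrite SE //; apply: contra vh => /claims_in; rewrite vy.
have [u' u'S IDS'] := invI.2 D S IDS y yP yD yS.
apply: (next v (Some u')) => //; first by rewrite /= (negPf ho).
split; first by rewrite DD.
exists (u' :: D), (y :: S); split=> // y'.
- move=> y'P; rewrite SS in_setU1 in_cons SE //; congr (_ || _).
  by apply/eqP/eqP => [->|]; [rewrite vy|rewrite vy => /point_inj; apply].
- rewrite inE => /predU1P[->|y'D y'P]; first by right.
  by rewrite DD; case: (DE y' y'D y'P) => [|//]; left.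
- rewrite inE => /predU1P[-> //|y'D]; rewrite inE negb_or DS // andbT.
  by apply: contraNneq yD => <-.
Qed.

Theorem breaker_dominator : has_winning_strategy G Staller Dominator.
Proof.
apply/gval_winning.
suff H k : k.+2 = hyper_order -> @gval G Staller k.+2 [::].
  have e : (hyper_order - 2).+2 = hyper_order by have := order_gt1; lia.
  by have := H _ e; rewrite e.
move=> Nk; rewrite [gval _ _ _]/= /dom_turn /=; apply/forallP => v.
have [va|va] := eqVneq v apex; last first.
  apply/existsP; exists apex; rewrite inE eq_sym va /=; apply: gval_apex; last exact: Nk.
  by rewrite (@claims_rcons _ [:: v]) ?inE ?eqxx // eq_sym.
apply/existsP; exists hub; rewrite va inE /=.
have hubD : claims Dominator [:: apex; hub] = [set hub].
  by rewrite (@claims_rcons _ [:: apex]) // (@claims_rcons _ [::]) //= claims_nil setU0.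
have apexS : claims Staller [:: apex; hub] = [set apex].
  by rewrite (@claims_rcons _ [:: apex]) // (@claims_rcons _ [::]) //= claims_nil setU0.
apply: (@breaker_safe_gval _ _ None) => //; split; first by rewrite hubD inE.
exists [::], [::]; split=> // y yP; rewrite apexS inE in_nil; apply/esym/negbTE.
by apply/eqP => /(congr1 (@nat_of_ord _)); rewrite pointK.
Qed.
End BreakerStrategy.

(** A copy of the completed hyperedge is still free; with it Staller owns a closed neighborhood,
    made of the copy, the apex and the points of the hyperedge. The equation for [size h] says that
    each player has claimed [size S + 1] vertices, which leaves such a copy. *)
Lemma maker_wins_gval D S : maker_wins D S -> forall h k, uniq h -> size h + k = hyper_order ->
  apex \in claims Staller h -> hub \in h -> uniq S -> all (fun y => y < P) S ->
  (forall y, y < P -> (y \in S) = (point y \in claims Staller h)) ->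
  (forall y, y < P -> point y \in claims Dominator h -> y \in D) ->
  size h = (size S).+1.*2 -> ~~ gval Staller k h.
Proof.
have Nge := order_ge.
elim=> {D S} [D S e eE done|D S v vP vD vS _ IH] h k uh sh apexS hubh uS allS SE DE hS.
  have SP : size S <= P.
    rewrite -(size_iota 0 P); apply: uniq_leq_size => // y /(allP allS).
    by rewrite mem_iota.
  have [|z [zh zb zl]] := @free_copy h e.+1 _ eE.
    by rewrite hS /copies; lia.
  have zl' : 2 + P + copies <= z by move: zl; rewrite mulSn; lia.
  have ho : odd (size h) = false by rewrite hS odd_double.
  case: k sh => [|k] sh; first by rewrite all_claimed // -sh addn0 in zh.
  rewrite /= /dom_turn /mover ho /=; apply/negP => /forallP/(_ z); rewrite zh /=; apply/negP.
  have SS : claims Staller (rcons h z) = z |: claims Staller h.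
    by rewrite claims_rcons // /mover ho.
  apply: (@gval_lost _ _ z); last by rewrite size_rcons addSnnS.
  split=> [|u /(adj_to_copy zl')[->|[y [yP -> ye]]]]; rewrite SS in_setU1 ?eqxx ?apexS ?orbT //.
  by rewrite -SE // done ?orbT //; move: ye; rewrite zb subn1.
have SP : size S < P.
  rewrite -(size_iota 0 P); apply: (@leq_trans (size (v :: S))) => //.
  apply: uniq_leq_size => [|y]; first by rewrite /= vS.
  by rewrite inE mem_iota => /predU1P[-> //|/(allP allS)].
have ho : odd (size h) = false by rewrite hS odd_double.
have [k' kE] : exists k', k = k'.+2.
  by exists (k - 2); move: sh; rewrite hS /copies in Nge *; lia.
rewrite kE in sh *.
have vh : point v \notin h.
  apply/negP => vh; case/negP: vS; rewrite SE //; apply/negPn/negP => nS.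
  by case/negP: vD; apply: DE => //; apply: claims_either.
rewrite /= /dom_turn /mover ho /=.
apply/negP => /forallP/(_ (point v)); rewrite vh /= size_rcons /= ho /= => /existsP[u /andP[uh']].
apply/negP.
set h1 := rcons h (point v) in uh' *.
have S1 pl : claims pl h1 = if pl == Staller then point v |: claims pl h else claims pl h.
  by rewrite claims_rcons // /mover ho; case: pl.
have S2 pl : claims pl (rcons h1 u) = if pl == Dominator then u |: claims pl h1 else claims pl h1.
  by rewrite claims_rcons // /mover size_rcons /= ho; case: pl.
have un : u \notin h by apply: contra uh'; rewrite mem_rcons inE => ->; rewrite orbT.
have u1 : 1 < u.
  have u_a : u != apex by apply: contraNneq un => ->; apply: claims_in apexS.
  have u_h : u != hub by apply: contraNneq un => ->.
  by move: u_a u_h; rewrite -!val_eqE /=; case: (nat_of_ord u) => [|[|]].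
have uP y : y < P -> y = u - 2 -> u = point y.
  by move=> yP yu; apply: val_inj; rewrite /= pointK //; lia.
have uvS : (u - 2)%N \notin v :: S.
  rewrite inE negb_or; apply/andP; split.
    by apply: contraNneq uh' => e; rewrite (uP v) // mem_rcons inE eqxx.
  apply: contra un => uS'; have up := allP allS _ uS'.
  by move: uS'; rewrite SE // => /claims_in; rewrite -(uP (u - 2)).
(* If [u] is a copy, then [u - 2] is not a point and Breaker passes. *)
apply: (IH (u - 2) uvS) => //.
- by rewrite rcons_uniq uh' rcons_uniq vh.
- by rewrite !size_rcons; move: sh; rewrite !addnS !addSn => ->.
- by rewrite S2 S1 /= in_setU1 apexS orbT.
- by rewrite mem_rcons in_cons /h1 mem_rcons in_cons hubh !orbT.
- by rewrite /= vS.
- by rewrite /= vP.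
- move=> y yP; rewrite S2 S1 /= in_setU1 in_cons SE //; congr (_ || _).
  by apply/eqP/eqP => [->|/point_inj]; [|apply].
- move=> y yP; rewrite S2 S1 /= in_setU1 => /predU1P[e|/DE yD]; rewrite inE.
    by rewrite -e pointK // addKn eqxx.
  by rewrite yD ?orbT.
- by rewrite !size_rcons hS.
Qed.

Theorem maker_staller : maker_wins [::] [::] -> ~ has_winning_strategy G Staller Dominator.
Proof.
move=> W /gval_winning; apply/negP.
suff H k : k.+4.+1 = hyper_order -> ~~ @gval G Staller k.+4.+1 [::].
  have e : (hyper_order - 5).+4.+1 = hyper_order by have := order_ge; rewrite /copies; lia.
  by have := H _ e; rewrite e.
move=> Nk; apply/negP; rewrite [gval _ _ _]/= /dom_turn /= => /forallP/(_ apex) /= /existsP[u /andP[]].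
rewrite inE => ua.
have apexS : claims Staller [:: apex; u] = [set apex].
  rewrite (@claims_rcons _ [:: apex]) ?inE // (@claims_rcons _ [::]) //= claims_nil.
  by rewrite setU0.
have uD : claims Dominator [:: apex; u] = [set u].
  rewrite (@claims_rcons _ [:: apex]) ?inE // (@claims_rcons _ [::]) //= claims_nil.
  by rewrite setU0.
have [uh|uh] := eqVneq u hub.
  change (gval Staller k.+3 [:: apex; u] -> False); apply/negP.
  apply: (maker_wins_gval W) => //.
  - by rewrite /= inE eq_sym ua.
  - by rewrite apexS inE.
  - by rewrite uh !inE eqxx orbT.
  - move=> y yP; rewrite apexS inE in_nil; apply/esym/negbTE/eqP.
    by move=> /(congr1 (@nat_of_ord _)); rewrite pointK.
  - move=> y yP; rewrite uD inE uh => /eqP/(congr1 (@nat_of_ord _)); rewrite pointK //=; lia.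
(* Dominator has not answered at the hub. Staller takes it and then a free copy of block 0, whose
   only neighbors are the apex and the hub. *)
have hh : hub \notin [:: apex; u] by rewrite !inE (eq_sym hub u) (negPf uh).
move=> /forallP/(_ hub); rewrite hh /= => /existsP[w /andP[wh]].
have [|z [zh zb zl]] := @free_copy [:: apex; u; hub; w] 0 _ (leq0n _).
  by rewrite /copies /=; lia.
move=> /forallP/(_ z); rewrite zh /=; apply/negP.
change (~~ gval Staller k (rcons [:: apex; u; hub; w] z)).
have S4 : claims Staller (rcons [:: apex; u; hub; w] z) = [set z; hub; apex].
  rewrite claims_rcons //= (@claims_rcons _ [:: apex; u; hub]) //=.
  by rewrite (@claims_rcons _ [:: apex; u]) //= apexS setUA.
apply: (@gval_lost _ _ z); last exact: Nk.
rewrite [rcons _ _]/= in S4 *.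
split=> [|v /adj_to_hub_copy[|->|->]]; rewrite ?S4 ?in_setU1 ?inE ?eqxx ?orbT //.
by move: zl; rewrite mul1n mul0n; lia.
Qed.
End Hypergraph.

(** * From quantified formulas to hypergraphs *)

Section QuantifiedFormula.
(* [n] variables, the [k]-th one universally quantified iff [univ k], and [m] clauses;
   [lit c k b]: clause [c] contains the literal "variable [k] has value [b]". *)
Variables (n m : nat) (univ : nat -> bool) (lit : nat -> nat -> bool -> bool).

Definition satisfied (a : nat -> bool) : bool :=
  all_lt m (fun c => some_lt n (fun k => lit c k (a k))).

Definition set_var (a : nat -> bool) (k : nat) (b : bool) : nat -> bool :=
  fun i => if i == k then b else a i.

Fixpoint qvalue (r k : nat) (a : nat -> bool) : bool :=
  if r is r'.+1 then
    if univ k then qvalue r' k.+1 (set_var a k false) && qvalue r' k.+1 (set_var a k true)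
    else qvalue r' k.+1 (set_var a k false) || qvalue r' k.+1 (set_var a k true)
  else satisfied a.

(* Stage [k] has a key [pt k 0], the literals [X k false] and [X k true], and a spare [pt k 3].
   Its hyperedges are two of the latter three together with the keys up to [k]; in a universal
   stage, the two literals with the keys before [k] also form a hyperedge, so that Maker
   can choose the value before he takes the key. *)
Definition pt (k j : nat) : nat := 4 * k + j.
Definition X (k : nat) (b : bool) : nat := pt k (if b then 2 else 1).

(** [t] names one of the four hyperedges of a stage: 0 and 1 have the pair of literals, 2 and 3 the
    spare with [X k false] or [X k true]. *)
Definition in_pair (t j : nat) : bool :=
  (0 < j) && (if t == 2 then j != 2 else if t == 3 then j != 1 else j != 3).

(** Breaker's literals are the true ones. A clause hyperedge consists of all keys and the literals
    of the clause, so Maker owns it after all stages when these literals are false. *)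
Definition incident (e y : nat) : bool :=
  if e < 4 * n then
    ((y %% 4 == 0) && ((y %/ 4 < e %/ 4) ||
       ((y %/ 4 == e %/ 4) && ((e %% 4 != 0) || ~~ univ (e %/ 4))))) ||
    ((y %/ 4 == e %/ 4) && in_pair (e %% 4) (y %% 4))
  else
    (y %% 4 == 0) || (((y %% 4 == 1) && lit (e - 4 * n) (y %/ 4) false) ||
                      ((y %% 4 == 2) && lit (e - 4 * n) (y %/ 4) true)).

Local Notation P := (4 * n).
Local Notation E := (4 * n + m).

Lemma ptP y : exists i j, j < 4 /\ y = pt i j.
Proof. by exists (y %/ 4), (y %% 4); rewrite /pt ltn_mod mulnC -divn_eq. Qed.

Lemma pt_div i j : j < 4 -> pt i j %/ 4 = i.
Proof. by move=> j4; rewrite /pt mulnC divnMDl // divn_small ?addn0. Qed.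

Lemma pt_mod i j : j < 4 -> pt i j %% 4 = j.
Proof. by move=> j4; rewrite /pt mulnC modnMDl modn_small. Qed.

Lemma incident_stage k t i j : k < n -> t < 4 -> j < 4 ->
  incident (pt k t) (pt i j) =
  ((j == 0) && ((i < k) || ((i == k) && ((t != 0) || ~~ univ k)))) || ((i == k) && in_pair t j).
Proof.
move=> kn t4 j4; rewrite /incident !pt_div // !pt_mod // ifT //.
by rewrite /pt; lia.
Qed.

Lemma incident_clause c i j : j < 4 ->
  incident (P + c) (pt i j) =
  (j == 0) || (((j == 1) && lit c i false) || ((j == 2) && lit c i true)).
Proof. by move=> j4; rewrite /incident ltnNge leq_addr /= addKn pt_div // pt_mod. Qed.

(** * Maker wins if the formula is false *)

Section Maker.

Lemma maker_finish D S e y : e < E -> y < P -> y \notin D -> y \notin S ->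
  (forall i j, j < 4 -> incident e (pt i j) -> pt i j = y \/ pt i j \in S) ->
  maker_wins P E incident D S.
Proof.
move=> eE yP yD yS H; apply: (MakerMove yP yD yS) => u _; apply: (@MakerDone _ _ _ _ _ e) => // z zP.
have [i [j [j4 ->]]] := ptP z; move=> /(H i j j4)[->|zS]; first by rewrite inE eqxx.
by rewrite inE zS orbT.
Qed.

(** Every move of Maker threatens a hyperedge, except the key of an existential stage, after which
    Breaker picks a literal; any reply there but a literal or the spare runs into a double threat.
    So Breaker gets no chance to play in a later stage. *)
Lemma maker_qvalue r k a D S : k + r = n ->
  (forall i, i < k -> pt i 0 \in S /\ X i (~~ a i) \in S) ->
  (forall y, y \in D -> y < P -> y < 4 * k) -> (forall y, y \in S -> y < 4 * k) ->
  ~~ qvalue r k a -> maker_wins P E incident D S.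
Proof.
elim: r k a D S => [|r IH] k a D S kr own DP SP.
  rewrite addn0 in kr; rewrite /= /satisfied => /allPn[c]; rewrite mem_iota => cm /hasPn no.
  apply: (@MakerDone _ _ _ _ _ (P + c)); first by lia.
  move=> y yP; have [i [j [j4 ey]]] := ptP y; rewrite {}ey in yP *.
  have lin : i < k by move: yP; rewrite /pt; lia.
  have [mi Xi] := own i lin; have nl : ~~ lit c i (a i) by apply: no; rewrite mem_iota; lia.
  rewrite incident_clause // => /orP[/eqP-> //|/orP[] /andP[/eqP-> l]];
    by move: Xi nl; rewrite /X; case: (a i) => //; rewrite l.
have kn : k < n by lia.
have kP j : j < 4 -> pt k j < P by rewrite /pt; lia.
have kE t : t < 4 -> pt k t < E by rewrite /pt; lia.
have fS j : pt k j \notin S by apply/negP => /SP; rewrite /pt; lia.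
have fD j : j < 4 -> pt k j \notin D by move=> j4; apply/negP => /DP/(_ (kP j j4)); rewrite /pt; lia.
have X4 b : (if b then 2 else 1) < 4 by case: b.
have next b D' S' : {subset S <= S'} -> pt k 0 \in S' -> X k (~~ b) \in S' ->
   (forall y, y \in D' -> [\/ y \in D, y = X k b | y = pt k 3]) ->
   (forall y, y \in S' -> [\/ y \in S, y = pt k 0 | y = X k (~~ b)]) ->
   ~~ qvalue r k.+1 (set_var a k b) -> maker_wins P E incident D' S'.
  move=> SS m1 m2 DD SS' q; apply: IH q; first by lia.
  - move=> i ik; rewrite /set_var; case: eqP => [-> //|ne].
    by have [|mi Xi] := own i; [lia|split; apply: SS].
  - move=> y /DD[/DP yD|->|->] yP; [have := yD yP; lia| |];
      by rewrite /X /pt; case: (b) => /=; lia.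
  - move=> y /SS'[/SP|->|->]; [lia| |]; by rewrite /X /pt; case: (b) => /=; lia.
(* Maker owns the key and one literal; unless Breaker takes the spare, Maker wins at once. *)
have spare b D' S' u : {subset S <= S'} -> pt k 0 \in S' -> X k (~~ b) \in S' ->
   (forall y, y \in D' -> y \in D \/ y = X k b) ->
   (forall y, y \in S' -> [\/ y \in S, y = pt k 0 | y = X k (~~ b)]) ->
   ~~ qvalue r k.+1 (set_var a k b) -> maker_wins P E incident (u :: D') S'.
  move=> SS m1 m2 DD SS' q; have [->|ud] := eqVneq u (pt k 3).
    apply: next q => // y; rewrite inE => /predU1P[->|/DD[yD|->]]; [exact: Or33|exact: Or31|exact: Or32].
  apply: (@maker_finish _ _ (pt k (if b then 2 else 3)) (pt k 3)).
  - by apply: kE; case: (b).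
  - exact: kP.
  - rewrite inE negb_or eq_sym ud; apply/negP => /DD[|]; first by apply/negP/fD.
    by rewrite /X /pt; case: (b) => /=; lia.
  - apply/negP => /SS'[| |]; [by apply/negP/fS|by rewrite /pt; lia|].
    by rewrite /X /pt; case: (b) => /=; lia.
  move=> i j j4; rewrite incident_stage //; last by case: (b).
  case/orP => [/andP[/eqP-> /orP[ik|/andP[/eqP-> _]]]|/andP[/eqP-> pr]].
  - by right; apply: SS; have [] := own i ik.
  - by right.
  - case: j j4 pr => [|[|[|[|j]]]] // _; case: b {q DD SS' next} m2 => //= m2 _;
      by [right|left].
rewrite /=; case: ifP => uk.
  (* Universal stage: by taking the literal of [~~ b] Maker forces [b], since the two literals need
     only the earlier keys to form a hyperedge. The key comes second. *)
  move=> nq; have [b qb] : exists b, ~~ qvalue r k.+1 (set_var a k b).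
    by move: nq; rewrite negb_and => /orP[]; [exists false|exists true].
  have XN : X k b <> X k (~~ b) by rewrite /X /pt; case: (b) => /=; lia.
  apply: (@MakerMove _ _ _ _ _ (X k (~~ b))); rewrite /X ?kP ?fD ?fS ?X4 //.
  rewrite -/(X k (~~ b)) => u uS; have [->|ub] := eqVneq u (X k b); last first.
    apply: (@maker_finish _ _ (pt k 0) (X k b)); rewrite /X ?kP ?kE ?X4 //.
    - by rewrite inE negb_or fD // andbT eq_sym.
    - rewrite inE negb_or fS // andbT; exact/eqP.
    move=> i j j4; rewrite incident_stage // uk /= andbF orbF.
    case/orP => [/andP[/eqP-> ik]|/andP[/eqP-> pr]].
      by right; rewrite inE; have [-> _] := own i ik; rewrite orbT.
    case: j j4 pr => [|[|[|[|j]]]] // _ _; rewrite /X; case: (b) => /=;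
      by [left|right; rewrite inE eqxx].
  apply: (@MakerMove _ _ _ _ _ (pt k 0)); rewrite ?kP //.
  - by rewrite inE negb_or fD // andbT /X /pt; case: (b) => /=; lia.
  - by rewrite inE negb_or fS // andbT /X /pt; case: (b) => /=; lia.
  move=> u' _; apply: (spare b) => //.
  - by move=> y yS; rewrite !inE yS !orbT.
  - by rewrite !inE eqxx.
  - by rewrite !inE eqxx !orbT.
  - by move=> y; rewrite inE => /predU1P[->|]; [right|left].
  - move=> y; rewrite !inE => /predU1P[->|/predU1P[->|]]; [exact: Or32|exact: Or33|exact: Or31].
rewrite negb_or => /andP[q0 q1].
have q b : ~~ qvalue r k.+1 (set_var a k b) by case: b.
(* Existential stage: Maker takes the key and leaves the value to Breaker. *)
apply: (@MakerMove _ _ _ _ _ (pt k 0)); rewrite ?kP ?fD ?fS //.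
move=> u uS.
have [[b ub]|nX] : (exists b, u = X k b) \/ (u != X k true) && (u != X k false).
- have [->|u1] := eqVneq u (X k true); first by left; exists true.
  by have [->|u0] := eqVneq u (X k false); [left; exists false|right].
- rewrite {}ub in uS *.
  have XN : X k (~~ b) != X k b by rewrite /X /pt; case: (b) => /=; lia.
  apply: (@MakerMove _ _ _ _ _ (X k (~~ b))).
  + by rewrite /X kP.
  + by rewrite inE negb_or XN /= /X fD.
  + by rewrite inE negb_or /X fS andbT /pt; case: (b) => /=; lia.
  move=> u' _; apply: (spare b) => //.
  + by move=> y yS; rewrite !inE yS !orbT.
  + by rewrite !inE eqxx orbT.
  + by rewrite !inE eqxx.
  + by move=> y; rewrite inE => /predU1P[->|]; [right|left].
  + move=> y; rewrite !inE => /predU1P[->|/predU1P[->|]]; [exact: Or33|exact: Or32|exact: Or31].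
(* Breaker took no literal. Maker takes one, threatening with the other literal and with the spare;
   unless the spare is Breaker's, this wins, and otherwise Breaker's forced reply sets the value
   [false]. *)
case/andP: nX => u1 u0.
apply: (@MakerMove _ _ _ _ _ (X k true)).
- by rewrite /X kP.
- by rewrite inE negb_or eq_sym u1 /X fD.
- by rewrite inE negb_or /X fS andbT /pt; lia.
move=> u' u'S; have [eu'|u'0] := eqVneq u' (X k false); last first.
  apply: (@maker_finish _ _ (pt k 1) (X k false)).
  - exact: kE.
  - by rewrite /X kP.
  - by rewrite !inE !negb_or eq_sym u'0 eq_sym u0 /X fD.
  - by rewrite !inE !negb_or /X fS andbT /pt; lia.
  move=> i j j4; rewrite incident_stage //=.
  case/orP => [/andP[/eqP-> /orP[ik|/andP[/eqP-> _]]]|/andP[/eqP-> pr]].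
  - by right; rewrite !inE; have [-> _] := own i ik; rewrite !orbT.
  - by right; rewrite !inE eqxx orbT.
  - by case: j j4 pr => [|[|[|[|j]]]] // _ _; [left|right; rewrite inE eqxx].
have [eu|ud] := eqVneq u (pt k 3); last first.
  apply: (@maker_finish _ _ (pt k 3) (pt k 3)).
  - exact: kE.
  - exact: kP.
  - by rewrite !inE !negb_or eu' (eq_sym _ u) ud fD //= andbT /X /pt; lia.
  - by rewrite !inE !negb_or fS /X /pt; lia.
  move=> i j j4; rewrite incident_stage //=.
  case/orP => [/andP[/eqP-> /orP[ik|/andP[/eqP-> _]]]|/andP[/eqP-> pr]].
  - by right; rewrite !inE; have [-> _] := own i ik; rewrite !orbT.
  - by right; rewrite !inE eqxx orbT.
  - by case: j j4 pr => [|[|[|[|j]]]] // _ _; [right; rewrite inE eqxx|left].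
apply: (next false) => //.
- by move=> y yS; rewrite !inE yS !orbT.
- by rewrite !inE eqxx orbT.
- by rewrite !inE eqxx.
- move=> y; rewrite !inE eu eu' => /predU1P[->|/predU1P[->|]]; [exact: Or32|exact: Or33|exact: Or31].
- move=> y; rewrite !inE => /predU1P[->|/predU1P[->|]]; [exact: Or33|exact: Or32|exact: Or31].
Qed.
End Maker.

(** * Breaker wins if the formula is true *)

Section Breaker.

(** Breaker's literal meets two of the three pairs of the stage. The third pair is met as well, or
    Maker has none of it and Breaker can answer a move in it by the other point. *)
Definition settled (a : nat -> bool) (D S : seq nat) (i : nat) : Prop :=
  X i (a i) \in D /\
  [\/ pt i 3 \in D, X i (~~ a i) \in D | pt i 3 \notin S /\ X i (~~ a i) \notin S].

(* Before stage [k]; after Maker has let Breaker choose the value of the universal variable [k]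
   by taking a literal; and after Breaker has taken the key of stage [k]. *)
Definition stage_state (a : nat -> bool) (D S : seq nat) (k : nat) : Prop :=
  [\/ (forall y, y \in S -> y < 4 * k) /\ qvalue (n - k) k a,
      [/\ k < n, X k (a k) \in D, pt k 0 \notin S /\ pt k 3 \notin S,
          forall y, y \in S -> y < 4 * k.+1 & qvalue (n - k.+1) k.+1 a]
    | [/\ k < n, pt k 0 \in D & univ k ->
          exists b, X k b \in D \/ X k false \notin S /\ X k true \notin S]].

Definition breaker_state (D S : seq nat) : Prop :=
  exists k a, [/\ k <= n, forall y, y \in D -> y \notin S,
    forall i, i < k -> settled a D S i & stage_state a D S k].

Lemma X_neq k b : X k b <> X k (~~ b).
Proof. by rewrite /X /pt; case: b => /=; lia. Qed.

Lemma settled_hit a D S i t : i < n -> t < 4 -> (forall y, y \in D -> y \notin S) ->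
  settled a D S i -> exists y, [/\ y < P, incident (pt i t) y & y \notin S].
Proof.
move=> lin t4 DS [XD alt].
have hit j : j < 4 -> in_pair t j -> pt i j \notin S ->
    exists y, [/\ y < P, incident (pt i t) y & y \notin S].
  move=> j4 tj jS; exists (pt i j); split=> //; first by rewrite /pt; lia.
  by rewrite incident_stage // eqxx tj orbT.
have XS := DS _ XD.
have alt' : pt i 3 \notin S \/ X i (~~ a i) \notin S.
  by case: alt => [/DS|/DS|[]]; [left|right|left].
move: XS alt'; rewrite /X; case: t t4 hit => [|[|[|[|t]]]] // _ hit; case: (a i) => /= XS.
- by move=> _; apply: (hit 2).
- by move=> _; apply: (hit 1).
- by move=> _; apply: (hit 2).
- by move=> _; apply: (hit 1).
- by case; [apply: (hit 3)|apply: (hit 1)].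
- by move=> _; apply: (hit 1).
- by move=> _; apply: (hit 2).
- by case; [apply: (hit 3)|apply: (hit 2)].
Qed.

(** Clauses and stages after [k] are blocked by the key of stage [k], which Maker does not own, and
    finished stages are settled. The truth of the clauses matters only when [k = n]. *)
Lemma breaker_hit D S e : breaker_state D S -> e < E ->
  exists y, [/\ y < P, incident e y & y \notin S].
Proof.
move=> [k [a [kn DS set st]]] eE.
have [eP|Pe] := ltnP e P; last first.
  have {}eE : e - P < m by lia.
  have -> : e = P + (e - P) by lia.
  move: (e - P) eE => c cm.
  have key k' : k' < n -> pt k' 0 \notin S -> exists y, [/\ y < P, incident (P + c) y & y \notin S].
    move=> k'n kS; exists (pt k' 0); split=> //; first by rewrite /pt; lia.
    by rewrite incident_clause.
  case: st => [[SP q]|[kn' _ [kS _] _ _]|[kn' kD _]].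
  - have [kn'|nk] := ltnP k n; first by apply: (key k) => //; apply/negP => /SP; rewrite /pt; lia.
    have ek : k = n by lia.
    move: q; rewrite ek subnn /= => /all_ltP/(_ c cm)/some_ltP[i lin l].
    have [|XD _] := set i; first by lia.
    exists (X i (a i)); split; [by rewrite /X /pt; case: (a i); lia| |exact: DS].
    by rewrite /X incident_clause; [move: l; case: (a i) => /= ->; rewrite ?orbT|case: (a i)].
  - exact: key kS.
  - exact: key (DS _ kD).
have [i [t [t4 ei]]] := ptP e; rewrite {}ei in eP *.
have lin : i < n by move: eP; rewrite /pt; lia.
have key k' : k' < i \/ k' = i /\ (t != 0) || ~~ univ i -> pt k' 0 \notin S ->
    exists y, [/\ y < P, incident (pt i t) y & y \notin S].
  move=> ki kS; exists (pt k' 0); split=> //.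
    by case: ki => [|[]]; rewrite /pt; lia.
  rewrite incident_stage //=; case: ki => [->//|[-> ->]].
  by rewrite eqxx orbT.
have lits b : t < 2 -> X i b \notin S -> exists y, [/\ y < P, incident (pt i t) y & y \notin S].
  move=> t2 XS; exists (X i b); split=> //; first by rewrite /X /pt; case: (b); lia.
  rewrite /X incident_stage //; last by case: (b).
  by rewrite eqxx; case: t t2 {t4 eP key} => [|[|]] //; case: (b); rewrite ?orbT.
case: (ltnP i k) => [ik|ki]; first exact: settled_hit t4 DS (set i ik).
case: st => [[SP _]|[kn' XD [kS dS] SP _]|[kn' kD pair]].
- have nS j : pt i j \notin S by apply/negP => /SP; rewrite /pt; lia.
  case: t t4 eP key lits => [|t] t4 eP key lits; first by apply: (lits true); rewrite // /X nS.
  by apply: (key i); [right|rewrite nS].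
- case: (ltngtP k i) ki => // [ki|eki] _; first by apply: (key k) => //; left.
  by rewrite -eki in t4 lits key *; case: (ltnP t 2) => t2;
    [apply: (lits (a k)) => //; apply: DS|apply: (key k) => //; right; split=> //; case: (t) t2].
- case: (ltngtP k i) ki => // [ki|eki] _; first by apply: (key k); [left|apply: DS].
  rewrite -eki in t4 lits key *.
  case t0: ((t != 0) || ~~ univ k); first by apply: (key k); [right|apply: DS].
  move: t0 => /negbT; rewrite negb_or !negbK => /andP[/eqP t0 uk].
  have [b [bD|[S0 _]]] := pair uk; [apply: (lits b)|apply: (lits false)] => //; rewrite ?t0 //.
  exact: DS.
Qed.

Lemma settled_sub a D S D' S' i : {subset D <= D'} ->
  (forall y, y \in S' -> y \in S \/ y %/ 4 != i) -> settled a D S i -> settled a D' S' i.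
Proof.
move=> DD SS [XD alt]; split; first exact: DD.
case: alt => [dD|xD|[dS xS]]; [by apply/Or31/DD|by apply/Or32/DD|apply: Or33].
split; apply/negP => /SS[]; rewrite ?(negPf dS) ?(negPf xS) //; rewrite /X pt_div ?eqxx //.
by case: (a i).
Qed.

Lemma settled_ext a a' D S i : a i = a' i -> settled a D S i -> settled a' D S i.
Proof. by rewrite /settled => ->. Qed.

Lemma settled_reply a D S i v : v \notin D -> (forall y, y \in D -> y \notin S) ->
  settled a D S i -> exists2 u, u \notin v :: S & settled a (u :: D) (v :: S) i.
Proof.
move=> vD DS [XD alt].
have pass : v <> pt i 3 -> v <> X i (~~ a i) ->
    exists2 u, u \notin v :: S & settled a (u :: D) (v :: S) i.
  (* Breaker passes by naming a literal that is already his. *)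
  move=> v3 vX; exists (X i (a i)); first by rewrite inE negb_or DS // andbT; apply: contraNneq vD => <-.
  split; first by rewrite inE eqxx.
  case: alt => [dD|xD|[dS xS]]; [by apply: Or31; rewrite inE dD orbT|by apply: Or32; rewrite inE xD orbT|].
  by apply: Or33; split; rewrite inE negb_or ?dS ?xS andbT eq_sym; apply/eqP.
have dx : pt i 3 != X i (~~ a i) by rewrite /X /pt; case: (a i) => /=; lia.
have D' u : X i (a i) \in u :: D by rewrite inE XD orbT.
have passD y : y \in D -> y \notin v :: S.
  by move=> yD; rewrite inE negb_or DS // andbT; apply: contraNneq vD => <-.
case: alt => [dD|xD|[dS xS]].
- by exists (pt i 3); [exact: passD|split=> //; apply: Or31; rewrite inE eqxx].
- by exists (X i (~~ a i)); [exact: passD|split=> //; apply: Or32; rewrite inE eqxx].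
have [e3|/eqP v3] := eqVneq v (pt i 3).
  exists (X i (~~ a i)); first by rewrite inE negb_or xS e3 eq_sym dx.
  by split=> //; apply: Or32; rewrite inE eqxx.
have [eX|/eqP vX] := eqVneq v (X i (~~ a i)); last exact: pass.
exists (pt i 3); first by rewrite inE negb_or dS eX dx.
by split=> //; apply: Or31; rewrite inE eqxx.
Qed.

Lemma breaker_reply D S v : breaker_state D S -> v < P -> v \notin D -> v \notin S ->
  exists2 u, u \notin v :: S & breaker_state (u :: D) (v :: S).
Proof.
move=> [k [a [kn DS set st]]] vP vD vS.
have [i [j [j4 ev]]] := ptP v.
have vi : v %/ 4 = i by rewrite ev pt_div.
have disj u : u \notin v :: S -> forall y, y \in u :: D -> y \notin v :: S.
  move=> uS y; rewrite inE => /predU1P[-> //|yD]; rewrite inE negb_or DS // andbT.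
  by apply: contraNneq vD => <-.
have DD u : {subset D <= u :: D} by move=> y yD; rewrite inE yD orbT.
have SS y i' : y \in v :: S -> y \in S \/ y %/ 4 != i' \/ i = i'.
  rewrite inE => /predU1P[->|]; last by left.
  by right; rewrite vi; case: eqP => [|_]; [right|left].
have set' u i' : i' < k -> i' <> i -> settled a (u :: D) (v :: S) i'.
  move=> i'k ne; apply: settled_sub (set i' i'k); first exact: DD.
  by move=> y /(@SS _ i')[|[|]]; [left|right|move=> e; case: ne].
(* A move in a finished stage is answered there. *)
have [ik|ki] := ltnP i k.
  have [u uS ui] := settled_reply vD DS (set i ik).
  exists u => //; exists k, a; split=> //; first exact: disj.
    by move=> i' i'k; case: (eqVneq i' i) => [->//|/eqP]; apply: set'.
  have vk : v < 4 * k by rewrite ev /pt; lia.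
  case: st => [[SP q]|[kn' XD [kS dS] SP q]|[kn' kD pair]].
  - by apply: Or31; split=> // y; rewrite inE => /predU1P[->|/SP].
  - apply: Or32; split=> //; first exact: DD.
      by rewrite !inE !negb_or kS dS !andbT; rewrite /pt; split; lia.
    by move=> y; rewrite inE => /predU1P[->|/SP]; lia.
  - apply: Or33; split=> //; first exact: DD.
    move=> uk; have [b [bD|[S0 S1]]] := pair uk; exists b; [by left; apply: DD|right].
    by rewrite !inE !negb_or S0 S1 !andbT; rewrite /X /pt; split; lia.
have kn' : k < n by move: vP; rewrite ev /pt; lia.
have setu u : forall i', i' < k -> settled a (u :: D) (v :: S) i'.
  by move=> i' i'k; apply: set' => //; lia.
(* Taking the key of stage [k] kills everything but one pair of literals. *)
have key : v <> pt k 0 -> pt k 0 \notin S ->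
    (univ k -> exists b, X k b \in D \/ X k false \notin v :: S /\ X k true \notin v :: S) ->
    exists2 u, u \notin v :: S & breaker_state (u :: D) (v :: S).
  move=> v0 kS pair; have kvS : pt k 0 \notin v :: S.
    by rewrite inE negb_or kS andbT eq_sym; apply/eqP.
  exists (pt k 0) => //; exists k, a; split=> //; [exact: disj|exact: setu|].
  apply: Or33; split=> //; first by rewrite inE eqxx.
  by move=> /pair[b [bD|bS]]; exists b; [left; apply: DD|right].
have seta b u i' : i' < k -> settled (set_var a k b) (u :: D) (v :: S) i'.
  by move=> i'k; apply: settled_ext (setu u i' i'k); rewrite /set_var ifF //; apply/eqP; lia.
case: st => [[SP q]|[_ XD [kS dS] SP q]|[_ kD pair]].
- have fresh j' : pt k j' \notin S by apply/negP => /SP; rewrite /pt; lia.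
  have [ev0|v0] := eqVneq v (pt k 0).
    (* Maker started with the key, so Breaker sets the value, even in a universal stage, where both
       values are good for him. *)
    have [b qb] : exists b, qvalue (n - k.+1) k.+1 (set_var a k b).
      move: q; rewrite (_ : n - k = (n - k.+1).+1) /=; last by lia.
      by case: ifP => _ => [/andP[]|/orP[]]; [exists false|exists false|exists true].
    have XS : X k b \notin v :: S.
      by rewrite inE negb_or /X fresh andbT ev0 /pt; case: (b); lia.
    exists (X k b) => //; exists k.+1, (set_var a k b); split=> //; first exact: disj.
      move=> i'; rewrite ltnS leq_eqVlt => /predU1P[->|]; last exact: seta.
      rewrite /settled /set_var eqxx; split; first by rewrite inE eqxx.
      by apply: Or33; rewrite !inE !negb_or /X !fresh !andbT ev0 /pt; case: (b) => /=; split; lia.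
    apply: Or31; split=> // y; rewrite inE => /predU1P[->|/SP]; last lia.
    by rewrite ev0 /pt; lia.
  (* In a universal stage Maker may fix the value by taking a literal; Breaker takes the opposite
     one and waits for the key. *)
  case: (boolP (univ k && ((v == X k false) || (v == X k true)))) => [/andP[uk vX]|nX].
    have [b evb] : exists b, v = X k (~~ b).
      by case/orP: vX => /eqP ->; [exists true|exists false].
    have XS : X k b \notin v :: S.
      by rewrite inE negb_or /X fresh andbT -/(X k b) evb; apply/eqP/X_neq.
    exists (X k b) => //; exists k, (set_var a k b); split=> //; first exact: disj.
      exact: seta.
    apply: Or32; split=> //; first by rewrite /set_var eqxx inE eqxx.
    - by rewrite !inE !negb_or !fresh !andbT evb /X /pt; case: (b) => /=; split; lia.
    - move=> y; rewrite inE => /predU1P[->|/SP]; last lia.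
      by rewrite evb /X /pt; case: (b) => /=; lia.
    move: q; rewrite (_ : n - k = (n - k.+1).+1) /= ?uk; last by lia.
    by case/andP; case: (b).
  (* Maker neglected the key. The literals of a universal stage belong to a hyperedge without this
     key, but both are free, so Breaker can pair them. *)
  apply: key; [exact/eqP|exact: fresh|move=> uk; exists true; right].
  move: nX; rewrite uk negb_or !(eq_sym v) => /andP[n0 n1].
  by rewrite !inE !negb_or n0 n1 /X !fresh.
(* If Maker returns to the key, the spare settles the stage. *)
- have [ev0|v0] := eqVneq v (pt k 0); last by apply: key => //; [exact/eqP|exists (a k); left].
  have dvS : pt k 3 \notin v :: S by rewrite inE negb_or dS andbT ev0 /pt; lia.
  exists (pt k 3) => //; exists k.+1, a; split=> //; first exact: disj.
    move=> i'; rewrite ltnS leq_eqVlt => /predU1P[->|]; last exact: setu.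
    by split; [apply: DD|apply: Or31; rewrite inE eqxx].
  by apply: Or31; split=> // y; rewrite inE => /predU1P[->|/SP //]; rewrite ev0 /pt; lia.
- have kvS : pt k 0 \notin v :: S.
    by rewrite inE negb_or DS // andbT; apply: contraNneq vD => <-.
  have finish u : u \notin v :: S -> (univ k -> exists b, X k b \in u :: D \/
       X k false \notin v :: S /\ X k true \notin v :: S) ->
     exists2 u, u \notin v :: S & breaker_state (u :: D) (v :: S).
    move=> uS pr; exists u => //; exists k, a; split=> //; [exact: disj|exact: setu|].
    by apply: Or33; split=> //; apply: DD.
  case: (boolP (univ k)) => [uk|nuk]; last by apply: (finish (pt k 0)) => // uk; rewrite uk in nuk.
  have [b [bD|[S0 S1]]] := pair uk.
    by apply: (finish (pt k 0)) => // _; exists b; left; apply: DD.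
  have XS c : X k c \notin S by case: c.
  have [e0|v0] := eqVneq v (X k false).
    apply: (finish (X k true)); first by rewrite inE negb_or XS e0 andbT /X /pt; lia.
    by move=> _; exists true; left; rewrite inE eqxx.
  have [e1|v1] := eqVneq v (X k true).
    apply: (finish (X k false)); first by rewrite inE negb_or XS e1 andbT /X /pt; lia.
    by move=> _; exists false; left; rewrite inE eqxx.
  apply: (finish (pt k 0)) => // _; exists true; right.
  by rewrite !inE !negb_or !XS !andbT !(eq_sym _ v).
Qed.

Lemma breaker_start a : qvalue n 0 a -> breaker_state [::] [::].
Proof. by move=> q; exists 0, a; split=> //; apply: Or31; rewrite subn0. Qed.
End Breaker.

Local Notation G := (hyper_graph P E incident).

Theorem qvalue_game a : qvalue n 0 a <-> has_winning_strategy G Staller Dominator.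
Proof.
split=> [q|w].
  apply: (@breaker_dominator _ _ _ breaker_state); last exact: breaker_start q.
  split=> [D S st e eE|D S st v vP vD vS]; first exact: breaker_hit st eE.
  exact: breaker_reply.
apply/negPn/negP => nq; apply: maker_staller w.
by apply: (@maker_qvalue n 0 a) => //; rewrite add0n.
Qed.
End QuantifiedFormula.

(** * From Turing machines to quantified formulas *)

Section Blocks.
Variables (n m : nat) (univ : nat -> bool) (lit : nat -> nat -> bool -> bool).
Local Notation qvalue := (qvalue n m univ lit).

Lemma qvalue_ext r k a a' : k + r = n -> (forall i, i < k -> a i = a' i) ->
  qvalue r k a = qvalue r k a'.
Proof.
elim: r k a a' => [|r IH] k a a' kr e /=.
  apply: eq_in_all => c _; apply: eq_in_has => i; rewrite mem_iota => lin; rewrite e //; lia.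
have E b : qvalue r k.+1 (set_var a k b) = qvalue r k.+1 (set_var a' k b).
  apply: IH => [|i ik]; first by lia.
  by rewrite /set_var; case: eqP => // ne; apply: e; lia.
by rewrite !E.
Qed.

Lemma qvalue_block l r k a : k + (l + r) = n -> (forall i, i < l -> ~~ univ (k + i)) ->
  qvalue (l + r) k a <-> exists2 a', (forall i, i < k -> a' i = a i) & qvalue r (k + l) a'.
Proof.
elim: l k a => [|l IH] k a klr nu.
  rewrite addn0; split=> [q|[a' e q]]; first by exists a.
  by rewrite -(qvalue_ext _ e).
have nuk : ~~ univ k by have := nu 0 isT; rewrite addn0.
have nu' i : i < l -> ~~ univ (k.+1 + i) by move=> il; rewrite addSnnS; apply: nu.
have kr' : k.+1 + (l + r) = n by lia.
have E b : qvalue (l + r) k.+1 (set_var a k b) <->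
   exists2 a', (forall i, i < k.+1 -> a' i = set_var a k b i) & qvalue r (k + l.+1) a'.
  by rewrite -addSnnS; apply: IH.
rewrite /= (negPf nuk); split=> [|[a' e q]].
  have H b : qvalue (l + r) k.+1 (set_var a k b) ->
     exists2 a' , (forall i, i < k -> a' i = a i) & qvalue r (k + l.+1) a'.
    move=> /E[a' e q]; exists a' => // i ik; rewrite e; last by lia.
    by rewrite /set_var ifF //; apply/eqP; lia.
  by case/orP; apply: H.
have : qvalue (l + r) k.+1 (set_var a k (a' k)).
  apply/E; exists a' => // i; rewrite ltnS leq_eqVlt /set_var => /predU1P[->|ik]; first by rewrite eqxx.
  by rewrite e // ifF //; apply/eqP; lia.
by case: (a' k) => ->; rewrite ?orbT.
Qed.
End Blocks.

Section Savitch.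
(* Words of length [s + 2] over an alphabet of [g] letters are given by [(s + 2) * g] bits, one
   for every position and letter. [good w]: the window with base-[g] digits [w], three letters
   of a word and the three letters below them in the next word, is allowed. *)
Variables (g s T : nat) (initbad finbad good : nat -> bool).
Hypothesis g_gt0 : 0 < g.

Definition word_bits : nat := (s + 2) * g.
(* Each of the levels 0 .. T has [word_bits] variables for the middle word, a universal variable that
   selects a half, and [word_bits] variables for each of the two ends of the selected half. *)
Definition level_size : nat := 3 * word_bits + 1.
Definition nvars : nat := T.+1 * level_size.
Definition mid_var (t j : nat) : nat := t * level_size + j.
Definition half_var (t : nat) : nat := t * level_size + word_bits.
Definition left_var (t j : nat) : nat := t * level_size + (word_bits + 1 + j).
Definition right_var (t j : nat) : nat := t * level_size + (2 * word_bits + 1 + j).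
Definition half_turn (k : nat) : bool := k %% level_size == word_bits.

Definition window_var (p w i : nat) : nat :=
  if i < 3 then left_var T ((p + i) * g + (w %/ g ^ i) %% g)
  else right_var T ((p + (i - 3)) * g + (w %/ g ^ i) %% g).

(** The number [f < 8] of a linking clause packs three bits: the selected half [f %% 2], the end
    [(f %/ 2) %% 2], and in [f %/ 4] the value to be carried from source to target. All eight
    together make the bits of the new ends equal to those of their sources. *)
Definition link_source (f t z : nat) : nat :=
  if (f %/ 2) %% 2 == 0 then if f %% 2 == 0 then left_var t z else mid_var t.+1 z
  else if f %% 2 == 0 then mid_var t.+1 z else right_var t z.
Definition link_target (f t z : nat) : nat :=
  if (f %/ 2) %% 2 == 0 then left_var t.+1 z else right_var t.+1 z.

(* A clause is a tautology when its parameters are out of range. *)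
Definition clause (f t z k : nat) (b : bool) : bool :=
  if f < 8 then
    ((T <= t) || (word_bits <= z)) ||
    (((k == half_var t.+1) && (b != (f %% 2 == 1))) ||
     (((k == link_target f t z) && (b == (f %/ 4 == 1))) ||
      ((k == link_source f t z) && (b != (f %/ 4 == 1)))))
  else if f == 8 then (word_bits <= z) || (~~ initbad z || ((k == left_var 0 z) && ~~ b))
  else if f == 9 then (word_bits <= z) || (~~ finbad z || ((k == right_var 0 z) && ~~ b))
  else if f == 10 then
    (s + 2 <= z) || (b && some_lt g (fun a => k == left_var T (z * g + a)))
  else if f == 11 then
    (s + 2 <= z) || (b && some_lt g (fun a => k == right_var T (z * g + a)))
  else (s <= z %% (s + 2)) || (good (z %/ (s + 2)) ||
         (~~ b && some_lt 6 (fun i => k == window_var (z %% (s + 2)) (z %/ (s + 2)) i))).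

(** The widest range of [z], that of pairs of a position and a window; clause numbers pack [f], [t]
    and [z] in mixed radix, with 13 families [f]. *)
Definition zmax : nat := (s + 2) * g ^ 6.
Definition nclauses : nat := T.+1 * zmax * 13.
Definition literal (c k : nat) (b : bool) : bool :=
  clause (c %% 13) (c %/ 13 %/ zmax) ((c %/ 13) %% zmax) k b.

(** At most one letter per position is never demanded: apart from this condition, [base], [starts]
    and [ends] only forbid letters, so any of several letters can be chosen. *)
Definition total (u : nat -> bool) : Prop :=
  forall q, q < s + 2 -> exists2 a, a < g & u (q * g + a).
Definition base (u v : nat -> bool) : Prop :=
  [/\ total u, total v & forall p w, p < s -> w < g ^ 6 -> ~~ good w ->
     exists2 i, i < 6 & ~~ (if i < 3 then u ((p + i) * g + (w %/ g ^ i) %% g)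
                       else v ((p + (i - 3)) * g + (w %/ g ^ i) %% g))].
Definition left_bits (a : nat -> bool) (t : nat) : nat -> bool := fun j => a (left_var t j).
Definition right_bits (a : nat -> bool) (t : nat) : nat -> bool := fun j => a (right_var t j).
Definition linked (a : nat -> bool) (t : nat) : Prop := forall j, j < word_bits ->
  a (left_var t.+1 j) = (if a (half_var t.+1) then a (mid_var t.+1 j) else a (left_var t j)) /\
  a (right_var t.+1 j) = (if a (half_var t.+1) then a (right_var t j) else a (mid_var t.+1 j)).
Definition starts (u : nat -> bool) : Prop := forall j, j < word_bits -> initbad j -> ~~ u j.
Definition ends (v : nat -> bool) : Prop := forall j, j < word_bits -> finbad j -> ~~ v j.

Lemma zmax_ge : word_bits <= zmax /\ s + 2 <= zmax.
Proof.
have h : 0 < g ^ 5 by rewrite expn_gt0 g_gt0.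
rewrite /zmax /word_bits expnS; split; first by rewrite leq_mul2l leq_pmulr ?orbT.
by rewrite leq_pmulr // muln_gt0 g_gt0.
Qed.

Lemma left_lt t j : t <= T -> j < word_bits -> left_var t j < nvars.
Proof. by move=> tT jL; rewrite /left_var /nvars; have := leq_mul tT (leqnn level_size); rewrite mulSn /level_size; lia. Qed.
Lemma right_lt t j : t <= T -> j < word_bits -> right_var t j < nvars.
Proof. by move=> tT jL; rewrite /right_var /nvars; have := leq_mul tT (leqnn level_size); rewrite mulSn /level_size; lia. Qed.
Lemma mid_lt t j : t <= T -> j < word_bits -> mid_var t j < nvars.
Proof. by move=> tT jL; rewrite /mid_var /nvars; have := leq_mul tT (leqnn level_size); rewrite mulSn /level_size; lia. Qed.
Lemma half_lt t : t <= T -> half_var t < nvars.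
Proof. by move=> tT; rewrite /half_var /nvars; have := leq_mul tT (leqnn level_size); rewrite mulSn /level_size; lia. Qed.

Lemma cell_lt q a : q < s + 2 -> a < g -> q * g + a < word_bits.
Proof. by move=> qs ag; rewrite /word_bits; have := leq_mul qs (leqnn g); rewrite mulSn; lia. Qed.

Local Notation sat := (satisfied nvars nclauses literal).

Lemma satisfied_clause a : sat a <-> forall f t z, f < 13 -> t <= T -> z < zmax ->
  exists2 k, k < nvars & clause f t z k (a k).
Proof.
have z0 : 0 < zmax by have [] := zmax_ge; lia.
split=> [/all_ltP H f t z f13 tT zz|H].
  have cm : (t * zmax + z) * 13 + f < nclauses.
    have h : t * zmax + z < T.+1 * zmax by have := leq_mul tT (leqnn zmax); rewrite mulSn; lia.
    by rewrite /nclauses; lia.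
  have /some_ltP[k kn hk] := H _ cm; exists k => //; move: hk; rewrite /literal.
  by rewrite modnMDl modn_small // divnMDl // (divn_small f13) addn0 divnMDl // (divn_small zz) addn0
    modnMDl modn_small.
apply/all_ltP => c cm; apply/some_ltP; rewrite /literal; apply: H.
- by rewrite ltn_mod.
- by rewrite -ltnS ltn_divLR // ltn_divLR.
- by rewrite ltn_mod.
Qed.

Lemma satisfiedP a : sat a <->
  [/\ forall t, t < T -> linked a t, starts (left_bits a 0), ends (right_bits a 0)
    & base (left_bits a T) (right_bits a T)].
Proof.
have [Lz sz] := zmax_ge; have digit w i : w %/ g ^ i %% g < g by rewrite ltn_mod.
rewrite satisfied_clause; split=> [H|[Hl Hs He [Hu Hv Hw]] f t z f13 tT zz].
  split=> [t tT j jL|j jL bad|j jL bad|].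
  - have C f : f < 8 -> exists2 k, k < nvars & clause f t j k (a k).
      by move=> f8; apply: H; lia.
    have K f : f < 8 -> [\/ a (half_var t.+1) != (f %% 2 == 1),
        a (link_target f t j) == (f %/ 4 == 1) | a (link_source f t j) != (f %/ 4 == 1)].
      move=> f8; have [k _] := C f f8; rewrite /clause f8 leqNgt tT leqNgt jL /=.
      by case/orP=> [/andP[/eqP->]|/orP[]/andP[/eqP->]]; [exact: Or31|exact: Or32|exact: Or33].
    have := (K 0 isT, K 1 isT, K 2 isT, K 3 isT, K 4 isT, K 5 isT, K 6 isT, K 7 isT).
    rewrite /link_target /link_source /=.
    case: (a (half_var _)); case: (a (mid_var _ _)); case: (a (left_var t j));
    case: (a (right_var t j)); case: (a (left_var _ _)); case: (a (right_var _ _)) => //=;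
    by intuition (repeat match goal with h : or3 _ _ _ |- _ => case: h => // end).
  - have [||k _] := @H 8 0 j isT _ _; [by []|by lia|].
    by rewrite /clause /= leqNgt jL bad => /andP[/eqP->].
  - have [||k _] := @H 9 0 j isT _ _; [by []|by lia|].
    by rewrite /clause /= leqNgt jL bad => /andP[/eqP->].
  split=> [q qs|q qs|p w ps wg bad].
  - have [||k _] := @H 10 0 q isT _ _; [by []|by lia|].
    rewrite /clause /= leqNgt qs /= => /andP[ak /some_ltP[i ig /eqP e]].
    by exists i; rewrite // /left_bits -e.
  - have [||k _] := @H 11 0 q isT _ _; [by []|by lia|].
    rewrite /clause /= leqNgt qs /= => /andP[ak /some_ltP[i ig /eqP e]].
    by exists i; rewrite // /right_bits -e.
  have [||k _] := @H 12 0 (w * (s + 2) + p) isT _ _; [by []| |].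
    by have := leq_mul wg (leqnn (s + 2)); rewrite mulSn /zmax; lia.
  have ps2 : p < s + 2 by lia.
  rewrite /clause /= modnMDl modn_small // divnMDl ?(divn_small ps2) ?addn0; last by lia.
  rewrite leqNgt ps (negPf bad) /= => /andP[ak /some_ltP[i i6 /eqP e]].
  by exists i => //; move: ak; rewrite e /window_var; case: ifP.
have n0 : 0 < nvars by rewrite /nvars /level_size; lia.
have taut : (forall k, clause f t z k (a k)) -> exists2 k, k < nvars & clause f t z k (a k).
  by exists 0.
have [f8|f8] := ltnP f 8.
  have [tT'|tT'] := leqP T t; first by apply: taut => k; rewrite /clause f8 tT'.
  have [zL|zL] := leqP word_bits z; first by apply: taut => k; rewrite /clause f8 zL orbT.
  have sub k : k < nvars ->
      ((k == half_var t.+1) && (a k != (f %% 2 == 1))) ||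
     (((k == link_target f t z) && (a k == (f %/ 4 == 1))) ||
      ((k == link_source f t z) && (a k != (f %/ 4 == 1)))) ->
      exists2 k, k < nvars & clause f t z k (a k).
    by move=> kn h; exists k => //; rewrite /clause f8 h orbT.
  have tn : link_target f t z < nvars by rewrite /link_target; case: ifP => _; [apply: left_lt|apply: right_lt].
  have sn : link_source f t z < nvars.
    by rewrite /link_source; do 2 case: ifP => _; rewrite ?left_lt ?right_lt ?mid_lt //; lia.
  have [h|/negPn/eqP h] := boolP (a (half_var t.+1) != (f %% 2 == 1)).
    by apply: (sub (half_var t.+1)); rewrite ?half_lt ?eqxx ?h.
  have [e|ne] := eqVneq (a (link_target f t z)) (f %/ 4 == 1).
    by apply: (sub (link_target f t z)); rewrite // eqxx e eqxx orbT.
  apply: (sub (link_source f t z)) => //; rewrite eqxx (_ : a (link_source f t z) = a (link_target f t z)).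
    by rewrite ne !orbT.
  have [e1 e2] := Hl t tT' z zL.
  rewrite /link_target /link_source; case: ifP => _; rewrite ?e1 ?e2 h;
    by have := ltn_mod f 2; case: (f %% 2) => [|[|]].
have [fe|f8'] := eqVneq f 8.
  have [zL|zL] := leqP word_bits z; first by apply: taut => k; rewrite /clause fe zL.
  exists (left_var 0 z); first exact: left_lt.
  rewrite /clause fe /= eqxx /=; have := Hs z zL; rewrite /left_bits.
  by case: initbad => [->|_]; rewrite ?orbT.
have [fe|f9'] := eqVneq f 9.
  have [zL|zL] := leqP word_bits z; first by apply: taut => k; rewrite /clause fe zL.
  exists (right_var 0 z); first exact: right_lt.
  rewrite /clause fe /= eqxx /=; have := He z zL; rewrite /right_bits.
  by case: finbad => [->|_]; rewrite ?orbT.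
have [fe|f10'] := eqVneq f 10.
  have [zs|zs] := leqP (s + 2) z; first by apply: taut => k; rewrite /clause fe zs.
  have [i ig ai] := Hu z zs; exists (left_var T (z * g + i)); first by rewrite left_lt ?cell_lt.
  rewrite /clause fe /= (_ : some_lt _ _) ?andbT; first by rewrite [a _]ai orbT.
  by apply/some_ltP; exists i.
have [fe|f11'] := eqVneq f 11.
  have [zs|zs] := leqP (s + 2) z; first by apply: taut => k; rewrite /clause fe zs.
  have [i ig ai] := Hv z zs; exists (right_var T (z * g + i)); first by rewrite right_lt ?cell_lt.
  rewrite /clause fe /= (_ : some_lt _ _) ?andbT; first by rewrite [a _]ai orbT.
  by apply/some_ltP; exists i.
have fe : f = 12 by lia.
set p := z %% (s + 2); set w := z %/ (s + 2).
have [ps|ps] := leqP s p; first by apply: taut => k; rewrite /clause fe /= -/p ps.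
have [gw|bad] := boolP (good w); first by apply: taut => k; rewrite /clause fe /= -/w gw orbT.
have wg : w < g ^ 6 by rewrite ltn_divLR ?addn2 //; move: zz; rewrite /zmax addn2 mulnC.
have [i i6 bi] := Hw p w ps wg bad.
exists (window_var p w i).
  by rewrite /window_var; case: (ltnP i 3) => i3; [apply: left_lt|apply: right_lt] => //; apply: cell_lt => //; lia.
rewrite /clause fe /= -/p -/w (_ : some_lt _ _) ?andbT; last by apply/some_ltP; exists i.
rewrite (_ : ~~ a _) ?orbT //; move: bi; rewrite /window_var.
by case: ltnP.
Qed.
End Savitch.

(** * Correctness of the recursion *)

Section Levels.
Variables (g s T : nat) (initbad finbad good : nat -> bool).
Hypothesis g_gt0 : 0 < g.
Local Notation L := (word_bits g s).
Local Notation B := (level_size g s).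
Local Notation n := (nvars g s T).
Local Notation qv := (qvalue n (nclauses g s T) (half_turn g s) (literal g s T initbad finbad good)).
Local Notation base := (base g s good).

Fixpoint reach (r : nat) (u v : nat -> bool) : Prop :=
  if r is r'.+1 then exists w, reach r' u w /\ reach r' w v else base u v.

Lemma base_ext u v u' v' : (forall j, j < L -> u j = u' j) -> (forall j, j < L -> v j = v' j) ->
  base u v -> base u' v'.
Proof.
move=> eu ev [tu tv win]; split=> [q qs|q qs|p w ps wg bad].
- by have [a ag ua] := tu q qs; exists a; rewrite -?eu ?cell_lt.
- by have [a ag va] := tv q qs; exists a; rewrite -?ev ?cell_lt.
have [i i6 h] := win p w ps wg bad; exists i => //; move: h.
have d : w %/ g ^ i %% g < g by rewrite ltn_mod.
case: (ltnP i 3) => i3.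
  by rewrite -eu // cell_lt //; lia.
by rewrite -ev // cell_lt //; lia.
Qed.

Lemma reach_ext r u v u' v' : (forall j, j < L -> u j = u' j) -> (forall j, j < L -> v j = v' j) ->
  reach r u v -> reach r u' v'.
Proof.
elim: r u v u' v' => [|r IH] u v u' v' eu ev /=; first exact: base_ext.
by move=> [w [uw wv]]; exists w; split; [apply: IH uw|apply: IH wv].
Qed.

Definition fill (a : nat -> bool) (k : nat) (w : nat -> bool) (b : bool) (u v : nat -> bool) :=
  fun i => if i < k then a i else
    let o := i - k in
    if o < L then w o else if o == L then b else
    if o < 2 * L + 1 then u (o - (L + 1)) else v (o - (2 * L + 1)).

Lemma level_split t r a : t * B + (B + r) = n ->
  qv (B + r) (t * B) a <->
  exists w, forall b, exists u v, qv r (t.+1 * B) (fill a (t * B) w b u v).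
Proof.
move=> tn; have B0 : B = 3 * L + 1 by [].
have turn i : i < B -> half_turn g s (t * B + i) = (i == L).
  by move=> iB; rewrite /half_turn modnMDl modn_small.
have -> : t.+1 * B = t * B + B by rewrite mulSn addnC.
move: turn tn; set k := t * B => turn tn.
have E1 : B + r = L + (1 + (2 * L + r)) by lia.
have e1 : k + (L + (1 + (2 * L + r))) = n by lia.
have n1 i : i < L -> ~~ half_turn g s (k + i) by move=> iL; rewrite turn; lia.
have e2 : (k + L).+1 + (2 * L + r) = n by lia.
have n2 i : i < 2 * L -> ~~ half_turn g s ((k + L).+1 + i).
  by move=> iL; rewrite (_ : _ + i = k + (L + 1 + i)) ?turn; lia.
have e3 : k + B + r = n by lia.
have tL : half_turn g s (k + L) by rewrite turn ?eqxx; lia.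
have Q1 := @qvalue_block n (nclauses g s T) (half_turn g s) (literal g s T initbad finbad good) L (1 + (2 * L + r)) k a e1 n1.
have Q2 a' := @qvalue_block n (nclauses g s T) (half_turn g s) (literal g s T initbad finbad good) (2 * L) r (k + L).+1 a' e2 n2.
have kB : (k + L).+1 + 2 * L = k + B by lia.
rewrite E1; split.
  move=> /Q1[a1 ea1]; rewrite /= tL => /andP[q0 q1].
  exists (fun o => a1 (k + o)) => b.
  have /Q2[a2 ea2 q2] : qv (2 * L + r) (k + L).+1 (set_var a1 (k + L) b) by case: b.
  exists (fun o => a2 (k + (L + 1 + o))), (fun o => a2 (k + (2 * L + 1 + o))).
  rewrite -(qvalue_ext _ _ _ e3 (_ : forall i, i < k + B -> a2 i = _)) -?kB // => i.
  rewrite kB /fill => iB; case: (ltnP i k) => ik.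
    by rewrite ea2 /set_var; [rewrite ifF; [exact: ea1|apply/eqP; lia]|lia].
  case: (ltnP (i - k) L) => iL.
    by rewrite ea2 /set_var; [rewrite ifF; [congr a1; lia|apply/eqP; lia]|lia].
  case: eqP => iL'; first by rewrite ea2 /set_var; [rewrite ifT //; apply/eqP; lia|lia].
  by case: ltnP => i2; congr a2; lia.
move=> [w H]; apply/Q1; exists (fun i => if i < k then a i else w (i - k)).
  by move=> i ->.
rewrite /= tL.
suff q b : qv (2 * L + r) (k + L).+1 (set_var (fun i => if i < k then a i else w (i - k)) (k + L) b).
  by rewrite !q.
have [u [v q]] := H b; apply/Q2; exists (fill a k w b u v); last by rewrite kB.
move=> i ikL; rewrite /fill /set_var; case: (i =P k + L) => [->|ne].
  by rewrite ltnNge leq_addr /= addKn ltnn eqxx.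
by case: (ltnP i k) => // ki; rewrite ifT //; lia.
Qed.

Lemma fill_below a k w b u v i : i < k -> fill a k w b u v i = a i.
Proof. by rewrite /fill => ->. Qed.
Lemma fill_mid a t w b u v j : j < L -> fill a (t * B) w b u v (mid_var g s t j) = w j.
Proof. by move=> jL; rewrite /fill /mid_var ltnNge leq_addr /= addKn jL. Qed.
Lemma fill_half a t w b u v : fill a (t * B) w b u v (half_var g s t) = b.
Proof. by rewrite /fill /half_var ltnNge leq_addr /= addKn ltnn eqxx. Qed.
Lemma fill_left a t w b u v j : j < L -> fill a (t * B) w b u v (left_var g s t j) = u j.
Proof.
move=> jL; rewrite /fill /left_var ltnNge leq_addr /= addKn.
rewrite ifF; last by lia.
rewrite ifF; last by lia.
by rewrite ifT ?addKn //; lia.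
Qed.
Lemma fill_right a t w b u v j : j < L -> fill a (t * B) w b u v (right_var g s t j) = v j.
Proof.
move=> jL; rewrite /fill /right_var ltnNge leq_addr /= addKn.
rewrite ifF; last by lia.
rewrite ifF; last by lia.
by rewrite ifF ?addKn //; lia.
Qed.

Lemma vars_below t t' j : t' < t -> j < L -> [/\ mid_var g s t' j < t * B,
   half_var g s t' < t * B, left_var g s t' j < t * B & right_var g s t' j < t * B].
Proof.
move=> tt jL; have := leq_mul tt (leqnn B); have B0 : B = 3 * L + 1 by [].
by rewrite /mid_var /half_var /left_var /right_var mulSn; split; lia.
Qed.

Lemma linked_ext a a' t : (forall i, i < t.+2 * B -> a i = a' i) -> linked g s a t -> linked g s a' t.
Proof.
move=> e H j jL; have [h1 h2] := H j jL.
have [m1 h1' l1 r1] := vars_below (ltnSn t.+1) jL.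
have [_ _ l2 r2] := vars_below (ltnW (ltnSn t.+1) : t < t.+2) jL.
by rewrite -!e.
Qed.

(** The links force the ends at level [t.+1] to be those of the selected half. The universal choice
    of the half then asks for both recursive calls of [reach], while the matrix occurs once. *)
Lemma level_value r t a : t + r = T ->
  qv (r * B) (t.+1 * B) a <->
  [/\ forall t', t' < t -> linked g s a t', starts g s initbad (left_bits g s a 0),
      ends g s finbad (right_bits g s a 0) & reach r (left_bits g s a t) (right_bits g s a t)].
Proof.
elim: r t a => [|r IH] t a tr.
  rewrite addn0 in tr; rewrite tr; exact: satisfiedP.
have tT : t.+1 + r = T by lia.
have nE : t.+1 * B + (B + r * B) = n.
  by rewrite -mulSn -mulnDl /nvars; congr (_ * _); lia.
rewrite [r.+1 * B]mulSn level_split //.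
have below w b u v i : i < t.+1 * B -> fill a (t.+1 * B) w b u v i = a i by apply: fill_below.
have low w b u v j : j < L ->
    left_bits g s (fill a (t.+1 * B) w b u v) 0 j = left_bits g s a 0 j /\
    right_bits g s (fill a (t.+1 * B) w b u v) 0 j = right_bits g s a 0 j.
  move=> jL; have [_ _ l1 r1] := vars_below (ltn0Sn t) jL.
  by rewrite /left_bits /right_bits !below.
have lowt w b u v j : j < L ->
    left_bits g s (fill a (t.+1 * B) w b u v) t j = left_bits g s a t j /\
    right_bits g s (fill a (t.+1 * B) w b u v) t j = right_bits g s a t j.
  move=> jL; have [_ _ l1 r1] := vars_below (ltnSn t) jL.
  by rewrite /left_bits /right_bits !below.
have lk w b u v t' : t' < t ->
    linked g s (fill a (t.+1 * B) w b u v) t' <-> linked g s a t'.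
  move=> tt; have le : t'.+2 * B <= t.+1 * B by rewrite leq_mul2r ltnS tt orbT.
  by split; apply: linked_ext => i it; rewrite below //; apply: leq_trans le.
split=> [[w H]|[Hl Hs He [w [uw wv]]]].
  have [u0 [v0 /(IH _ _ tT)[l0 s0 f0 r0]]] := H false.
  have [u1 [v1 /(IH _ _ tT)[l1 s1 f1 r1]]] := H true.
  split=> [t' t't|j jL bad|j jL bad|].
  - by apply/(lk w false u0 v0 t' t't); apply: l0; lia.
  - by have [<- _] := low w false u0 v0 j jL; apply: s0.
  - by have [_ <-] := low w false u0 v0 j jL; apply: f0.
  exists w; split; [apply: reach_ext r0|apply: reach_ext r1] => j jL.
  - have [+ _] := l0 t (ltnSn t) j jL; rewrite fill_half => e.
    by rewrite [LHS]e; have [<- _] := lowt w false u0 v0 j jL.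
  - have [_ +] := l0 t (ltnSn t) j jL; rewrite fill_half fill_mid // => e; exact: e.
  - have [+ _] := l1 t (ltnSn t) j jL; rewrite fill_half fill_mid // => e; exact: e.
  - have [_ +] := l1 t (ltnSn t) j jL; rewrite fill_half => e.
    by rewrite [LHS]e; have [_ <-] := lowt w true u1 v1 j jL.
exists w => b; pose u := if b then w else left_bits g s a t.
pose v := if b then right_bits g s a t else w; exists u, v.
apply/(IH _ _ tT); split=> [t' t't|j jL bad|j jL bad|].
- have [->|ne] := eqVneq t' t; last by apply/lk; [lia|apply: Hl; lia].
  move=> j jL; rewrite fill_left // fill_right // fill_half fill_mid //.
  have [e1 e2] := lowt w b u v j jL.
  by rewrite [_ (left_var _ _ t j)]e1 [_ (right_var _ _ t j)]e2 /u /v; case: (b).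
- by have [-> _] := low w b u v j jL; apply: Hs.
- by have [_ ->] := low w b u v j jL; apply: He.
have eL j : j < L -> u j = left_bits g s (fill a (t.+1 * B) w b u v) t.+1 j.
  by move=> jL; rewrite /left_bits fill_left.
have eR j : j < L -> v j = right_bits g s (fill a (t.+1 * B) w b u v) t.+1 j.
  by move=> jL; rewrite /right_bits fill_right.
by apply: (reach_ext eL eR); rewrite /u /v; case: (b).
Qed.

Theorem qvalue_reach a : qv n 0 a <->
  exists u v, [/\ starts g s initbad u, ends g s finbad v & reach T u v].
Proof.
have nE : n = B + T * B by rewrite -mulSn.
have tn : 0 * B + (B + T * B) = n by rewrite mul0n nE.
have := level_split a tn; rewrite mul0n -nE => ->; split=> [[w /(_ false)[u [v]]]|[u [v [su ev r]]]].
  move=> /(level_value _ (add0n T))[_ sl er r].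
  by exists (left_bits g s (fill a 0 w false u v) 0), (right_bits g s (fill a 0 w false u v) 0).
(* [u] is a default for the middle word of level 0, whose ends are those of the whole run. *)
exists u => b; exists u, v; apply/(level_value _ (add0n T)).
have eL j : j < L -> left_bits g s (fill a (0 * B) u b u v) 0 j = u j by move=> jL; apply: fill_left.
have eR j : j < L -> right_bits g s (fill a (0 * B) u b u v) 0 j = v j by move=> jL; apply: fill_right.
rewrite mul0n in eL eR; split=> // [j jL bad|j jL bad|].
- by rewrite eL //; apply: su.
- by rewrite eR //; apply: ev.
by apply: reach_ext r => j jL; rewrite ?eL ?eR.
Qed.
End Levels.

(** * Configurations as words over a finite alphabet *)

Section Words.
Variables (M : turing_machine) (s : nat).
Local Notation index := 'I_(tm_tapes M).+1.
Definition csym : finType := option (bool + tm_work M)%type.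

(* A letter describes one position of all the tapes: the state and the scanned symbols, which
   are repeated at every position, the symbols found at this position, and whether the heads
   are there. The border of a word is marked by [None]. *)
Definition letter : finType :=
  option (tm_state M * {ffun index -> csym} * {ffun index -> csym} * {ffun index -> bool})%type.

Definition head_at (a : letter) (i : index) : bool := if a is Some l then l.2 i else false.

(** [a1] is [None] at the left border, where a left move stays put. *)
Definition new_head (m : move) (a1 : letter) (h : bool) (a3 : letter) (i : index) : bool :=
  match m with
  | Left => head_at a3 i || (h && ~~ isSome a1)
  | Stay => h
  | Right => head_at a1 i
  end.

(** The scanned symbols [r'] after the step cannot be computed inside a window, as heads may be
    elsewhere. They are verified instead: neighbors must agree on them, and wherever a head stands
    they must match the symbol there. *)
Definition allowed (a1 a2 a3 b1 b2 b3 : letter) : bool :=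
  [&& isSome a1 == isSome b1, isSome a2 == isSome b2, isSome a3 == isSome b3 &
    match a2, b2 with
    | Some (q, r, sy, hd), Some (q', r', sy', hd') =>
      [&& if tm_halting q then [&& q' == q, sy' == sy & hd' == hd] else
            [&& q' == (tm_trans q r).1,
                [forall i, sy' i == if hd i then ((tm_trans q r).2 i).1 else sy i] &
                [forall i, hd' i == new_head ((tm_trans q r).2 i).2 a1 (hd i) a3 i]],
          if b3 is Some (_, r3, _, _) then r3 == r' else true &
          [forall i, hd' i ==> (r' i == sy' i)]]
    | _, _ => true
    end].

Definition scanned (c : config M) : {ffun index -> csym} :=
  [ffun i => cfg_tape c i (cfg_head c i)].

Definition letter_at (c : config M) (q : nat) : letter :=
  if (q == 0) || (s < q) then None else
  Some (cfg_state c, scanned c, [ffun i => cfg_tape c i q.-1], [ffun i => cfg_head c i == q.-1]).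

Arguments letter_at : simpl never.
Arguments head_at : simpl never.

Definition follows_word (w w' : nat -> letter) : Prop := forall p, p < s ->
  allowed (w p) (w p.+1) (w p.+2) (w' p) (w' p.+1) (w' p.+2).

Definition in_space (c : config M) : Prop := forall i, cfg_head c i < s.

Lemma letter_at_inside c p : p < s ->
  letter_at c p.+1 = Some (cfg_state c, scanned c, [ffun i => cfg_tape c i p], [ffun i => cfg_head c i == p]).
Proof. by move=> ps; rewrite /letter_at /= ltnNge ps. Qed.

Lemma follows_step c : in_space c -> follows_word (letter_at c) (letter_at (step c)).
Proof.
move=> sp p ps; rewrite /allowed.
have some c1 c2 q : isSome (letter_at c1 q) == isSome (letter_at c2 q).
  by rewrite /letter_at; case: ifP.
rewrite !some /= !(letter_at_inside _ ps); apply/and3P; split.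
- case: ifP => h; first by rewrite /step h !eqxx.
  rewrite /step h /= eqxx /=; apply/andP; split; apply/forallP => i; rewrite !ffunE.
    by rewrite /= (eq_sym p); case: (cfg_head c i =P p) => /= _; apply/eqP.
  have spi := sp i; rewrite /=; set mv := (_.2 i).2.
  have E3 : head_at (letter_at c p.+2) i = (cfg_head c i == p.+1).
    rewrite /head_at /letter_at /=; case: ltnP => /= sp'; last by rewrite ffunE.
    by apply/esym/negbTE; lia.
  have E1 : head_at (letter_at c p) i = (p != 0) && (cfg_head c i == p.-1).
    by rewrite /head_at /letter_at; have [->|p0] := eqVneq p 0; rewrite //= ltnNge (ltnW ps) /= ffunE.
  have E0 : isSome (letter_at c p) = (p != 0).
    by rewrite /letter_at; have [->|p0] := eqVneq p 0; rewrite //= ltnNge (ltnW ps).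
  by rewrite /new_head E3 E1 E0; case: mv => /=; lia.
- by rewrite {1}/letter_at; case: ifP.
- by apply/forallP => i; rewrite !ffunE; apply/implyP => /eqP->.
Qed.

(** Everything in the new letter is local except the record of scanned symbols. *)
Lemma allowed_det a1 a2 a3 b1 b2 b3 b1' b2' b3' q r sy hd :
  allowed a1 a2 a3 b1 b2 b3 -> allowed a1 a2 a3 b1' b2' b3' -> isSome a2 ->
  b2' = Some (q, r, sy, hd) -> exists r', b2 = Some (q, r', sy, hd).
Proof.
case: a2 => [[[[qa ra] sya] hda]|//] /and4P[_ + _ +] /and4P[_ _ _ +] _ e; rewrite e.
case: b2 => [[[[q1 r1] sy1] hd1]|//] _ /and3P[H1 _ _] /and3P[H2 _ _]; exists r1.
case: ifP H1 H2 => _.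
  by move=> /and3P[/eqP-> /eqP-> /eqP->] /and3P[/eqP-> /eqP-> /eqP->].
move=> /and3P[/eqP-> /forallP S1 /forallP D1] /and3P[/eqP-> /forallP S2 /forallP D2].
congr (Some (_, _, _, _)); apply/ffunP => i.
  by rewrite (eqP (S1 i)) (eqP (S2 i)).
by rewrite (eqP (D1 i)) (eqP (D2 i)).
Qed.

(** The record of scanned symbols is the same at all inner positions, by agreement of neighbors, and
    it is right for tape [i] at the head of that tape, which lies inside the space. *)
Lemma follows_det c w w' : in_space c -> in_space (step c) ->
  (forall q, q < s + 2 -> w q = letter_at c q) -> follows_word w w' ->
  forall q, q < s + 2 -> w' q = letter_at (step c) q.
Proof.
move=> sp sp' ew fw.
have s0 : 0 < s by have := sp ord0; lia.
have al p : p < s -> allowed (letter_at c p) (letter_at c p.+1) (letter_at c p.+2)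
    (w' p) (w' p.+1) (w' p.+2).
  by move=> ps; have := fw p ps; rewrite !ew //; lia.
have border q : isSome (letter_at c q) = isSome (w' q) -> (q == 0) || (s < q) -> w' q = None.
  by rewrite /letter_at => + h; rewrite h; case: (w' q).
have mid p : p < s -> exists r', w' p.+1 = Some (cfg_state (step c), r',
    [ffun i => cfg_tape (step c) i p], [ffun i => cfg_head (step c) i == p]).
  move=> ps; apply: (allowed_det (al p ps) (follows_step sp ps)); last exact: letter_at_inside.
  by rewrite letter_at_inside.
pose rd p := if w' p.+1 is Some (_, r, _, _) then r else scanned c.
have rdS p : p.+1 < s -> rd p.+1 = rd p.
  move=> ps; have [r1 e1] := mid p (ltnW ps); have [r2 e2] := mid p.+1 ps.
  have /and4P[_ _ _] := al p (ltnW ps).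
  by rewrite letter_at_inside ?(ltnW ps) // /rd e1 e2 => /and3P[_ /eqP].
have rd0 p : p < s -> rd p = rd 0.
  by elim: p => // p IH ps; rewrite rdS // IH // ltnW.
have rdE p : p < s -> rd p = scanned (step c).
  move=> ps; apply/ffunP => i; have hs := sp' i; set h := cfg_head (step c) i in hs.
  rewrite rd0 // -(rd0 h hs) ffunE -/h; have [r1 e1] := mid h hs.
  have /and4P[_ _ _] := al h hs; rewrite letter_at_inside // /rd e1.
  by move=> /and3P[_ _ /forallP/(_ i)]; rewrite !ffunE eqxx => /eqP.
case=> [_|p ps2].
  have /and4P[/eqP e _ _ _] := al 0 s0; exact: border e isT.
have [ps|sp1] := ltnP p s.
  have [r e] := mid p ps; rewrite e letter_at_inside // -(rdE p ps) /rd e //.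
have ep : p.+1 = s.-1.+2 by lia.
have /and4P[_ _ /eqP e _] : allowed (letter_at c s.-1) (letter_at c s.-1.+1) (letter_at c s.-1.+2)
    (w' s.-1) (w' s.-1.+1) (w' s.-1.+2) by apply: al; lia.
rewrite ep border //; last by lia.
by rewrite /letter_at ifT //; lia.
Qed.

Local Notation g := #|letter|.
Definition code (a : letter) : nat := seq.index a (enum letter).
Definition decode (i : nat) : letter := nth None (enum letter) i.

Lemma code_lt a : code a < g.
Proof. by rewrite /code cardE index_mem mem_enum. Qed.

Lemma codeK a : decode (code a) = a.
Proof. by rewrite /decode /code nth_index // mem_enum. Qed.

Lemma decodeK i : i < g -> code (decode i) = i.
Proof. by move=> ig; rewrite /code /decode index_uniq ?enum_uniq // -cardE. Qed.

Lemma g_gt0 : 0 < g. Proof. by apply/card_gt0P; exists None. Qed.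

Definition digit (w i : nat) : nat := (w %/ g ^ i) %% g.

Definition good_window (w : nat) : bool :=
  allowed (decode (digit w 0)) (decode (digit w 1)) (decode (digit w 2))
          (decode (digit w 3)) (decode (digit w 4)) (decode (digit w 5)).

Definition number (cs : seq nat) : nat := foldr (fun c n => c + g * n) 0 cs.

Lemma digit_number cs i : all (fun c => c < g) cs -> digit (number cs) i = nth 0 cs i.
Proof.
rewrite /digit; elim: cs i => [|c cs IH] i /=; first by rewrite div0n mod0n nth_nil.
case/andP=> cg call; case: i => [|i] /=.
  by rewrite expn0 divn1 mulnC addnC modnMDl modn_small.
have h : (c + g * number cs) %/ g = number cs.
  by rewrite addnC mulnC divnMDl ?g_gt0 // divn_small // addn0.
by rewrite expnS divnMA h IH.
Qed.

Lemma number_lt cs : all (fun c => c < g) cs -> number cs < g ^ size cs.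
Proof.
elim: cs => //= c cs IH /andP[cg /IH h]; rewrite expnS.
move: (g ^ _) (number cs) h cg => G N h cg.
by have := leq_mul (leqnn g) h; rewrite mulnS; apply: leq_trans; rewrite -addSn leq_add2r.
Qed.

Definition word_of (u : nat -> bool) (q : nat) : letter :=
  head None [seq a <- enum letter | u (q * g + code a)].

Definition bits_of (w : nat -> letter) (j : nat) : bool := code (w (j %/ g)) == j %% g.

Lemma word_of_bit u q : total g s u -> q < s + 2 -> u (q * g + code (word_of u q)).
Proof.
move=> tu qs; have [a ag ua] := tu q qs; rewrite /word_of.
have : decode a \in [seq a <- enum letter | u (q * g + code a)].
  by rewrite mem_filter mem_enum decodeK // ua.
case e : [seq _ <- _ | _] => [|b bs] //= _.
have : b \in [seq a <- enum letter | u (q * g + code a)] by rewrite e inE eqxx.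
by rewrite mem_filter => /andP[].
Qed.

Lemma base_word u v : base g s good_window u v -> follows_word (word_of u) (word_of v).
Proof.
move=> [tu tv win] p ps.
set cs := [:: code (word_of u p); code (word_of u p.+1); code (word_of u p.+2);
   code (word_of v p); code (word_of v p.+1); code (word_of v p.+2)].
have call : all (fun c => c < g) cs by rewrite /= !code_lt.
(* A forbidden window would have a missing letter, but all six chosen letters are present. *)
apply/negPn/negP => na; have [|i i6] := win p (number cs) ps (number_lt call).
  by rewrite /good_window !digit_number //= !codeK.
rewrite -/(digit _ _) digit_number //; apply/negP/negPn.
by case: i i6 => [|[|[|[|[|[|i]]]]]] //= _; rewrite ?subSS ?subn0 ?addn0 ?addn1 ?addn2;
  apply: word_of_bit => //; lia.
Qed.

Lemma bits_of_bit w q a : a < g -> bits_of w (q * g + a) = (code (w q) == a).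
Proof. by move=> ag; rewrite /bits_of divnMDl ?g_gt0 // divn_small // addn0 modnMDl modn_small. Qed.

Lemma base_bits w w' : follows_word w w' -> base g s good_window (bits_of w) (bits_of w').
Proof.
move=> fw; split=> [q _|q _|p t ps tg bad].
- by exists (code (w q)); rewrite ?bits_of_bit ?code_lt.
- by exists (code (w' q)); rewrite ?bits_of_bit ?code_lt.
pose letter_of i := if i < 3 then w (p + i) else w' (p + (i - 3)).
have dg i : digit t i < g by rewrite ltn_mod g_gt0.
have [/hasP[i]|/hasPn H] := boolP (has (fun i => code (letter_of i) != digit t i) (iota 0 6)).
  rewrite mem_iota => /= i6 ne; exists i => //; rewrite -/(digit _ _).
  by move: ne; rewrite /letter_of; case: ifP => _ ne; rewrite bits_of_bit.
case/negP: bad; have E i : i < 6 -> decode (digit t i) = letter_of i.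
  by move=> i6; have := H i; rewrite mem_iota negbK => /(_ i6)/eqP <-; rewrite codeK.
by rewrite /good_window !E // /letter_of /= !subSS !subn0 addn0 addn1 addn2; apply: fw.
Qed.

Definition accepting_letter (a : letter) : bool :=
  if a is Some (q, _, _, _) then tm_accepting q else false.

Section Run.
Variable x : seq bool.
Hypothesis spacex : runs_in_space M x s.

Definition init_bad (j : nat) : bool :=
  decode (j %% g) != letter_at (init_config M x) (j %/ g).
(** Every letter inside the border carries the state, so position 1 shows acceptance. *)
Definition final_bad (j : nat) : bool :=
  (j %/ g == 1) && ~~ accepting_letter (decode (j %% g)).

Local Notation reach := (reach g s good_window).

Lemma in_space_run t : in_space (run M x t).
Proof. by move=> i; apply: spacex. Qed.

Lemma reach_word r t u v : (forall q, q < s + 2 -> word_of u q = letter_at (run M x t) q) ->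
  reach r u v -> forall q, q < s + 2 -> word_of v q = letter_at (run M x (t + 2 ^ r)) q.
Proof.
elim: r t u v => [|r IH] t u v eu /=.
  move=> /base_word fw; rewrite addn1; exact: (@follows_det (run M x t) _ _ (in_space_run t) (in_space_run t.+1) eu fw).
move=> [w [uw wv]]; rewrite expnS mul2n -addnn addnA.
exact: (IH _ _ _ (IH _ _ _ eu uw) wv).
Qed.

Lemma reach_bits r t : reach r (bits_of (letter_at (run M x t))) (bits_of (letter_at (run M x (t + 2 ^ r)))).
Proof.
elim: r t => [|r IH] t /=.
  by rewrite addn1; apply/base_bits/follows_step/in_space_run.
exists (bits_of (letter_at (run M x (t + 2 ^ r)))); split; first exact: IH.
by rewrite expnS mul2n -addnn addnA; apply: IH.
Qed.

Lemma run_halted t t' : halts_at M x t -> t <= t' -> run M x t' = run M x t.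
Proof.
move=> h tt; rewrite -(subnK tt) /run iterD; apply: iter_fix.
by rewrite /step; move: h; rewrite /halts_at /run => ->.
Qed.

(** A word leaves out the cells beyond the space, but it determines the words to come. *)
Lemma same_word t t' k : (forall q, q < s + 2 -> letter_at (run M x t) q = letter_at (run M x t') q) ->
  forall q, q < s + 2 -> letter_at (run M x (t + k)) q = letter_at (run M x (t' + k)) q.
Proof.
move=> e; elim: k => [|k IH]; first by rewrite !addn0.
move=> q qs; rewrite (addnS t) (addnS t').
exact: (@follows_det (run M x (t' + k)) _ (letter_at (step (run M x (t + k)))) (in_space_run _)
  (in_space_run (t' + k).+1) IH (follows_step (in_space_run (t + k))) q qs).
Qed.

(* A run of minimal length repeats no word. *)
Lemma halts_early t : halts_at M x t -> exists2 t', t' < 2 ^ ((s + 2) * g) & halts_at M x t'.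
Proof.
move=> ht; have ex : exists t, tm_halting (cfg_state (run M x t)) by exists t.
have [m hm mmin] := ex_minnP ex; exists m => //.
have s0 : 0 < s by have := in_space_run 0 ord0; lia.
pose f (i : 'I_m.+1) : {ffun 'I_(s + 2) -> letter} := [ffun q : 'I_(s + 2) => letter_at (run M x i) q].
have finj : injective f.
  suff H (i j : 'I_m.+1) : i < j -> f i <> f j.
    move=> i j e; apply: val_inj; case: (ltngtP i j) => // [/H|/H]; by rewrite e.
  move=> ij /ffunP e; have jm : j <= m by rewrite -ltnS.
  have e' q : q < s + 2 -> letter_at (run M x i) q = letter_at (run M x j) q.
    by move=> qs; have := e (Ordinal qs); rewrite !ffunE.
  (* Replaying the last [m - j] steps from time [i] would halt before the minimal time [m]. *)
  have := same_word (m - j) e' (_ : 1 < s + 2); rewrite addn2 => /(_ isT).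
  rewrite !letter_at_inside // => -[est _ _ _].
  have := mmin (i + (m - j)); rewrite est subnKC // => /(_ hm); lia.
have := leq_card f finj; rewrite card_ord card_ffun card_ord => le.
(* There are [g ^ (s + 2)] words, and [g <= 2 ^ g]. *)
apply: leq_trans le _; rewrite mulnC expnM; apply: leq_exp.
exact: ltnW (ltn_expl _ _).
Qed.

(** A halted machine stays where it is, so the configuration after exactly [2 ^ T] steps shows the
    outcome; [T = (s + 2) * g] comes from [halts_early]. *)
Theorem reach_accepting t : halts_at M x t ->
  (exists u v, [/\ starts g s init_bad u, ends g s final_bad v & reach ((s + 2) * g) u v]) <->
  tm_accepting (cfg_state (run M x t)).
Proof.
move=> ht; have [t' t'T ht'] := halts_early ht; set T := (s + 2) * g in t'T *.
have s0 : 0 < s by have := in_space_run 0 ord0; lia.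
have eT : run M x (0 + 2 ^ T) = run M x t.
  rewrite add0n (run_halted ht' (ltnW t'T)).
  by case: (leqP t t') => [|/ltnW] tt; [rewrite (run_halted ht tt)|rewrite (run_halted ht' tt)].
have acc : accepting_letter (letter_at (run M x t) 1) = tm_accepting (cfg_state (run M x t)).
  by rewrite letter_at_inside.
have cl q a : q < s + 2 -> q * g + code a < word_bits g s by move=> qs; have := cell_lt g_gt0 qs (code_lt a).
have dm q a : (q * g + code a) %/ g = q /\ (q * g + code a) %% g = code a.
  by rewrite divnMDl ?g_gt0 // divn_small ?code_lt // addn0 modnMDl modn_small ?code_lt.
split=> [[u [v [su ev r]]]|h].
  have tu : total g s u /\ total g s v.
    elim: (T) u v r {su ev} => [|k IH] u v /=; first by case.
    by move=> [w [/IH[? _] /IH[_ ?]]].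
  have eu q : q < s + 2 -> word_of u q = letter_at (run M x 0) q.
    move=> qs; have [d1 d2] := dm q (word_of u q).
    have := su _ (cl q (word_of u q) qs); rewrite /init_bad d1 d2 codeK word_of_bit //; last by case: tu.
    by move=> H; apply/eqP/negPn/negP => /H.
  have s1 : 1 < s + 2 by lia.
  have := reach_word eu r s1; rewrite eT => ew.
  have [d1 d2] := dm 1 (word_of v 1).
  have := ev _ (cl 1 (word_of v 1) s1); rewrite /final_bad d1 d2 codeK word_of_bit //; last by case: tu.
  rewrite eqxx /= ew acc => H; apply/negPn/negP => /H; exact.
exists (bits_of (letter_at (run M x 0))), (bits_of (letter_at (run M x (0 + 2 ^ T)))).
split; last exact: reach_bits.
- move=> j jL; rewrite /init_bad /bits_of; apply: contraNN => /eqP e.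
  by rewrite -e codeK.
- move=> j jL /andP[/eqP j1]; rewrite /bits_of; apply: contraNN => /eqP e.
  by rewrite -e codeK j1 eT acc.
Qed.
End Run.
End Words.

(** * The reduction *)

Lemma nth_read x j : nth false x j = (read x j == 2).
Proof. by rewrite /read -odflt_onth; case: onth => [[]|]. Qed.

(** The leading [false] makes Staller the first player. *)
Definition encoding_bit (n : nat) (adj : nat -> nat -> bool) (j : nat) : bool :=
  if j == 0 then false else if j <= n then true else if j == n.+1 then false
  else adj ((j - (n + 2)) %/ n) ((j - (n + 2)) %% n).

Lemma encode_mkseq (G : graph) (a : nat -> nat -> bool) :
  (forall u v : vertex G, adj u v = a u v) ->
  encode G Staller = mkseq (encoding_bit (nvertices G) a) (nvertices G + 2 + nvertices G * nvertices G).
Proof.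
move=> adjE; set n := nvertices G.
apply: (@eq_from_nth _ false); first by rewrite size_mkseq size_encode.
move=> j; rewrite size_encode -/n => jn; rewrite nth_mkseq // nth_read /encoding_bit.
case: (j =P 0) => [->//|j0]; case: (leqP j n) => jn'.
  have h : j.-1 < coded_order (encode G Staller) by rewrite order_encode -/n; lia.
  by have := order_prefix h; rewrite prednK; [move=> ->|lia].
case: (j =P n.+1) => [->|jn1]; first by rewrite read_encode_sep.
have qn : j - (n + 2) < n * n by lia.
have n0 : 0 < n by case: (n) qn => //; rewrite mul0n.
have q1 : (j - (n + 2)) %/ n < n by rewrite ltn_divLR.
have q2 : (j - (n + 2)) %% n < n by rewrite ltn_mod.
have e : j = n + 2 + (j - (n + 2)) %/ n * n + (j - (n + 2)) %% n.
  by rewrite -addnA -divn_eq; lia.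
rewrite [in read _ _]e (@read_encode_adj G Staller (Ordinal q1) (Ordinal q2)) adjE /=.
by case: (a _ _).
Qed.

Lemma winning_encode G G' first first' : encode G first = encode G' first' ->
  has_winning_strategy G first Dominator -> has_winning_strategy G' first' Dominator.
Proof.
move=> e /value_winning v; apply/value_winning.
by move: v; rewrite -(order_encode G first) -(order_encode G' first') e.
Qed.

Lemma reach_good g s good good' r u v : (forall w, w < g ^ 6 -> good w = good' w) ->
  reach g s good r u v -> reach g s good' r u v.
Proof.
move=> e; elim: r u v => [|r IH] u v /=.
  by move=> [tu tv win]; split=> // p w ps wg; rewrite -e //; apply: win.
by move=> [w [/IH uw /IH wv]]; exists w.
Qed.

Section Reduction.
Variables (M : turing_machine) (p : {poly nat}).
Local Notation g := #|letter M|.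

Definition space (x : seq bool) : nat := (p.[size x])%R.
Definition levels (x : seq bool) : nat := (space x + 2) * g.

Definition start_letter (r0 r1 : nat) (b : bool) : letter M :=
  let tr r : option (bool + tm_work M) := if r is r'.+1 then Some (inl (r' == 1)) else None in
  Some (tm_start M, [ffun i => if i == ord0 then tr r0 else None],
    [ffun i => if i == ord0 then tr r1 else None], [ffun=> b]).

(** Three readings of the first input cell, three of the cell at hand and the presence of the heads
    make [3 * 3 * 2 = 18] cases, whose codes fit in a constant table. *)
Definition start_code (x : seq bool) (q : nat) : nat :=
  if (q == 0) || (space x < q) then code (None : letter M) else
  nth 0 (mkseq (fun i => code (start_letter (i %/ 6) ((i %/ 2) %% 3) (i %% 2 == 1))) 18)
    ((read x 0 * 3 + read x (q - 1)) * 2 + (q == 1)).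

Lemma start_codeE x q : start_code x q = code (letter_at (space x) (init_config M x) q).
Proof.
rewrite /start_code /letter_at; case: ifP => // /negbT/norP[q0 _].
set i := _ * 2 + _.
have i18 : i < 18 by rewrite /i; have := read_le x 0; have := read_le x (q - 1); case: (q == 1); lia.
rewrite nth_mkseq //; congr code.
have tr (z : seq bool) r : (if read z r is r'.+1 then Some (inl (r' == 1)) else None) =
     word_tape M z r by rewrite /read /word_tape; case: onth => [[]|].
have r1 := read_le x (q - 1); have r0 := read_le x 0.
have -> : i %/ 6 = read x 0 by rewrite /i; case: (q == 1); lia.
have -> : (i %/ 2) %% 3 = read x (q - 1) by rewrite /i; case: (q == 1); lia.
have -> : (i %% 2 == 1) = (q == 1) by rewrite /i; case: (q == 1); lia.
rewrite /start_letter !tr /scanned; congr (Some (_, _, _, _)); apply/ffunP => j; rewrite !ffunE /=.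
- by case: ifP.
- by rewrite subn1; case: ifP.
- by case: (q) q0 => [|[|q']].
Qed.

Definition start_bad (x : seq bool) (j : nat) : bool := j %% g != start_code x (j %/ g).
Definition end_bad (j : nat) : bool :=
  (j %/ g == 1) && nth false (mkseq (fun a => ~~ accepting_letter (decode M a)) g) (j %% g).
Definition good_table (w : nat) : bool := nth false (mkseq (@good_window M) (g ^ 6)) w.

Lemma start_badE x j : start_bad x j = init_bad M (space x) x j.
Proof.
have jg : j %% g < g by rewrite ltn_mod g_gt0.
rewrite /start_bad /init_bad start_codeE; congr negb; apply/eqP/eqP => [->|<-].
  by rewrite codeK.
by rewrite decodeK.
Qed.

Lemma end_badE j : end_bad j = final_bad M j.
Proof. by rewrite /end_bad /final_bad nth_mkseq // ltn_mod g_gt0. Qed.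

Local Notation n x := (nvars g (space x) (levels x)).
Definition matrix x := literal g (space x) (levels x) (start_bad x) end_bad good_table.
Definition points x := 4 * n x.
Definition edges x := 4 * n x + nclauses g (space x) (levels x).
Definition incidence x := incident (n x) (half_turn g (space x)) (matrix x).
Definition game_graph x := hyper_graph (points x) (edges x) (incidence x).

Theorem game_graph_correct x t : runs_in_space M x (space x) -> halts_at M x t ->
  has_winning_strategy (game_graph x) Staller Dominator <-> tm_accepting (cfg_state (run M x t)).
Proof.
move=> sp ht; rewrite -(reach_accepting sp ht).
rewrite -(@qvalue_game (n x) (nclauses g (space x) (levels x)) _ (matrix x) (fun=> false)).
have G u v r : reach g (space x) good_table r u v <-> reach g (space x) (@good_window M) r u v.
  by split; apply: reach_good => w wg; rewrite /good_table nth_mkseq.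
rewrite qvalue_reach ?g_gt0 //; split=> -[u [v [su ev /G r]]]; exists u, v; split=> //.
- by move=> j jL; rewrite -start_badE; apply: su.
- by move=> j jL; rewrite -end_badE; apply: ev.
- by move=> j jL; rewrite start_badE; apply: su.
- by move=> j jL; rewrite end_badE; apply: ev.
Qed.

Lemma computable_space : computable (fun x y e => space x).
Proof. by rewrite /space; computable. Qed.

Lemma computable_start_bad (j : fn) : computable j -> computable (fun x y e => start_bad x (j x y e)).
Proof.
move=> cj; have S := computable_space.
rewrite /start_bad /start_code; computable.
Qed.

Lemma computable_window (pf w k : fn) b : computable pf -> computable w -> computable k ->
  computable (fun x y e => b && some_lt 6 (fun i =>
    k x y e == window_var g (space x) (levels x) (pf x y e) (w x y e) i)).
Proof.
move=> cp cw ck; have S := computable_space.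
(* Powers with a variable exponent are not expressions, so [g ^ i] for [i < 6] is looked up in a
   table. *)
apply: (@computable_ext (fun x y e => b && some_lt 6 (fun i => k x y e ==
   if i < 3 then left_var g (space x) (levels x) ((pf x y e + i) * g + (w x y e %/ nth 0 (mkseq (expn g) 6) i) %% g)
   else right_var g (space x) (levels x) ((pf x y e + (i - 3)) * g + (w x y e %/ nth 0 (mkseq (expn g) 6) i) %% g)))).
  by move=> x y e; congr (nat_of_bool (_ && _)); apply: eq_some_lt => i i6; rewrite nth_mkseq.
by rewrite /left_var /right_var /levels /level_size /word_bits; computable.
Qed.

Lemma computable_matrix (c k : fn) b : computable c -> computable k ->
  computable (fun x y e => matrix x (c x y e) (k x y e) b).
Proof.
move=> cc ck; have S := computable_space.
have Z : computable (fun x y e => zmax g (space x)) by rewrite /zmax; computable.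
pose f : fn := fun x y e => c x y e %% 13.
pose t : fn := fun x y e => c x y e %/ 13 %/ zmax g (space x).
pose z : fn := fun x y e => (c x y e %/ 13) %% zmax g (space x).
have cf : computable f by rewrite /f; computable.
have ct : computable t by rewrite /t; computable.
have cz : computable z by rewrite /z; computable.
have cI := computable_start_bad cz.
have cF : computable (fun x y e => end_bad (z x y e)) by rewrite /end_bad; computable.
pose p1 : fn := fun x y e => z x y e %% (space x + 2).
pose w1 : fn := fun x y e => z x y e %/ (space x + 2).
have c1 : computable p1 by rewrite /p1; computable.
have cw1 : computable w1 by rewrite /w1; computable.
have cG : computable (fun x y e => good_table (w1 x y e)) by rewrite /good_table; computable.
have cW := computable_window (~~ b) c1 cw1 ck.
change (computable (fun x y e => clause g (space x) (levels x) (start_bad x) end_bad good_table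
   (f x y e) (t x y e) (z x y e) (k x y e) b)).
rewrite /clause.
rewrite /link_target /link_source /half_var /left_var /right_var /mid_var /levels /level_size /word_bits.
by computable.
Qed.

Lemma computable_points : computable (fun x y e => points x).
Proof.
have S := computable_space.
by rewrite /points /nvars /levels /level_size /word_bits; computable.
Qed.

Lemma computable_edges : computable (fun x y e => edges x).
Proof.
have S := computable_space.
by rewrite /edges /nclauses /zmax /nvars /levels /level_size /word_bits; computable.
Qed.

Lemma computable_incidence (a c : fn) : computable a -> computable c ->
  computable (fun x y e => incidence x (a x y e) (c x y e)).
Proof.
move=> ca cc; have S := computable_space; have P := computable_points.
have k1 : computable (fun x y e => a x y e - points x) by computable.
have k2 : computable (fun x y e => c x y e %/ 4) by computable.
have M0 := computable_matrix false k1 k2; have M1 := computable_matrix true k1 k2.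
rewrite /incidence /incident.
by rewrite /half_turn /in_pair /level_size /word_bits; computable.
Qed.

Definition adjacency (x : seq bool) : nat -> nat -> bool := adjacent (points x) (incidence x).

Lemma computable_adjacency (u v : fn) : computable u -> computable v ->
  computable (fun x y e => adjacency x (u x y e) (v x y e)).
Proof.
move=> cu cv; have P := computable_points.
have block (a : fn) : computable a ->
    computable (fun x y e => (a x y e - (2 + points x)) %/ (2 * points x + 5) - 1).
  by move=> ca; computable.
have point (a : fn) : computable a -> computable (fun x y e => a x y e - 2).
  by move=> ca; computable.
have I1 := computable_incidence (block v cv) (point u cu).
have I2 := computable_incidence (block u cu) (point v cv).
by rewrite /adjacency /adjacent /arc /copies; computable.
Qed.

Definition game_order (x : seq bool) : nat := hyper_order (points x) (edges x).

Lemma polytime_reduction : polytime (fun x => encode (game_graph x) Staller).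
Proof.
have P := computable_points; have E := computable_edges.
have N : computable (fun x y e => game_order x) by rewrite /game_order /hyper_order /copies; computable.
have V0 := computable_var 0.
have L : computable (fun x y e => game_order x + 2 + game_order x * game_order x) by computable.
have q1 : computable (fun x y e => (e 0 - (game_order x + 2)) %/ game_order x) by computable.
have q2 : computable (fun x y e => (e 0 - (game_order x + 2)) %% game_order x) by computable.
have A := computable_adjacency q1 q2.
have b : computable (fun x y e => encoding_bit (game_order x) (adjacency x) (e 0)).
  rewrite /encoding_bit; computable.
have := @polytime_computable _ (fun x j => encoding_bit (game_order x) (adjacency x) j) L b.
congr polytime; apply: functional_extensionality => x.
rewrite (@encode_mkseq (game_graph x) (adjacency x)) //.
by apply: eq_mkseq => j; case: encoding_bit.
Qed.

End Reduction.

(** Replaces a minimum over vertex sets by a condition that bounded quantifiers over the adjacency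
    matrix can test. *)
Lemma gamma_eq1 (G : graph) :
  gamma G = 1 <-> exists u : vertex G, forall v, (u == v) || adj u v.
Proof.
have dom1 (u : vertex G) : dominating [set u] <-> forall v, (u == v) || adj u v.
  split=> [/forallP H v|H].
    have := H v; rewrite inE eq_sym => /orP[->//|/exists_inP[w]].
    by rewrite inE => /eqP-> ->; rewrite orbT.
  apply/forallP => v; rewrite inE eq_sym; case: (u == v) (H v) => //= uv.
  by apply/exists_inP; exists u; rewrite ?inE.
have domT : dominating [set: vertex G] by apply/forallP => v; rewrite inE.
rewrite /gamma; case: arg_minnP => // D domD minD; split=> [/eqP/cards1P[u eD]|[u /dom1 domu]].
  by exists u; apply/dom1; rewrite -eD.
apply/eqP; rewrite eqn_leq -{1}(cards1 u) minD // card_gt0; apply/negP => /eqP D0.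
by move/forallP: domD => /(_ u); rewrite D0 inE => /exists_inP[w]; rewrite inE.
Qed.

Definition has_universal (x : seq bool) : bool :=
  some_lt (coded_order x) (fun u => all_lt (coded_order x) (fun v => (u == v) || coded_edge x u v)).

Lemma has_universalP G first : has_universal (encode G first) <-> gamma G = 1.
Proof.
rewrite gamma_eq1 /has_universal order_encode; split=> [/some_ltP[u un /all_ltP H]|[u H]].
  by exists (Ordinal un) => v; have := H v (ltn_ord v); rewrite (edge_encode first (Ordinal un) v).
apply/some_ltP; exists u => //; apply/all_ltP => v vn.
by rewrite (edge_encode first u (Ordinal vn)); exact: (H (Ordinal vn)).
Qed.

Lemma computable_has_universal : computable (fun x y e => has_universal x).
Proof. have O := computable_coded_order; rewrite /has_universal /coded_edge; computable. Qed.

(** The reduction produces only graphs of domination number one, with Staller first, so it proves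
    hardness for every larger class as well. *)
Lemma PSPACE_hard_class (C : graph -> Prop) : (forall G, gamma G = 1 -> C G) ->
  PSPACE_hard (MB_Dom_Game_on C).
Proof.
move=> C1 A [M [p HM]]; exists (fun x => encode (game_graph M p x) Staller).
split=> [|x]; first exact: polytime_reduction.
have CG : C (game_graph M p x) by apply/C1/gamma_hyper.
have [sp [t [ht acc]]] := HM x.
have W := game_graph_correct sp ht.
split; first by exists (game_graph M p x), Staller.
split=> [/acc/W w|[_ [G [first [e w]]]]].
  by split; exists (game_graph M p x), Staller.
by apply/acc/W; apply: winning_encode w.
Qed.

Theorem proposition2p3 :
  PSPACE_complete MB_Dom_Game /\
  PSPACE_complete (MB_Dom_Game_on (fun G => gamma G = 1)).
Proof.
split; split.
- apply: (@PSPACE_class (fun=> true)) => //; exact: (computable_const 1).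
- exact: PSPACE_hard_class.
- apply: (@PSPACE_class has_universal); first exact: computable_has_universal.
  by move=> G first; apply: has_universalP.
- exact: PSPACE_hard_class.
Qed.
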